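(* There is a deterministic polynomial-time algorithm that, given a configuration $C$ of g-2PATH (in a standard encoding), decides whether $C$ satisfies the condition of noninterference of extensions (CNI).
   Context: Positions are elements of $\mathbb{Z}^2$; with $\epsilon_0=(1,0),\epsilon_1=(0,1),\epsilon_2=(-1,0),\epsilon_3=(0,-1)$, positions $p,p'$ are adjacent if $p'-p$ is some $\epsilon_i$. A configuration of g-2PATH is a sequence $C=p_r\dots p_s$ ($r\le0\le s$) of positions with $p_0=(0,0)$, consecutive positions adjacent, all positions distinct, and $p_l,p_m$ not adjacent whenever $|l-m|\ge2$; it is encoded e.g. by the list of coordinates of $p_r,\dots,p_s$ together with the index of the origin. For $p\in C$, $\mathrm{bc}_C(p)=(b_0,\dots,b_3)$ with $b_i=1$ iff $p+\epsilon_i\in C$. For $r\le i\le0\le j\le s$: $W(i,j)$ is the set of pairs $(x_0,x_1)$ of finite, possibly empty, sequences of positions such that $x_0p_i\dots p_jx_1$ is a configuration $C'$ of g-2PATH (general at $p_0$) with $\mathrm{bc}_{C'}(p_l)=\mathrm{bc}_C(p_l)$ for $i\le l\le j$; $U(i,j)$, $V(i,j)$ are the sets of first, resp. second, components of its elements. $\mathrm{NI}(i,j)$ means $W(i,j)=U(i,j)\times V(i,j)$. $I=\{(i,j): r\le i-1,\ W(i,j)$ infinite, $W(i-1,j)$ finite$\}$, $J=\{(i,j): j+1\le s,\ W(i,j)$ infinite, $W(i,j+1)$ finite$\}$, $K=\{(i,j): W(i,j)$ finite$\}$. $C$ satisfies CNI if $\mathrm{NI}(i,j)$ holds for all $(i,j)\in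 I\cup J\cup K$. *)

(* Defs.v *)
From mathcomp Require Import all_boot all_order all_algebra.
Set Implicit Arguments. Unset Strict Implicit. Unset Printing Implicit Defensive.
Import GRing.Theory Num.Theory.
Local Open Scope ring_scope.

Definition pos := (int * int)%type.

Definition eps : seq pos := [:: (1, 0); (0, 1); (-1, 0); (0, -1)].

Definition padd (p e : pos) : pos := (p.1 + e.1, p.2 + e.2).

Definition adj (p p' : pos) : bool := (p'.1 - p.1, p'.2 - p.2) \in eps.

(* A configuration p_r ... p_s is represented by the list
   ps = [:: p_r; ...; p_s] together with the (natural) index o = -r of the
   origin p_0 in that list; the paper's p_l is  nth (0,0) ps (l + o). *)
Definition is_config (ps : seq pos) (o : nat) : Prop :=
  [/\ (o < size ps)%N,
      nth (0, 0) ps o = (0, 0),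
      (forall l : nat, (l.+1 < size ps)%N ->
          adj (nth (0,0) ps l) (nth (0,0) ps l.+1)),
      uniq ps &
      (forall l m : nat, (l < size ps)%N -> (m < size ps)%N -> (l + 2 <= m)%N ->
          ~~ adj (nth (0,0) ps l) (nth (0,0) ps m))].

Definition bc (ps : seq pos) (p : pos) : seq bool :=
  [seq (padd p e \in ps) | e <- eps].

Definition seg (ps : seq pos) (i j : nat) : seq pos := take (j - i).+1 (drop i ps).

(* W(i,j) (natural indices i <= o <= j < size ps): pairs (x0, x1) such that
   x0 p_i...p_j x1 is a configuration (with p_0 still the origin) and the
   bc of each p_l, i <= l <= j, is unchanged. *)
Definition W (ps : seq pos) (o i j : nat) (x : seq pos * seq pos) : Prop :=
  let C' := x.1 ++ seg ps i j ++ x.2 in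
  is_config C' (size x.1 + (o - i)) /\
  (forall l : nat, (i <= l <= j)%N ->
     bc C' (nth (0,0) ps l) = bc ps (nth (0,0) ps l)).

Definition U ps o i j (x0 : seq pos) : Prop := exists x1, W ps o i j (x0, x1).
Definition V ps o i j (x1 : seq pos) : Prop := exists x0, W ps o i j (x0, x1).

Definition finite_set (P : seq pos * seq pos -> Prop) : Prop :=
  exists s : seq (seq pos * seq pos), forall x, P x -> x \in s.

Definition NI ps o i j : Prop :=
  forall x0 x1, U ps o i j x0 -> V ps o i j x1 -> W ps o i j (x0, x1).

Definition valid_ij (ps : seq pos) (o i j : nat) : Prop :=
  (i <= o)%N /\ (o <= j)%N /\ (j < size ps)%N.

Definition in_I ps o i j : Prop :=
  (1 <= i)%N /\ ~ finite_set (W ps o i j) /\ finite_set (W ps o i.-1 j).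
Definition in_J ps o i j : Prop :=
  (j.+1 < size ps)%N /\ ~ finite_set (W ps o i j) /\ finite_set (W ps o i j.+1).
Definition in_K ps o i j : Prop := finite_set (W ps o i j).

Definition CNI (ps : seq pos) (o : nat) : Prop :=
  forall i j : nat, valid_ij ps o i j ->
    in_I ps o i j \/ in_J ps o i j \/ in_K ps o i j -> NI ps o i j.

Inductive isym := I0 | I1 | IMinus | IComma.

(* tape alphabet: blank (None), input symbols, and G extra work symbols *)
Definition tsym (G : nat) := option (isym + 'I_G)%type.

Inductive move := MoveL | MoveR | Stay.

Record TM := {
  nQ : nat;
  nG : nat;
  start : 'I_nQ;
  halt : 'I_nQ -> option bool;
  delta : 'I_nQ -> tsym nG -> 'I_nQ * tsym nG * move
}.
Arguments start : clear implicits.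
Arguments halt : clear implicits.
Arguments delta : clear implicits.

(* state, left part (nearest cell first), scanned symbol, right part *)
Definition tmconf (M : TM) := ('I_(nQ M) * seq (tsym (nG M)) * tsym (nG M)
                               * seq (tsym (nG M)))%type.

Definition tm_init (M : TM) (w : seq isym) : tmconf M :=
  let t := [seq Some (inl a) : tsym (nG M) | a <- w] in
  match t with
  | [::] => (start M, [::], None, [::])
  | a :: r => (start M, [::], a, r)
  end.

Definition tm_step (M : TM) (c : tmconf M) : tmconf M :=
  let: (q, l, a, r) := c in
  match halt M q with
  | Some _ => c
  | None =>
    let: (q', b, m) := delta M q a in
    match m with
    | Stay => (q', l, b, r)
    | MoveL => match l with
               | [::] => (q', [::], None, b :: r)
               | x :: l' => (q', l', x, b :: r)
               end
    | MoveR => match r with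
               | [::] => (q', b :: l, None, [::])
               | x :: r' => (q', b :: l, x, r')
               end
    end
  end.

Definition tm_run (M : TM) (t : nat) (w : seq isym) : tmconf M :=
  iter t (tm_step (M:=M)) (tm_init M w).

Definition tm_state (M : TM) (c : tmconf M) : 'I_(nQ M) := c.1.1.1.

Fixpoint binf (fuel n : nat) : seq isym :=
  match fuel with
  | 0 => [::]
  | f.+1 => if n is 0 then [::] else (if odd n then I1 else I0) :: binf f n./2
  end.
Definition bin (n : nat) : seq isym := binf n n.

Definition enc_int (z : int) : seq isym :=
  match z with
  | Posz n => bin n
  | Negz n => IMinus :: bin n.+1
  end.

Definition enc_config (ps : seq pos) (o : nat) : seq isym :=
  bin o ++ IComma ::
  flatten [seq enc_int p.1 ++ IComma :: enc_int p.2 ++ [:: IComma] | p <- ps].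

(* Main.v *)
(* The set W(i,j) with i < j is governed by two regions: L, the cells connected to p_(i-1) outside
   the neighbourhood of p_i ... p_(j+1), and R, the cells connected to p_(j+1) outside the
   neighbourhood of p_(i-1) ... p_j.  Since walks can be shortened to induced paths, every cell of
   L (R) lies on a left (right) extension.  Hence W(i,j) is finite iff neither region contains a
   fixed far away cell, and NI(i,j) holds iff no cell of L is equal or adjacent to a cell of R; both
   can be tested inside a box of linear size.  For i = j the two neighbours of the origin can be
   exchanged, so that NI fails as soon as there is a second position; finiteness being monotone in
   (i,j), CNI becomes a condition on pairs i < j only.

   The test is a nesting of loops over numbers bounded by a quadratic polynomial of the input size,
   plus one array of marks for reachability.  Such loops are run by a machine with several heads on
   one tape, the position of a head being the value of a counter, and a multi-head machine is
   simulated by a Turing machine that writes the heads present on a cell into its symbol. *)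
Require Import Defs.
From mathcomp Require Import all_boot all_order all_algebra.
From HB Require Import structures.
From mathcomp Require Import zify.
Set Implicit Arguments. Unset Strict Implicit. Unset Printing Implicit Defensive.
Import Order.TTheory GRing.Theory Num.Theory.

(** * Multi-head programs and their simulation by a Turing machine *)

(** The obstacle is that W(i,j) ranges over sequences of unbounded length. For i < j the segment has
    a second cell, so the [bc] of its two end cells forces p_(i-1) and p_(j+1), where they exist, to
    remain the next cells of every extension. The further cells then do not touch the segment, and
    the conditions on [bc] turn into conditions on induced paths. Binary notation could hide
    exponentially large coordinates, but a configuration passes through the origin, so its
    coordinates are smaller than its length. With M one more than the input length, all positions
    lie strictly inside the box of radius M-1, and the cells outside the box of radius M are free
    and connected to each other. The grid has side 2M+1 <= 3M, hence at most 9M^2 cells. This number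
    is the cap at which arithmetic saturates and also the number of rounds of marking. The argument
    stays constructive: the case distinction on finiteness that the reduction to i < j needs is
    supplied by the correctness of the finiteness test itself. *)

Inductive test :=
  TLt (a b : nat) | TPos (r : nat) | TNSym (r : nat) (x : 'I_5) | TBit (r : nat).

Inductive cmd :=
  | Skip | Inc (r : nat) | Clr (r : nat) | SetB (r : nat) (b : bool)
  | Seq (c1 c2 : cmd) | If (t : test) (c1 c2 : cmd) | While (t : test) (c : cmd)
  | Stop (b : bool).

Lemma test_comparable : comparable test.
Proof. by move=> x y; rewrite /decidable; decide equality; apply: eq_comparable. Qed.

HB.instance Definition _ := hasDecEq.Build test (compareP test_comparable).

Lemma cmd_comparable : comparable cmd.
Proof. by move=> x y; rewrite /decidable; decide equality; apply: eq_comparable. Qed.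

HB.instance Definition _ := hasDecEq.Build cmd (compareP cmd_comparable).

(* [hd r] is the value of counter [r] and the position of head [r]; [bt p] is the mark on cell [p]. *)
Record store := Store { hd : nat -> nat; bt : nat -> bool }.

Definition upd (T : Type) (f : nat -> T) (r : nat) (v : T) : nat -> T :=
  fun r' => if r' == r then v else f r'.

Definition inc s r := Store (upd (hd s) r (hd s r).+1) (bt s).
Definition clr s r := Store (upd (hd s) r 0) (bt s).
Definition setb s r b := Store (hd s) (upd (bt s) (hd s r) b).

Section Semantics.
Variable w : nat -> 'I_5.

Definition tst (t : test) (s : store) : bool :=
  match t with
  | TLt a b => hd s a < hd s b
  | TPos r => 0 < hd s r
  | TNSym r x => w (hd s r) != x
  | TBit r => bt s (hd s r)
  end.

Definition kstep (ks : seq cmd * store) : seq cmd * store :=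
  let: (k, s) := ks in
  if k is c :: k' then
    match c with
    | Skip => (k', s)
    | Inc r => (k', inc s r)
    | Clr r => (k', clr s r)
    | SetB r b => (k', setb s r b)
    | Seq a b => ([:: a, b & k'], s)
    | If t a b => ((if tst t s then a else b) :: k', s)
    | While t a => (if tst t s then a :: k else k', s)
    | Stop b => (k, s)
    end
  else (k, s).
End Semantics.

Definition test_regs (t : test) : seq nat :=
  match t with
  | TLt a b => [:: a; b]
  | TPos r => [:: r]
  | TNSym r _ => [:: r]
  | TBit r => [:: r]
  end.

Fixpoint regs (c : cmd) : seq nat :=
  match c with
  | Skip | Stop _ => [::]
  | Inc r | Clr r | SetB r _ => [:: r]
  | Seq a b => regs a ++ regs b
  | If t a b => test_regs t ++ regs a ++ regs b
  | While t a => test_regs t ++ regs a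
  end.

(* The finitely many continuations reachable from [c :: k]; they are the control states. *)
Fixpoint conts (c : cmd) (k : seq cmd) : seq (seq cmd) :=
  (c :: k) ::
  match c with
  | Seq a b => conts a (b :: k) ++ conts b k
  | If _ a b => conts a k ++ conts b k
  | While _ a => conts a (c :: k)
  | _ => [::]
  end.

Lemma conts_head c k : c :: k \in conts c k.
Proof. by case: c => *; rewrite /= inE eqxx. Qed.

Definition succs (k : seq cmd) : seq (seq cmd) :=
  if k is c :: k' then
    match c with
    | Seq a b => [:: [:: a, b & k']]
    | If _ a b => [:: a :: k'; b :: k']
    | While _ a => [:: a :: k; k']
    | Stop _ => [:: k]
    | _ => [:: k']
    end
  else [:: k].

Lemma conts_closed c k x y :
  x \in conts c k -> y \in succs x -> (y \in conts c k) || (y == k).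
Proof.
elim: c k => [|r|r|r b|a IHa b IHb|t a IHa b IHb|t a IHa|b] k /=;
  rewrite ?inE ?mem_cat.
- by move/eqP=> -> /=; rewrite !inE => ->; rewrite orbT.
- by move/eqP=> -> /=; rewrite !inE => ->; rewrite orbT.
- by move/eqP=> -> /=; rewrite !inE => ->; rewrite orbT.
- by move/eqP=> -> /=; rewrite !inE => ->; rewrite orbT.
- case/or3P=> [/eqP-> /=|/IHa h /h|/IHb h /h].
  + by rewrite inE => /eqP->; rewrite conts_head orbT.
  + by case/orP=> [->|/eqP->]; rewrite ?conts_head !orbT.
  + by case/orP=> ->; rewrite !orbT.
- case/or3P=> [/eqP-> /=|/IHa h /h|/IHb h /h].
  + by rewrite !inE => /orP[] /eqP->; rewrite conts_head !orbT.
  + by case/orP=> ->; rewrite !orbT.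
  + by case/orP=> ->; rewrite !orbT.
- case/orP=> [/eqP-> /=|/IHa h /h].
  + by rewrite !inE => /orP[] /eqP->; rewrite ?conts_head ?eqxx !orbT.
  + by case/orP=> ->; rewrite ?orbT.
- by move/eqP=> -> /=; rewrite !inE => ->.
Qed.

Definition kregs (k : seq cmd) : seq nat := flatten (map regs k).

(* A command is executed by walking right from the origin to the head it uses ([Seek]), acting
   there, possibly on the next cell ([Put]) or on the origin ([BackPut]), and walking back. *)
Inductive phase := Init | Seek | Put | BackPut | Rewind.

Lemma phase_comparable : comparable phase.
Proof. by move=> x y; rewrite /decidable; decide equality. Qed.

HB.instance Definition _ := hasDecEq.Build phase (compareP phase_comparable).

(** * Control states and transitions of the simulating machine *)

Section Machine.
Variables (prog : cmd) (R : nat).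

(* symbol, mark bit, heads present on the cell, "is the origin" *)
Definition cell : finType := ('I_5 * bool * {ffun 'I_R.+1 -> bool} * bool)%type.

Definition csym (c : cell) := c.1.1.1.
Definition cbit (c : cell) := c.1.1.2.
Definition has_hd (r : nat) (c : cell) := c.1.2 (inord r).
Definition corig (c : cell) := c.2.

Definition set_hd (r : nat) (v : bool) (c : cell) : cell :=
  (c.1.1, [ffun i => if i == inord r then v else c.1.2 i], c.2).
Definition set_bit (v : bool) (c : cell) : cell := (csym c, v, c.1.2, c.2).
(** All counters start at 0, so all heads start on the origin. *)
Definition to_origin (c : cell) : cell := (c.1.1, [ffun=> true], true).

Definition sym_code (a : isym) : 'I_5 :=
  match a with
  | I0 => inord 1 | I1 => inord 2 | IMinus => inord 3 | IComma => inord 4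
  end.

(** Blanks and raw input symbols already count as cells without heads or marks, so the input need
    not be recoded before the simulation starts. *)
Definition cdec (x : tsym #|cell|) : cell :=
  match x with
  | None => (ord0, false, [ffun=> false], false)
  | Some (inl a) => (sym_code a, false, [ffun=> false], false)
  | Some (inr g) => enum_val g
  end.
Definition cenc (c : cell) : tsym #|cell| := Some (inr (enum_rank c)).

Lemma cencK c : cdec (cenc c) = c.
Proof. by rewrite /= enum_rankK. Qed.

(** On the walk to the right a comparison is decided by the first of its two heads that is met. Head
    [b] is looked at first, so that a tie yields false. *)
Definition ctst (t : test) (c : cell) : option bool :=
  match t with
  | TLt a b => if has_hd b c then Some false
               else if has_hd a c then Some true else None
  | TPos r => if has_hd r c then Some (~~ corig c) else None
  | TNSym r x => if has_hd r c then Some (csym c != x) else None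
  | TBit r => if has_hd r c then Some (cbit c) else None
  end.

Definition ctl := (seq cmd * phase)%type.

Definition cdelta (q : ctl) (c : cell) : ctl * cell * move :=
  let right := (q, c, MoveR) in
  match q.2 with
  | Init => ((q.1, Seek), to_origin c, Stay)
  | Seek =>
    if q.1 is x :: k then
      match x with
      | Skip => ((k, Seek), c, Stay)
      | Inc r => if has_hd r c then ((q.1, Put), set_hd r false c, MoveR) else right
      | Clr r => if has_hd r c then ((q.1, BackPut), set_hd r false c, Stay) else right
      | SetB r b => if has_hd r c then ((k, Rewind), set_bit b c, Stay) else right
      | Seq a b => (([:: a, b & k], Seek), c, Stay)
      | If t a b => if ctst t c is Some v
                    then (((if v then a else b) :: k, Rewind), c, Stay) else right
      | While t a => if ctst t c is Some v
                     then ((if v then a :: q.1 else k, Rewind), c, Stay) else right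
      | Stop b => (q, c, Stay)
      end
    else (q, c, Stay)
  | Put => if q.1 is Inc r :: k then ((k, Rewind), set_hd r true c, Stay)
           else (q, c, Stay)
  | BackPut => if corig c then
                 if q.1 is Clr r :: k then ((k, Seek), set_hd r true c, Stay)
                 else (q, c, Stay)
               else (q, c, MoveL)
  | Rewind => if corig c then ((q.1, Seek), c, Stay) else (q, c, MoveL)
  end.

Definition chalt (q : ctl) : option bool :=
  match q with
  | (Stop b :: _, Seek) => Some b
  | _ => None
  end.

Definition kont := [::] :: conts prog [::].
Definition ctls : seq ctl :=
  [seq (k, ph) | k <- kont, ph <- [:: Init; Seek; Put; BackPut; Rewind]].

Definition qdec (q : 'I_(size ctls).+1) : ctl := nth ([::], Init) ctls q.
Definition qenc (q : ctl) : 'I_(size ctls).+1 := inord (index q ctls).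

Lemma qencK q : q \in ctls -> qdec (qenc q) = q.
Proof.
move=> h; rewrite /qdec /qenc inordK ?nth_index //.
by rewrite ltnS index_size.
Qed.

Lemma mem_ctls q : (q \in ctls) = (q.1 \in kont).
Proof.
case: q => k ph; apply/allpairsP/idP => [[[k' ph'] /= [h _ [-> _]]] //|h].
by exists (k, ph); split=> //; clear h; case: ph; rewrite !inE eqxx ?orbT.
Qed.

Lemma kont_succ k y : k \in kont -> y \in succs k -> y \in kont.
Proof.
rewrite /kont !inE; case/orP=> [/eqP->|h] /=; first by rewrite inE => /eqP->.
by move/(conts_closed h); rewrite orbC.
Qed.

Lemma cdelta_ctls q c : q \in ctls -> (cdelta q c).1.1 \in ctls.
Proof.
case: q => k ph h; move: (h); rewrite !mem_ctls /= => hk.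
have S y : y \in succs k -> y \in kont by apply: kont_succ.
rewrite /cdelta /=; clear h; case: ph => //=.
- case: k hk S => [|x k] hk S //=; case: x hk S => [|r|r|r b|a b|t a b|t a|b] hk S //=;
    try case: (has_hd _ _) => //=; try case: (ctst _ _) => [[]|] //=;
    by apply: S; rewrite !inE ?eqxx ?orbT.
- case: k hk S => [|x k] hk S //=; case: x hk S => [|r|r|r b|a b|t a b|t a|b] hk S //=;
    by apply: S; rewrite !inE ?eqxx ?orbT.
- case: (corig c) => //=.
  case: k hk S => [|x k] hk S //=; case: x hk S => [|r|r|r b|a b|t a b|t a|b] hk S //=;
    by apply: S; rewrite !inE ?eqxx ?orbT.
- by case: (corig c).
Qed.

Definition machine : TM :=
  {| nQ := (size ctls).+1;
     nG := #|cell|;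
     start := qenc ([:: prog], Init);
     halt := fun q => chalt (qdec q);
     delta := fun q x =>
       let: (q', c, m) := cdelta (qdec q) (cdec x) in (qenc q', cenc c, m) |}.

Notation tape_conf := (tmconf machine).

(* the cell at position [i] >= 0 of the tape; cells left of the input are never visited *)
Definition tape_at (c : tape_conf) (i : nat) : cell :=
  cdec (nth None (rev c.1.1.2 ++ c.1.2 :: c.2) i).
Definition head_at (c : tape_conf) : nat := size c.1.1.2.
Definition ctl_at (c : tape_conf) : ctl := qdec c.1.1.1.

Definition represents (c : tape_conf) (q : ctl) (p : nat) (f : nat -> cell) :=
  [/\ ctl_at c = q, head_at c = p & tape_at c =1 f].

(** Isolates the scanned cell: the cells elsewhere do not depend on [a], so a step of the machine is
    an update at one position. *)
Lemma nth_zip (T : Type) (x0 : T) (l r : seq T) a i :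
  nth x0 (rev l ++ a :: r) i =
  if i == size l then a else nth x0 (rev l ++ x0 :: r) i.
Proof.
rewrite !nth_cat size_rev; case: (ltngtP i (size l)) => // [h|->]; last by rewrite subnn.
by move: h; rewrite -subn_gt0; case: (i - size l).
Qed.

(** The last hypothesis keeps the head on the tape: a left move from position 0 would insert a blank
    and shift all positions. *)
Lemma step_represents c q p f q' b m :
  represents c q p f -> chalt q = None -> q \in ctls ->
  cdelta q (f p) = (q', b, m) -> (m = MoveL -> 0 < p) ->
  represents (tm_step c) q'
    (match m with MoveL => p.-1 | MoveR => p.+1 | Stay => p end) (upd f p b).
Proof.
case: c => [[[s l] a] r] [/= hq hp hf] hh qin hd hL.
have ea : f p = cdec a.
  by rewrite -hf /tape_at /= nth_zip -hp /head_at /= eqxx.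
have q'in : q' \in ctls by have := cdelta_ctls (f p) qin; rewrite hd.
have hu i : cdec (nth None (rev l ++ cenc b :: r) i) = upd f p b i.
  rewrite nth_zip /upd -hp /head_at /=; case: eqP => [_|ne]; first exact: cencK.
  by rewrite -hf /tape_at /=; congr cdec; rewrite [RHS]nth_zip; case: eqP ne.
rewrite /tm_step /=; change (qdec s = q) in hq; rewrite hq hh -ea hd.
case: m hd hL => _ hL; last by split=> //; exact: qencK.
- case: l hp hf hu => [|x l] hp hf hu; first by have := hL erefl; rewrite -hp.
  split=> /=; [exact: qencK|by rewrite -hp|].
  by move=> i; rewrite -hu /tape_at /= rev_cons cat_rcons.
- case: r hp hf hu => [|x r] hp hf hu; (split; first exact: qencK);
    try (by rewrite /head_at /= -hp); move=> i; rewrite -hu /tape_at /= rev_cons cat_rcons //.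
  congr cdec; rewrite !nth_cat; case: ltnP => // _.
  by case: (i - _) => // -[|k] //=; rewrite nth_nil.
Qed.


Lemma represents_eq c q p f g : f =1 g -> represents c q p f -> represents c q p g.
Proof. by move=> e [h1 h2 h3]; split=> // i; rewrite h3. Qed.

(** For the walking phases, in which only the head moves; [u] is its trajectory. *)
Lemma iter_represents n c (q : ctl) f (u : nat -> nat) :
  q \in ctls -> chalt q = None ->
  (forall i, i < n -> exists m, [/\ cdelta q (f (u i)) = (q, f (u i), m),
     (m = MoveL -> 0 < u i) &
     u i.+1 = match m with MoveL => (u i).-1 | MoveR => (u i).+1 | Stay => u i end]) ->
  represents c q (u 0) f -> represents (iter n (@tm_step machine) c) q (u n) f.
Proof.
move=> hq hh; elim: n => [|n IH] hs h0 //.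
have /IH/(_ h0) h : forall i, i < n -> exists m, [/\ cdelta q (f (u i)) = (q, f (u i), m),
     (m = MoveL -> 0 < u i) &
     u i.+1 = match m with MoveL => (u i).-1 | MoveR => (u i).+1 | Stay => u i end].
  by move=> i hi; apply: hs; lia.
have [m [h1 h2 h3]] := hs n (leqnn _).
have := step_represents h hh hq h1 h2; rewrite -h3 /=; apply: represents_eq.
by move=> i; rewrite /upd; case: eqP => [->|].
Qed.

Lemma chalt_rewind k : chalt (k, Rewind) = None.
Proof. by case: k => [|[]]. Qed.

Lemma chalt_put k : chalt (k, Put) = None.
Proof. by case: k => [|[]]. Qed.

Lemma chalt_backput k : chalt (k, BackPut) = None.
Proof. by case: k => [|[]]. Qed.

Lemma rewind_represents c k p f :
  (k, Rewind) \in ctls -> (forall i, corig (f i) = (i == 0)) ->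
  represents c (k, Rewind) p f ->
  represents (iter p.+1 (@tm_step machine) c) (k, Seek) 0 f.
Proof.
move=> hq ho h.
have h0 : represents (iter p (@tm_step machine) c) (k, Rewind) (p - p) f.
  apply: (iter_represents (u := fun i => p - i)) => //; last by rewrite subn0.
    exact: chalt_rewind.
  move=> i hi; exists MoveL; rewrite /cdelta /= ho.
  have /negbTE-> : p - i != 0 by lia.
  by split=> //; lia.
rewrite subnn in h0.
have hd : cdelta (k, Rewind) (f 0) = ((k, Seek), f 0, Stay) by rewrite /cdelta /= ho.
rewrite iterS.
have := step_represents h0 (chalt_rewind k) hq hd (fun e : Stay = MoveL => match e with end).
by apply: represents_eq => i; rewrite /upd; case: eqP => [->|].
Qed.

(** * Simulation of program steps *)

Section Simulation.
Variable w : nat -> 'I_5.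

Definition cells (s : store) (i : nat) : cell :=
  (w i, bt s i, [ffun r : 'I_R.+1 => hd s r == i], i == 0).

Lemma has_hd_cells s i r : r <= R -> has_hd r (cells s i) = (hd s r == i).
Proof. by move=> h; rewrite /has_hd /cells /= ffunE inordK. Qed.

Definition simulates (c : tape_conf) (ks : seq cmd * store) :=
  represents c (ks.1, Seek) 0 (cells ks.2).

Lemma seek_represents c k s p :
  (k, Seek) \in ctls ->  chalt (k, Seek) = None ->
  (forall i, i < p -> cdelta (k, Seek) (cells s i) = ((k, Seek), cells s i, MoveR)) ->
  simulates c (k, s) ->
  represents (iter p (@tm_step machine) c) (k, Seek) p (cells s).
Proof.
move=> hq hh hs h; apply: (iter_represents (u := id)) => //.
by move=> i hi; exists MoveR; split=> //; apply: hs.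
Qed.

Lemma act_simulates c k s p k' b :
  (k, Seek) \in ctls -> chalt (k, Seek) = None -> k' \in kont ->
  (forall i, i < p -> cdelta (k, Seek) (cells s i) = ((k, Seek), cells s i, MoveR)) ->
  cdelta (k, Seek) (cells s p) = ((k', Rewind), b, Stay) ->
  corig b = (p == 0) ->
  simulates c (k, s) ->
  represents (iter (p.+1 + p.+1) (@tm_step machine) c) (k', Seek) 0 (upd (cells s) p b).
Proof.
move=> hq hh hk hs hp hb h; have h1 := seek_represents hq hh hs h.
have h2 := step_represents h1 hh hq hp (fun e : Stay = MoveL => match e with end).
rewrite iterD; apply: rewind_represents; rewrite ?mem_ctls //.
by move=> i; rewrite /upd; case: eqP => [->|].
Qed.

Definition test_pos (t : test) (s : store) : nat :=
  match t with
  | TLt a b => minn (hd s a) (hd s b)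
  | TPos r | TNSym r _ | TBit r => hd s r
  end.

Lemma ctst_before t s i : all (leq^~ R) (test_regs t) -> i < test_pos t s ->
  ctst t (cells s i) = None.
Proof.
case: t => [a b|r|r x|r] /=; rewrite ?andbT => hR hi.
- case/andP: hR => ha hb; rewrite !has_hd_cells //.
  by do 2?case: eqP => //; lia.
- by rewrite has_hd_cells //; case: eqP => //; lia.
- by rewrite has_hd_cells //; case: eqP => //; lia.
- by rewrite has_hd_cells //; case: eqP => //; lia.
Qed.

Lemma ctst_at t s : all (leq^~ R) (test_regs t) ->
  ctst t (cells s (test_pos t s)) = Some (tst w t s).
Proof.
case: t => [a b|r|r x|r] /=; rewrite ?andbT => hR.
- case/andP: hR => ha hb; rewrite !has_hd_cells //.
  by case: (ltngtP (hd s a) (hd s b)) => h; do 2?case: eqP => //; lia.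
- by rewrite has_hd_cells // eqxx /cells /corig /= lt0n.
- by rewrite has_hd_cells // eqxx.
- by rewrite has_hd_cells // eqxx.
Qed.

Lemma test_pos_le t s H : all (leq^~ R) (test_regs t) ->
  (forall r, r <= R -> hd s r <= H) -> test_pos t s <= H.
Proof.
case: t => [a b|r|r x|r] /=; rewrite ?andbT => hR hH; try exact: hH.
by case/andP: hR => /hH ha /hH hb; lia.
Qed.

Definition rm (r : nat) (p : nat) (f : nat -> cell) := upd f p (set_hd r false (f p)).
Definition add (r : nat) (p : nat) (f : nat -> cell) := upd f p (set_hd r true (f p)).

Lemma cells_upd s r v : r <= R ->
  add r v (rm r (hd s r) (cells s)) =1 cells (Store (upd (hd s) r v) (bt s)).
Proof.
move=> hr i.
have hi (r' : 'I_R.+1) : (r' == inord r) = (nat_of_ord r' == r) by rewrite -val_eqE /= inordK.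
suff hh : (add r v (rm r (hd s r) (cells s)) i).1.2 =
    [ffun r' : 'I_R.+1 => upd (hd s) r v r' == i].
  rewrite [RHS]/cells /= -hh /add /rm /upd /set_hd /cells.
  by case: (i =P v) => [->|nv]; case: eqP => [->|].
apply/ffunP => r'; rewrite /add /rm /upd /set_hd [RHS]ffunE.
case: (nat_of_ord r' =P r) => [e|ne]; case: (i =P v) => [->|nv];
  case: eqP => [?|?]; rewrite /= ?ffunE ?hi ?e ?eqxx //=;
  do ?[case: eqP => ? /=] => //; try lia.
all: rewrite ?ffunE ?hi ?e ?eqxx //=; do ?[case: eqP => ? /=] => //; try lia.
Qed.

(** Each command costs at most a walk to one head and back. The longest is [Inc], which also visits
    the next cell and takes [2 * hd s r + 4] steps. *)
Lemma simulates_kstep c k s H :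
  k \in kont -> all (leq^~ R) (kregs k) -> (forall r, r <= R -> hd s r <= H) ->
  simulates c (k, s) ->
  exists2 m, m <= 2 * H + 6 & simulates (iter m (@tm_step machine) c) (kstep w (k, s)).
Proof.
move=> hk; have hq k' ph : k' \in kont -> (k', ph) \in ctls by rewrite mem_ctls.
have hs y : y \in succs k -> y \in kont by apply: kont_succ.
case: k hk hs => [|x k] hk hs hR hH h; first by exists 0.
have {}hq ph : (x :: k, ph) \in ctls by apply: hq.
have stay y : chalt (x :: k, Seek) = None ->
    cdelta (x :: k, Seek) (cells s 0) = ((y, Seek), cells s 0, Stay) ->
    simulates (tm_step c) (y, s).
  move=> hh hd; have := step_represents h hh (hq _) hd
     (fun e : Stay = MoveL => match e with end).
  by apply: represents_eq => i; rewrite /upd; case: eqP => [->|].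
have test_ok t y : chalt (x :: k, Seek) = None -> y \in kont ->
    all (leq^~ R) (test_regs t) ->
    (forall i, ctst t (cells s i) = None ->
      cdelta (x :: k, Seek) (cells s i) = ((x :: k, Seek), cells s i, MoveR)) ->
    (forall i, ctst t (cells s i) = Some (tst w t s) ->
      cdelta (x :: k, Seek) (cells s i) = ((y, Rewind), cells s i, Stay)) ->
    exists2 m, m <= 2 * H + 6 & simulates (iter m (@tm_step machine) c) (y, s).
  move=> hh hy ht h1 h2; exists ((test_pos t s).+1 + (test_pos t s).+1).
    by have := test_pos_le ht hH; lia.
  have hp := h2 _ (ctst_at s ht).
  have := act_simulates (hq _) hh hy _ hp (erefl _) h.
  move=> H0; apply: represents_eq (H0 _) => [i|i /(ctst_before ht)/h1 //].
  by rewrite /upd; case: eqP => [->|].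
case: x hk hq hs hR h stay test_ok => [|r|r|r b|a1 a2|t a1 a2|t a1|b]
  hk hq hs /= hR h stay test_ok.
- by exists 1; [lia|apply: (stay k)].
- case/andP: hR => hr _; exists ((hd s r).+2 + (hd s r).+2); first by have := hH r hr; lia.
  have hsk i : i < hd s r ->
      cdelta (Inc r :: k, Seek) (cells s i) = ((Inc r :: k, Seek), cells s i, MoveR).
    by move=> hi; rewrite /cdelta /= has_hd_cells //; case: eqP => //; lia.
  have h1 := seek_represents (hq _) erefl hsk h.
  have hp1 : cdelta (Inc r :: k, Seek) (cells s (hd s r)) =
      ((Inc r :: k, Put), set_hd r false (cells s (hd s r)), MoveR).
    by rewrite /cdelta /= has_hd_cells // eqxx.
  have h2 := step_represents h1 erefl (hq _) hp1 (fun e : MoveR = MoveL => match e with end).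
  have h3 := step_represents h2 (chalt_put _) (hq _) erefl
     (fun e : Stay = MoveL => match e with end).
  rewrite iterD; apply: represents_eq (rewind_represents _ _ h3).
  + exact: cells_upd.
  + by rewrite mem_ctls; apply: hs; rewrite inE.
  + by move=> i; rewrite /upd; do 2?case: eqP => [->|] //.
- case/andP: hR => hr _; exists ((hd s r).+1 + (hd s r).+1); first by have := hH r hr; lia.
  have hsk i : i < hd s r ->
      cdelta (Clr r :: k, Seek) (cells s i) = ((Clr r :: k, Seek), cells s i, MoveR).
    by move=> hi; rewrite /cdelta /= has_hd_cells //; case: eqP => //; lia.
  have h1 := seek_represents (hq _) erefl hsk h.
  have hp1 : cdelta (Clr r :: k, Seek) (cells s (hd s r)) =
      ((Clr r :: k, BackPut), set_hd r false (cells s (hd s r)), Stay).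
    by rewrite /cdelta /= has_hd_cells // eqxx.
  have := step_represents h1 erefl (hq _) hp1 (fun e : Stay = MoveL => match e with end).
  set f := upd _ _ _ => h2.
  have ho i : corig (f i) = (i == 0) by rewrite /f /upd; case: eqP => [->|].
  have h3 : represents (iter (hd s r) (@tm_step machine)
      (iter (hd s r).+1 (@tm_step machine) c)) (Clr r :: k, BackPut) (hd s r - hd s r) f.
    apply: (iter_represents (u := fun i => hd s r - i)) => //; last by rewrite subn0.
    move=> i hi; exists MoveL; rewrite /cdelta /= ho.
    have /negbTE-> : hd s r - i != 0 by lia.
    by split=> //; lia.
  rewrite subnn in h3.
  have hp3 : cdelta (Clr r :: k, BackPut) (f 0) = ((k, Seek), set_hd r true (f 0), Stay).
    by rewrite /cdelta /= ho.
  have := step_represents h3 (chalt_backput _) (hq _) hp3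
     (fun e : Stay = MoveL => match e with end).
  have -> : iter ((hd s r).+1 + (hd s r).+1) (@tm_step machine) c =
      tm_step (iter (hd s r) (@tm_step machine) (iter (hd s r).+1 (@tm_step machine) c)).
    by rewrite addSn iterS iterD.
  by apply: represents_eq; apply: cells_upd.
- case/andP: hR => hr _; exists ((hd s r).+1 + (hd s r).+1); first by have := hH r hr; lia.
  have := @act_simulates c (SetB r b :: k) s (hd s r) k (set_bit b (cells s (hd s r)))
    (hq _) erefl (hs _ _) _ _ _ h.
  rewrite inE eqxx /cdelta /= has_hd_cells // eqxx => H0.
  apply: represents_eq (H0 _ _ _ _) => // [i|i hi].
    rewrite /cells /setb /set_bit /upd /=; case: (i =P hd s r) => [->|ne] /=; rewrite ?eqxx //; by case: eqP ne.
  by rewrite has_hd_cells //; case: eqP => //; lia.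
- by exists 1; [lia|apply: (stay [:: a1, a2 & k])].
- move: hR; rewrite /kregs /= !all_cat -!andbA => /andP[hR _].
  apply: (test_ok t ((if tst w t s then a1 else a2) :: k)) => // [|i e|i e].
  + by apply: hs; rewrite !inE; case: (tst _ _ _); rewrite eqxx ?orbT.
  + by rewrite /cdelta /= e.
  + by rewrite /cdelta /= e.
- move: hR; rewrite /kregs /= !all_cat -!andbA => /andP[hR _].
  apply: (test_ok t (if tst w t s then a1 :: While t a1 :: k else k)) => // [|i e|i e].
  + by apply: hs; rewrite !inE; case: (tst _ _ _); rewrite eqxx ?orbT.
  + by rewrite /cdelta /= e.
  + by rewrite /cdelta /= e.
- by exists 0.
Qed.
End Simulation.

(** A program step raises a counter by at most one, so all heads stay within [H + n] during [n]
    steps. *)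
Lemma simulates_iter w n : forall c ks H,
  ks.1 \in kont -> all (leq^~ R) (kregs ks.1) ->
  (forall r, r <= R -> hd ks.2 r <= H) -> simulates w c ks ->
  exists2 m, m <= n * (2 * (H + n) + 6) &
    simulates w (iter m (@tm_step machine) c) (iter n (kstep w) ks).
Proof.
elim: n => [|n IH] c [k s] H /= hk hR hH hs; first by exists 0.
have [m hm hs1] := simulates_kstep hk hR hH hs.
have succ_k : (kstep w (k, s)).1 \in succs k.
  case: k {hk hR hs hs1} => [|x k]; first by rewrite inE.
  case: x => [|r|r|r b|a1 a2|t a1 a2|t a1|b]; try exact: mem_head.
    by rewrite /kstep /succs; case: (tst w t s); rewrite !inE eqxx ?orbT.
  by rewrite /kstep /succs; case: (tst w t s); rewrite !inE eqxx ?orbT.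
have hk1 := kont_succ hk succ_k.
have hR1 : all (leq^~ R) (kregs (kstep w (k, s)).1).
  move: hR; rewrite /kregs.
  case: k {hk hs hs1 succ_k hk1} => [|x k] //=.
  case: x => [|r|r|r b|a1 a2|t a1 a2|t a1|b] //=; rewrite ?all_cat ?andbA //.
  - by case/andP.
  - by case/andP.
  - by case/andP.
  - by case: (tst _ _ _) => /andP[/andP[/andP[h1 h2] h3] h4] /=; rewrite ?all_cat ?h2 ?h3 h4.
  - by case: (tst _ _ _) => /andP[/andP[h1 h2] h3] /=; rewrite ?all_cat /= ?h1 ?h2 h3.
have hH1 r : r <= R -> hd (kstep w (k, s)).2 r <= H.+1.
  move=> /hH; case: k {hk hR hs hs1 succ_k hk1 hR1} => [|x k] /=; first by lia.
  case: x => [|r'|r'|r' b|a1 a2|t a1 a2|t a1|b] /=; rewrite ?/upd;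
    by try case: eqP => [->|]; lia.
have [m' hm' h'] := IH _ _ _ hk1 hR1 hH1 hs1.
exists (m' + m); last by rewrite iterD -iterS iterSr.
by have := leq_add hm hm'; nia.
Qed.

Lemma machine_run (u : seq isym) (n : nat) (b : bool) (k : seq cmd) (s : store) :
  let w := fun i => nth ord0 (map sym_code u) i in
  all (leq^~ R) (regs prog) ->
  iter n (kstep w) ([:: prog], Store (fun=> 0) (fun=> false)) = (Stop b :: k, s) ->
  exists2 m, m <= (n * (2 * n + 6)).+1 &
    halt machine (tm_state (tm_run machine m u)) = Some b.
Proof.
move=> w hR hn.
have hk : [:: prog] \in kont by rewrite inE conts_head orbT.
have hq ph : ([:: prog], ph) \in ctls by rewrite mem_ctls.
have h0 : represents (tm_init machine u) ([:: prog], Init) 0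
    (fun i => (w i, false, [ffun=> false], false)).
  rewrite /tm_init; split.
  - by case: u {w hn} => [|a u]; rewrite /ctl_at /= qencK.
  - by case: u {w hn}.
  - move=> i; rewrite /tape_at /w; clear hn w.
    case: u => [|a u] /=; first by case: i => [|[]].
    rewrite -!map_cons.
    elim: (a :: u) i => [|x v IH] [|i] //=.
have hd0 : cdelta ([:: prog], Init) (w 0, false, [ffun=> false], false) =
  (([:: prog], Seek), to_origin (w 0, false, [ffun=> false], false), Stay) by [].
have h1 := step_represents h0 _ (hq _) hd0 (fun e : Stay = MoveL => match e with end).
have h2 : simulates w (tm_step (tm_init machine u)) ([:: prog], Store (fun=> 0) (fun=> false)).
  apply: represents_eq (h1 _); last by case: (prog).
  move=> i; rewrite /upd /cells /to_origin /=; case: eqP => [->|] //=.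
  move=> ne; have -> // : [ffun=> 0 == i] = [ffun=> false] :> {ffun 'I_R.+1 -> bool}.
  by apply/ffunP => r; rewrite !ffunE; case: i ne.
have hR' : all (leq^~ R) (kregs [:: prog]) by rewrite /kregs /= cats0.
have [m hm h3] := @simulates_iter w n _ ([:: prog], Store (fun=> 0) (fun=> false)) 0 hk hR' (fun r _ => leqnn 0) h2.
exists m.+1; first by lia.
rewrite hn in h3; case: h3 => h3 _ _.
by rewrite /tm_run iterSr /tm_state /= -/(ctl_at _) h3.
Qed.
End Machine.

(** * Compiling capped primitive recursive terms *)

Definition For (c l : nat) (body : cmd) :=
  Seq (Clr c) (While (TLt c l) (Seq body (Inc c))).
Definition Copy (a b : nat) := For b a Skip.

(** * Total correctness of programs with time bounds *)

Section Runs.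
Variable w : nat -> 'I_5.

(** A Hoare triple for total correctness with a time bound. The final store and the time do not
    depend on the continuation [k], which makes the triples compose. *)
Definition run (c : cmd) (s : store) (Q : store -> Prop) (n : nat) :=
  exists s' m, [/\ m <= n, forall k, iter m (kstep w) (c :: k, s) = (k, s') & Q s'].

Lemma run_weaken c s (Q Q' : store -> Prop) n n' :
  run c s Q n -> (forall s', Q s' -> Q' s') -> n <= n' -> run c s Q' n'.
Proof.
move=> [s' [m [h1 h2 h3]]] hQ hn; exists s', m.
by split=> //; [apply: leq_trans hn|apply: hQ].
Qed.

Lemma run_skip s (Q : store -> Prop) : Q s -> run Skip s Q 1.
Proof. by move=> h; exists s, 1. Qed.

Lemma run_inc r s (Q : store -> Prop) : Q (inc s r) -> run (Inc r) s Q 1.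
Proof. by move=> h; exists (inc s r), 1. Qed.

Lemma run_clr r s (Q : store -> Prop) : Q (clr s r) -> run (Clr r) s Q 1.
Proof. by move=> h; exists (clr s r), 1. Qed.

Lemma run_setb r b s (Q : store -> Prop) : Q (setb s r b) -> run (SetB r b) s Q 1.
Proof. by move=> h; exists (setb s r b), 1. Qed.

Lemma run_seq c1 c2 s Q1 Q n1 n2 :
  run c1 s Q1 n1 -> (forall s1, Q1 s1 -> run c2 s1 Q n2) ->
  run (Seq c1 c2) s Q (n1 + n2).+1.
Proof.
move=> [s1 [m1 [h1 e1 q1]]] /(_ _ q1) [s2 [m2 [h2 e2 q2]]].
exists s2, (m2 + m1).+1; split=> // [|k]; first by lia.
by rewrite iterSr /= iterD e1 e2.
Qed.

Lemma run_if t c1 c2 s Q n1 n2 :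
  (tst w t s -> run c1 s Q n1) -> (~~ tst w t s -> run c2 s Q n2) ->
  run (If t c1 c2) s Q (n1 + n2).+1.
Proof.
case e: (tst w t s) => h1 h2.
  have [s1 [m [g1 e1 q1]]] := h1 isT; exists s1, m.+1; split=> // [|k]; first by lia.
  by rewrite iterSr /= e e1.
have [s1 [m [g1 e1 q1]]] := h2 isT; exists s1, m.+1; split=> // [|k]; first by lia.
by rewrite iterSr /= e e1.
Qed.

(** The three extra steps of a round are the loop test, the unfolding of [Seq] and the increment. *)
Lemma run_for c l body s n (I : nat -> store -> Prop) K :
  c != l -> hd s l = n -> I 0 (clr s c) ->
  (forall i s1, i < n -> I i s1 -> hd s1 c = i -> hd s1 l = n ->
     run body s1 (fun s2 => [/\ hd s2 c = i, hd s2 l = n & I i.+1 (inc s2 c)]) K) ->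
  run (For c l body) s (fun s' => [/\ I n s', hd s' c = n & hd s' l = n]) (n * (K + 3) + 4).
Proof.
move=> ncl hl hI hs.
have aux i : i <= n -> exists s' m, [/\ m <= i * (K + 3), forall k,
   iter m (kstep w) (While (TLt c l) (Seq body (Inc c)) :: k, clr s c) =
   (While (TLt c l) (Seq body (Inc c)) :: k, s'), I i s', hd s' c = i & hd s' l = n].
  elim: i => [_|i IH hi].
    exists (clr s c), 0; split=> //; first by rewrite /clr /upd /= eqxx.
    by rewrite /clr /upd /= eq_sym (negbTE ncl).
  have [s1 [m [h1 h2 h3 h4 h5]]] := IH (ltnW hi).
  have [s2 [m2 [g1 g2 [g3 g4 g5]]]] := hs i s1 hi h3 h4 h5.
  exists (inc s2 c), ((m2 + 2).+1 + m); split=> //.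
  - by rewrite mulSn; lia.
  - move=> k; rewrite iterD h2 iterS [m2 + 2]addnC addnC iterD.
    have -> : iter 2 (kstep w) (While (TLt c l) (Seq body (Inc c)) :: k, s1) =
       ([:: body, Inc c, While (TLt c l) (Seq body (Inc c)) & k], s1).
      by rewrite /= h4 h5 hi.
    by rewrite g2.
  - by rewrite /inc /upd /= eqxx g3.
  - by rewrite /inc /upd /= eq_sym (negbTE ncl).
have [s1 [m [h1 h2 h3 h4 h5]]] := aux n (leqnn n).
exists s1, ((1 + m) + 2); split=> //; first by lia.
by move=> k; rewrite iterD /= iterD h2 /= h4 h5 ltnn.
Qed.

Lemma run_copy a b s n : a != b -> hd s a <= n ->
  run (Copy a b) s (fun s' => [/\ hd s' b = hd s a, forall r, r != b -> hd s' r = hd s r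
     & bt s' =1 bt s]) (4 * n + 4).
Proof.
move=> nab hn.
have := @run_for b a Skip s (hd s a) (fun _ s' => (forall r, r != b -> hd s' r = hd s r)
  /\ bt s' =1 bt s) 1.
rewrite eq_sym nab => /(_ isT erefl) h; apply: run_weaken (h _ _) _ _.
- by split=> // r /negbTE nr; rewrite /clr /upd /= nr.
- move=> i s1 hi [h1 h2] hb ha; apply: run_skip; split=> //; split=> // r nr.
  by rewrite /inc /upd /= (negbTE nr) h1.
- by move=> s' [[h1 h2] h3 h4].
- by nia.
Qed.
End Runs.

Definition scons (v : nat) (e : nat -> nat) : nat -> nat :=
  fun i => if i is j.+1 then e j else v.

(* Primitive recursion on numbers capped at [B].  In [Rec a b s] the body [s] sees the
   accumulator as variable 0 and the counter as variable 1.  [Fix s t] evaluates [t] with the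
   set of marked positions obtained by [B] rounds of marking every [x < B] satisfying [s]. *)
Inductive term :=
  | Var (i : nat) | Cst | Zero | Succ (t : term)
  | IfLt (a b t1 t2 : term) | IfSym (x : 'I_5) (a t1 t2 : term) | IfBit (a t1 t2 : term)
  | Rec (a b s : term) | Fix (s t : term) | Let (a t : term) | Lift (t : term).

(** * Semantics and compilation of terms *)

Section Terms.
Variables (B M : nat) (w : nat -> 'I_5).

(** In [Fix] a round is a fold, not a simultaneous update: a mark set early in a round is seen later
    in the same round, as happens on a single track changed in place. *)
Fixpoint eval (S : seq nat) (e : nat -> nat) (t : term) {struct t} : nat :=
  match t with
  | Var i => e i
  | Cst => M
  | Zero => 0
  | Succ t => minn B (eval S e t).+1
  | IfLt a b t1 t2 => if eval S e a < eval S e b then eval S e t1 else eval S e t2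
  | IfSym x a t1 t2 => if w (eval S e a) == x then eval S e t1 else eval S e t2
  | IfBit a t1 t2 => if eval S e a \in S then eval S e t1 else eval S e t2
  | Rec a b s =>
      iteri (eval S e a) (fun c acc => eval S (scons acc (scons c e)) s) (eval S e b)
  | Fix s t =>
      eval (iter B (fun S0 => foldl (fun S1 x => if 0 < eval S1 (scons x e) s then x :: S1
                                                 else S1) S0 (iota 0 B)) [::]) e t
  | Let a t => eval S (scons (eval S e a) e) t
  | Lift t => eval S (fun i => e i.+1) t
  end.

(* There is one track of marks: [wf true] terms use it, [wf false] ones may overwrite it. *)
Fixpoint wf (b : bool) (t : term) : bool :=
  match t with
  | Var _ | Cst | Zero => true
  | Succ t | Lift t => wf b t
  | IfLt a1 a2 t1 t2 => [&& wf b a1, wf b a2, wf b t1 & wf b t2]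
  | IfSym _ a t1 t2 => [&& wf b a, wf b t1 & wf b t2]
  | IfBit a t1 t2 => [&& b, wf b a, wf b t1 & wf b t2]
  | Rec a1 a2 s => [&& wf b a1, wf b a2 & wf b s]
  | Fix s t => [&& ~~ b, wf true s & wf true t]
  | Let a t => wf b a && wf b t
  end.

Lemma scons_le v e : v <= B -> (forall i, e i <= B) -> forall i, scons v e i <= B.
Proof. by move=> hv he [|i] /=. Qed.

Lemma eval_le S e t : M <= B -> (forall i, e i <= B) -> eval S e t <= B.
Proof.
move=> hM; elim: t S e => //=.
- by move=> *; apply: geq_minl.
- by move=> a IHa b IHb t IHt u IHu S e he; case: ifP => _; auto.
- by move=> x a IHa t IHt u IHu S e he; case: ifP => _; auto.
- by move=> a IHa t IHt u IHu S e he; case: ifP => _; auto.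
- move=> a IHa b IHb s IHs S e he; have := leqnn (eval S e a).
  elim: {1 3}(eval S e a) => [|n IHn] hn /=; first exact: IHb.
  have hnB := leq_trans (ltnW hn) (IHa S e he).
  by apply: IHs; apply: scons_le (IHn (ltnW hn)) _; apply: scons_le.
- by move=> s IHs t IHt S e he; auto.
- by move=> a IHa t IHt S e he; apply: IHt; apply: scons_le; auto.
- by move=> t IHt S e he; apply: IHt.
Qed.

(* Register 0 holds the cap and register 1 the constant; variable [i] lives in register
   [nth 0 rho i], the result goes to register [d], and registers above [d] are scratch. *)
Fixpoint compile (rho : seq nat) (d : nat) (t : term) : cmd :=
  match t with
  | Var i => if i < size rho then Copy (nth 0 rho i) d else Clr d
  | Cst => Copy 1 d
  | Zero => Clr d
  | Succ t => Seq (compile rho d t) (If (TLt d 0) (Inc d) Skip)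
  | IfLt a b t1 t2 =>
      Seq (compile rho d a) (Seq (compile rho d.+1 b)
        (If (TLt d d.+1) (compile rho d t1) (compile rho d t2)))
  | IfSym x a t1 t2 =>
      Seq (compile rho d a) (If (TNSym d x) (compile rho d t2) (compile rho d t1))
  | IfBit a t1 t2 =>
      Seq (compile rho d a) (If (TBit d) (compile rho d t1) (compile rho d t2))
  | Rec a b s =>
      Seq (compile rho d b) (Seq (compile rho d.+1 a)
        (For d.+2 d.+1 (Seq (compile [:: d, d.+2 & rho] d.+3 s) (Copy d.+3 d))))
  | Fix s t =>
      Seq (For d 0 (SetB d false))
        (Seq (For d 0 (For d.+1 0
           (Seq (compile (d.+1 :: rho) d.+2 s) (If (TPos d.+2) (SetB d.+1 true) Skip))))
          (compile rho d t))
  | Let a t => Seq (compile rho d a) (Seq (compile (d :: rho) d.+1 t) (Copy d.+1 d))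
  | Lift t => compile (behead rho) d t
  end.

Fixpoint cost (t : term) : nat :=
  match t with
  | Var _ | Cst | Zero => 4 * B + 4
  | Succ t => (cost t + 3).+1
  | IfLt a b t1 t2 => (cost a + (cost b + (cost t1 + cost t2).+1).+1).+1
  | IfSym _ a t1 t2 | IfBit a t1 t2 => (cost a + (cost t1 + cost t2).+1).+1
  | Rec a b s => (cost b + (cost a + (B * ((cost s + (4 * B + 4)).+1 + 3) + 4)).+1).+1
  | Fix s t => ((B * 4 + 4) + ((B * ((B * ((cost s + 3).+1 + 3) + 4) + 3) + 4) + cost t).+1).+1
  | Let a t => (cost a + (cost t + (4 * B + 4)).+1).+1
  | Lift t => cost t
  end.

Definition env (rho : seq nat) (s : store) (i : nat) : nat :=
  if i < size rho then hd s (nth 0 rho i) else 0.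

(** The clause [ready_bt] is kept because [Fix] erases only the cells below [B], whereas a value,
    and hence a tested cell, can be [B] itself. *)
Record ready (d : nat) (rho : seq nat) (e : nat -> nat) (b : bool) (S : seq nat) (s : store)
  : Prop := Ready {
  ready_d : 1 < d;
  ready_rho : all (gtn d) rho;
  ready_env : e =1 env rho s;
  ready_B : hd s 0 = B;
  ready_M : hd s 1 = M;
  ready_S : b -> forall p, bt s p = (p \in S);
  ready_bt : forall p, B <= p -> bt s p = false }.

Definition result (d v : nat) (b : bool) (s s' : store) : Prop :=
  [/\ hd s' d = v, forall r, r < d -> hd s' r = hd s r,
      b -> bt s' =1 bt s & forall p, B <= p -> bt s' p = false].

Lemma env_eq rho d s s' : all (gtn d) rho ->
  (forall r, r < d -> hd s' r = hd s r) -> env rho s =1 env rho s'.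
Proof.
move=> h hs i; rewrite /env; case: ifP => // hi; rewrite hs //.
by have /allP/(_ _ (mem_nth 0 hi)) := h.
Qed.

Lemma env_cons r rho s : env (r :: rho) s =1 scons (hd s r) (env rho s).
Proof. by case. Qed.

Lemma all_gtn_le d d' rho : d <= d' -> all (gtn d) rho -> all (gtn d') rho.
Proof. by move=> h; apply: sub_all => x /= hx; apply: leq_trans hx h. Qed.

Lemma scons_eq v v' e e' : v = v' -> e =1 e' -> scons v e =1 scons v' e'.
Proof. by move=> -> h [|i] /=. Qed.

Lemma ready_next d d' rho e b S s s' : d <= d' ->
  ready d rho e b S s -> (forall r, r < d -> hd s' r = hd s r) ->
  (b -> bt s' =1 bt s) -> (forall p, B <= p -> bt s' p = false) ->
  ready d' rho e b S s'.
Proof.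
move=> hd' [h1 h2 h3 h4 h5 h6 h7] hr hb hp; split=> //.
- exact: leq_trans hd'.
- exact: all_gtn_le hd' h2.
- by move=> i; rewrite h3; apply: env_eq h2 hr i.
- by rewrite hr //; lia.
- by rewrite hr //; lia.
- by move=> b1 p; rewrite hb // h6.
Qed.

Lemma ready_cons r v d rho e b S s :
  ready d rho e b S s -> r < d -> hd s r = v -> ready d (r :: rho) (scons v e) b S s.
Proof.
move=> [h1 h2 h3 h4 h5 h6 h7] hr <-; split=> //=; first by rewrite hr.
by move=> i; rewrite env_cons; apply: scons_eq.
Qed.

Definition compile_spec t := forall b d rho e S s, wf b t -> (forall i, e i <= B) ->
  ready d rho e b S s ->
  run w (compile rho d t) s (result d (eval S e t) b s) (cost t).

Lemma compile_ok t : M <= B -> compile_spec t.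
Proof.
move=> hM; elim: t => [i| | |t IH|a IHa a' IHa' t1 IH1 t2 IH2|x a IHa t1 IH1 t2 IH2
  |a IHa t1 IH1 t2 IH2|a IHa a' IHa' t IH|t1 IH1 t2 IH2|a IHa t IH|t IH]
  b d rho e S s /= hw he hr.
- case: ifP => hi.
    have hn : nth 0 rho i < d by have /allP := ready_rho hr; apply; apply: mem_nth.
    have hv : e i = hd s (nth 0 rho i) by rewrite (ready_env hr) /env hi.
    apply: run_weaken (@run_copy _ _ _ _ B _ _) _ _ => //; first by lia.
      by rewrite -hv.
    move=> s' [h1 h2 h3]; split=> //; first by rewrite h1.
      by move=> r hr'; apply: h2; lia.
    by move=> p hp; rewrite h3 (ready_bt hr).
  apply: run_weaken (run_clr _ _) (fun _ h => h) _ => //; last by lia.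
  split=> //=; first by rewrite /upd eqxx (ready_env hr) /env hi.
    by move=> r hr'; rewrite /upd; case: eqP => // hh; lia.
  exact: ready_bt hr.
- have hd1 := ready_d hr.
  apply: run_weaken (@run_copy _ _ _ _ B _ _) _ _ => //; first by lia.
    by rewrite (ready_M hr).
  move=> s' [h1 h2 h3]; split=> //; first by rewrite h1 (ready_M hr).
    by move=> r hr'; apply: h2; lia.
  by move=> p hp; rewrite h3 (ready_bt hr).
- apply: run_weaken (run_clr _ _) (fun _ h => h) _ => //; last by lia.
  split=> //=; first by rewrite /upd eqxx.
    by move=> r hr'; rewrite /upd; case: eqP => // hh; lia.
  exact: ready_bt hr.
- apply: run_weaken (run_seq (IH b d rho e S s hw he hr) _) (fun _ h => h) (leqnn _).
  move=> s1 [h1 h2 h3 h4].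
  have h0 : hd s1 0 = B by rewrite h2 ?(ready_B hr) //; have := ready_d hr; lia.
  apply: (@run_if _ _ _ _ _ _ 1 1) => /=; rewrite h0 h1 => hlt.
    apply: run_inc; split=> //=; first by rewrite /upd eqxx h1; lia.
    by move=> r hr'; rewrite /upd -h2 //; case: eqP => // hh; lia.
  by apply: run_skip; split=> //; have := eval_le S t hM he; lia.
- case/and4P: hw => wa wa' w1 w2; have hd1 := ready_d hr.
  apply: run_seq (IHa b d rho e S s wa he hr) _ => s1 [h1 h2 h3 h4].
  have hr1 := ready_next (leqnn d) hr h2 h3 h4.
  have hr1' := ready_next (leqnSn d) hr h2 h3 h4.
  apply: run_seq (IHa' b d.+1 rho e S s1 wa' he hr1') _ => s2 [g1 g2 g3 g4].
  have g2' r : r < d -> hd s2 r = hd s1 r by move=> hlt; apply: g2; lia.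
  have hr2 := ready_next (leqnn d) hr1 g2' g3 g4.
  have fin v s' : result d v b s2 s' -> result d v b s s'.
    move=> [k1 k2 k3 k4]; split=> //.
      by move=> r hlt; rewrite k2 // g2' // h2.
    by move=> hb p; rewrite k3 // g3 // h3.
  apply: run_if => /=; rewrite g1 g2 // h1 => hlt.
    by apply: run_weaken (IH1 b d rho e S s2 w1 he hr2) _ (leqnn _) => s'; rewrite hlt; apply: fin.
  by apply: run_weaken (IH2 b d rho e S s2 w2 he hr2) _ (leqnn _) => s';
    rewrite (negbTE hlt); apply: fin.
- case/and3P: hw => wa w1 w2; have hd1 := ready_d hr.
  rewrite [cost t1 + _]addnC.
  apply: run_seq (IHa b d rho e S s wa he hr) _ => s1 [h1 h2 h3 h4].
  have hr1 := ready_next (leqnn d) hr h2 h3 h4.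
  have fin v s' : result d v b s1 s' -> result d v b s s'.
    move=> [k1 k2 k3 k4]; split=> //.
      by move=> r hlt; rewrite k2 // h2.
    by move=> hb p; rewrite k3 // h3.
  apply: run_if => /=; rewrite h1 ?negbK => hlt.
    by apply: run_weaken (IH2 b d rho e S s1 w2 he hr1) _ (leqnn _) => s';
      rewrite (negbTE hlt); apply: fin.
  by apply: run_weaken (IH1 b d rho e S s1 w1 he hr1) _ (leqnn _) => s'; rewrite hlt; apply: fin.
- case/and4P: hw => hb wa w1 w2; have hd1 := ready_d hr.
  apply: run_seq (IHa b d rho e S s wa he hr) _ => s1 [h1 h2 h3 h4].
  have hr1 := ready_next (leqnn d) hr h2 h3 h4.
  have fin v s' : result d v b s1 s' -> result d v b s s'.
    move=> [k1 k2 k3 k4]; split=> //.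
      by move=> r hlt; rewrite k2 // h2.
    by move=> hb' p; rewrite k3 // h3.
  apply: run_if => /=; rewrite h1 (ready_S hr1 hb) => hlt.
    by apply: run_weaken (IH1 b d rho e S s1 w1 he hr1) _ (leqnn _) => s'; rewrite hlt; apply: fin.
  by apply: run_weaken (IH2 b d rho e S s1 w2 he hr1) _ (leqnn _) => s';
    rewrite (negbTE hlt); apply: fin.
- case/and3P: hw => wa wa' wt; have hd1 := ready_d hr.
  apply: run_seq (IHa' b d rho e S s wa' he hr) _ => s1 [h1 h2 h3 h4].
  have hr1 := ready_next (leqnn d) hr h2 h3 h4.
  have hr1' := ready_next (leqnSn d) hr h2 h3 h4.
  apply: run_seq (IHa b d.+1 rho e S s1 wa he hr1') _ => s2 [g1 g2 g3 g4].
  set n := eval S e a; set v := eval S e a'.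
  (* [F i] is the accumulator after [i] rounds; the loop invariant keeps it in register [d], while
     [d.+1] holds the number of rounds and [d.+2] the counter. *)
  pose F i := iteri i (fun c acc => eval S (scons acc (scons c e)) t) v.
  have hn : n <= B by apply: eval_le.
  have hF i : i <= n -> F i <= B.
    move=> hi; elim: i hi => [|i IHi] hi /=; first exact: eval_le.
    by apply: eval_le => //; do 2?apply: scons_le => //; [apply: IHi|]; lia.
  pose I i s' := [/\ hd s' d = F i, hd s' d.+1 = n, forall r, r < d -> hd s' r = hd s r,
      b -> bt s' =1 bt s & forall p, B <= p -> bt s' p = false].
  have ne : d.+2 != d.+1 by lia.
  have I0 : I 0 (clr s2 d.+2).
    split=> //=; rewrite /upd.
    - by rewrite ifF; [rewrite g2 //|lia].
    - by rewrite ifF; [rewrite g1|lia].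
    - by move=> r hlt; rewrite ifF; [rewrite g2 ?h2 //; lia|lia].
    - by move=> hb p; rewrite g3 // h3.
  apply: (run_weaken (run_for (K := (cost t + (4 * B + 4)).+1) ne g1 I0 _)).
  + move=> i s3 hi [i1 i2 i3 i4 i5] hc hl.
    have hr3 : ready d rho e b S s3 by apply: ready_next (leqnn d) hr _ _ _.
    have hrr : ready d.+3 [:: d, d.+2 & rho] (scons (F i) (scons i e)) b S s3.
      apply: ready_cons; [|lia|exact: i1].
      apply: ready_cons; [|lia|exact: hc].
      by apply: ready_next hr3 _ _ _ => //; lia.
    have he3 : forall j, scons (F i) (scons i e) j <= B.
      by do 2?apply: scons_le => //; [apply: hF|]; lia.
    apply: run_seq (IH b d.+3 _ _ S s3 wt he3 hrr) _ => s4 [j1 j2 j3 j4].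
    have hB4 : hd s4 d.+3 <= B by rewrite j1; apply: eval_le.
    apply: run_weaken (run_copy w _ hB4) _ (leqnn _); first by lia.
    move=> s5 [q1 q2 q3].
    have fr r : r < d -> hd s5 r = hd s r by move=> hlt; rewrite q2 ?j2 ?i3 //; lia.
    split; [by rewrite q2 ?j2 ?hc //; lia|by rewrite q2 ?j2 ?hl //; lia|].
    split=> //=; rewrite /upd.
    * by rewrite ifF ?q1 ?j1 //; lia.
    * by rewrite ifF; [rewrite q2 ?j2 ?i2 //; lia|lia].
    * by move=> r hlt; rewrite ifF ?fr //; lia.
    * by move=> hb p; rewrite q3 j3 // i4.
    * by move=> p hp; rewrite q3 j4.
  + by move=> s' [[i1 i2 i3 i4 i5] _ _].
  + by rewrite leq_add2r leq_mul2r hn orbT.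
- case/and3P: hw => /negbTE-> w1 w2; have hd1 := ready_d hr.
  have nd0 : d != 0 by lia.
  (* What survives while the track is being rewritten: the lower registers and the empty cells from
     [B] on. *)
  pose base s' := (forall r, r < d -> hd s' r = hd s r) /\ (forall p, B <= p -> bt s' p = false).
  have base_inc s' r : d <= r -> base s' -> base (inc s' r).
    by move=> hdr [k1 k2]; split=> // r' hr'; rewrite /= /upd ifF ?k1 //; lia.
  have base_clr s' r : d <= r -> base s' -> base (clr s' r).
    by move=> hdr [k1 k2]; split=> // r' hr'; rewrite /= /upd ifF ?k1 //; lia.
  have base0 s' : base s' -> hd s' 0 = B by case=> -> //; rewrite ?(ready_B hr); lia.
  apply: (@run_seq _ _ _ _ (fun s' => base s' /\ forall p, bt s' p = false)).
    apply: (run_weaken (run_for (K := 1)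
      (I := fun i s' => base s' /\ forall p, p < i -> bt s' p = false) nd0 (ready_B hr) _ _)).
    - by split=> //; apply: base_clr => //; split=> //; apply: ready_bt hr.
    - move=> i s1 hi [b1 k1] hc hl; apply: run_setb.
      have b2 : base (setb s1 d false).
        by case: b1 => b1 b2; split=> // p hp; rewrite /= /upd b2 //; case: ifP.
      split=> //; split; first exact: base_inc.
      by move=> p hp; rewrite /= /upd hc; case: eqP => // ne; apply: k1; lia.
    - move=> s' [[b1 k1] _ _]; split=> // p.
      by have [hp|hp] := ltnP p B; [apply: k1|apply: b1.2].
    - lia.
  move=> s1 [b1 z1].
  set f := fun S1 x => if 0 < eval S1 (scons x e) t1 then x :: S1 else S1.
  set T := iter B _ [::].
  apply: (@run_seq _ _ _ _ (fun s' => base s' /\ forall p, bt s' p = (p \in T))).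
    apply: (run_weaken (run_for (K := B * ((cost t1 + 3).+1 + 3) + 4)
      (I := fun i s' => base s' /\
         forall p, bt s' p = (p \in iter i (fun S0 => foldl f S0 (iota 0 B)) [::]))
      nd0 (base0 _ b1) _ _)).
    - by split; [apply: base_clr|].
    - move=> i s2 hi [b2 k2] hc hl; set S0 := iter i _ _ in k2 *.
      (* Inside a round the marks are the partial fold over the positions below [j]; the term [t1]
         is run with exactly this set. *)
      apply: (run_weaken (run_for (K := (cost t1 + 3).+1)
        (I := fun j s' => [/\ base s', hd s' d = i & forall p, bt s' p = (p \in foldl f S0 (iota 0 j))])
        _ (base0 _ b2) _ _)) => //.
      + by split; [apply: base_clr|rewrite /= /upd ifF //; lia|].
      + move=> j s3 hj [b3 k3 k3'] hc3 hl3; set S1 := foldl _ _ _ in k3'.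
        have hr3 : ready d.+2 (d.+1 :: rho) (scons j e) true S1 s3.
          apply: ready_cons; [|lia|exact: hc3].
          case: hr => r1 r2 r3 r4 r5 r6 r7; case: (b3) => q1 q2; split=> //.
          * by apply: all_gtn_le r2; lia.
          * by move=> y; rewrite r3; apply: env_eq r2 q1 y.
          * by rewrite q1.
        have he3 : forall y, scons j e y <= B by apply: scons_le => //; lia.
        apply: run_seq (IH1 true d.+2 _ _ S1 s3 w1 he3 hr3) _ => s4 [q1 q2 q3 q4].
        have b4 : base s4 by split=> // r hlt; rewrite q2 ?b3.1 //; lia.
        have e4 : foldl f (f S0 0) (iota 1 j) = f S1 j.
          by rewrite -[LHS]/(foldl f S0 (iota 0 j.+1)) -addn1 iotaD foldl_cat.
        apply: (@run_if _ _ _ _ _ _ 1 1) => /=; rewrite q1 => hlt.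
          apply: run_setb.
          have b5 : base (setb s4 d.+1 true).
            case: b4 => y1 y2; split=> // p hp; rewrite /= /upd y2 // q2 // hc3.
            by case: eqP => // ?; lia.
          split; [by rewrite /= q2|by rewrite /= q2 //; lia|split].
          * exact: base_inc.
          * by rewrite /= /upd ifF ?q2 ?k3 //; lia.
          * move=> p; rewrite e4 /f hlt /= /upd q2 // hc3 q3 // k3' inE.
            by case: eqP.
        apply: run_skip; split; [by rewrite q2|by rewrite q2 //; lia|split].
        * exact: base_inc.
        * by rewrite /= /upd ifF ?q2 ?k3 //; lia.
        * by move=> p; rewrite e4 /f (negbTE hlt) /= q3 // k3'.
      + move=> s' [[b3 k3 k3'] _ hl3]; split=> //; split; first exact: base_inc.
        by move=> p; rewrite iterS k3'.
    - by move=> s' [[b2 k2] _ _].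
    - exact: leqnn.
  move=> s2 [b2 z2].
  have hr2 : ready d rho e true T s2.
    case: hr => r1 r2 r3 r4 r5 r6 r7; case: (b2) => q1 q2; split=> //.
    - by move=> y; rewrite r3; apply: env_eq r2 q1 y.
    - exact: base0.
    - by rewrite q1.
  apply: run_weaken (IH2 true d _ _ T s2 w2 he hr2) _ (leqnn _) => s3 [q1 q2 q3 q4].
  by split=> // r hlt; rewrite q2 // b2.1.
- case/andP: hw => wa wt; have hd1 := ready_d hr.
  apply: run_seq (IHa b d rho e S s wa he hr) _ => s1 [h1 h2 h3 h4].
  have hr1 : ready d.+1 (d :: rho) (scons (eval S e a) e) b S s1.
    by apply: ready_cons => //; apply: ready_next hr _ _ _ => //.
  have he1 : forall i, scons (eval S e a) e i <= B by apply: scons_le => //; apply: eval_le.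
  apply: run_seq (IH b d.+1 _ _ S s1 wt he1 hr1) _ => s2 [g1 g2 g3 g4].
  have hB : hd s2 d.+1 <= B by rewrite g1; apply: eval_le.
  apply: run_weaken (run_copy w _ hB) _ (leqnn _); first by lia.
  move=> s3 [j1 j2 j3]; split=> //; first by rewrite j1.
  + by move=> r hlt; rewrite j2 ?g2 ?h2 //; lia.
  + by move=> hb p; rewrite j3 g3 // h3.
  + by move=> p hp; rewrite j3 g4.
- apply: IH => //; case: hr => h1 h2 h3 h4 h5 h6 h7; split=> //.
    by case: (rho) h2 => //= x l /andP[].
  by move=> i; rewrite h3 /env size_behead nth_behead; congr (if _ then _ else _); lia.
Qed.
End Terms.

(** * Polynomial bounds on the running time *)

Definition poly_bounded (f : nat -> nat) :=
  exists c k, forall x, f x <= c * x.+1 ^ k.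

Lemma poly_bounded_const c : poly_bounded (fun=> c).
Proof. by exists c, 0 => x; rewrite expn0 muln1. Qed.

Lemma poly_bounded_id : poly_bounded id.
Proof. by exists 1, 1 => x; rewrite expn1 mul1n. Qed.

(** The base [x.+1] is positive, so both powers are bounded by the power with the sum of the
    exponents. *)
Lemma poly_bounded_add f g :
  poly_bounded f -> poly_bounded g -> poly_bounded (fun x => f x + g x).
Proof.
move=> [c [k hf]] [c' [k' hg]]; exists (c + c'), (k + k') => x.
rewrite mulnDl; apply: leq_add; [apply: leq_trans (hf x) _|apply: leq_trans (hg x) _].
  by rewrite leq_mul2l leq_pexp2l ?leq_addr ?orbT.
by rewrite leq_mul2l leq_pexp2l ?leq_addl ?orbT.
Qed.

Lemma poly_bounded_mul f g :
  poly_bounded f -> poly_bounded g -> poly_bounded (fun x => f x * g x).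
Proof.
move=> [c [k hf]] [c' [k' hg]]; exists (c * c'), (k + k') => x.
by rewrite expnD mulnACA; apply: leq_mul.
Qed.

Lemma poly_bounded_comp f g :
  poly_bounded f -> poly_bounded g -> poly_bounded (fun x => f (g x)).
Proof.
move=> [c [k hf]] [c' [k' hg]]; exists (c * (c'.+1 ^ k)), (k' * k) => x.
apply: leq_trans (hf _) _; rewrite -mulnA leq_mul2l expnM -expnMn; apply/orP; right.
case: (k) => [|j]; rewrite ?expn0 // leq_exp2r // mulSn -[(g x).+1]add1n.
by apply: leq_add (hg x); rewrite expn_gt0.
Qed.

Lemma poly_bounded_cost t : poly_bounded (cost^~ t).
Proof.
have K := poly_bounded_const; have D := poly_bounded_add; have X := poly_bounded_mul.
have Z := poly_bounded_id.
have S f : poly_bounded f -> poly_bounded (fun x => (f x).+1).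
  by move=> hf; have := D _ _ (K 1) hf.
have L : poly_bounded (fun B => 4 * B + 4) by apply: D (X _ _ (K 4) Z) (K 4).
by elim: t => //= *;
  repeat (apply: (K) || apply: (L) || apply: (Z) || assumption || apply: (S) || apply: (D) || apply: (X)).

Qed.

(** * Initialisation of the constant and of the cap *)

Definition incs (n : nat) : cmd := iter n (Seq (Inc 0)) Skip.

(** Head 1 scans to the first blank and goes one cell further, to N+1 for an input of length N. Two
    nested loops then add 9 to register 0 in each of (N+1)^2 rounds. *)
Definition setup : cmd :=
  Seq (While (TNSym 1 ord0) (Inc 1))
    (Seq (Inc 1) (For 2 1 (For 3 1 (incs 9)))).

Lemma run_incs w n s : run w (incs n) s (fun s' => [/\ hd s' 0 = hd s 0 + n,
  forall r, r != 0 -> hd s' r = hd s r & bt s' = bt s]) (2 * n).+1.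
Proof.
elim: n s => [|n IH] s; first by apply: run_skip; split=> //; rewrite addn0.
have -> : (2 * n.+1).+1 = (1 + (2 * n).+1).+1 by lia.
apply: (run_seq (Q1 := fun s' => s' = inc s 0)); first by apply: run_inc.
move=> s1 ->; apply: run_weaken (IH _) _ (leqnn _) => s' [h1 h2 h3]; split=> //.
  by rewrite h1 /inc /upd /=; lia.
by move=> r hr; rewrite h2 // /inc /upd /= (negbTE hr).
Qed.

(** Code 0 is reserved for the blank, so the scan stops exactly at the end of the input. *)
Lemma sym_code_neq0 a : sym_code a != ord0.
Proof. by case: a; rewrite -val_eqE /= inordK. Qed.

Section Setup.
Variable u : seq isym.
Let w := fun i => nth ord0 (map sym_code u) i.
Let N := size u.

Lemma run_scan :
  run w (While (TNSym 1 ord0) (Inc 1)) (Store (fun=> 0) (fun=> false))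
   (fun s' => [/\ hd s' 1 = N, hd s' 0 = 0 & forall p, bt s' p = false]) (2 * N + 1).
Proof.
set c := While _ _; set s0 := Store _ _.
have aux i : i <= N -> exists s', [/\ forall k, iter (2 * i) (kstep w) (c :: k, s0) = (c :: k, s'),
    hd s' 1 = i, hd s' 0 = 0 & forall p, bt s' p = false].
  elim: i => [_|i IH hi]; first by exists s0.
  have [s1 [h1 h2 h3 h4]] := IH (ltnW hi); exists (inc s1 1); split=> // [k|].
    rewrite mulnS iterD h1 /= h2 /w (nth_map I0) //.
    by rewrite sym_code_neq0.
  by rewrite /inc /upd /= h2.
have [s1 [h1 h2 h3 h4]] := aux N (leqnn N).
exists s1, (2 * N + 1); split=> // k.
by rewrite addnC iterD h1 /= h2 /w nth_default ?size_map //= eqxx.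
Qed.

Lemma run_setup :
  run w setup (Store (fun=> 0) (fun=> false))
   (fun s' => [/\ hd s' 1 = N.+1, hd s' 0 = 9 * N.+1 ^ 2 & forall p, bt s' p = false])
   (2 * N + 1 + (1 + (N.+1 * (N.+1 * 22 + 7) + 4)).+1).+1.
Proof.
apply: run_seq run_scan _ => s1 [h1 h2 h3].
apply: (run_seq (Q1 := fun s' => s' = inc s1 1)); first by apply: run_inc.
move=> s2 ->; have hl : hd (inc s1 1) 1 = N.+1 by rewrite /inc /upd /= h1.
apply: (run_weaken (run_for (K := N.+1 * 22 + 4)
  (I := fun i s' => hd s' 0 = 9 * i * N.+1 /\ forall p, bt s' p = false) _ hl _ _)) => //.
- move=> i s3 hi [k1 k2] hc3 hl3.
  apply: (run_weaken (run_for (K := 19)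
    (I := fun j s' => [/\ hd s' 0 = 9 * i * N.+1 + 9 * j, hd s' 2 = i
       & forall p, bt s' p = false]) _ hl3 _ _)) => //.
  + by split=> //=; rewrite /upd /= k1 //; lia.
  + move=> j s4 hj [q1 q2 q3] hc4 hl4.
    apply: run_weaken (run_incs w 9 s4) _ (leqnn _) => s5 [e1 e2 e3].
    split; rewrite ?e2 //; split=> //=; rewrite /upd /= ?e1 ?q1 ?e2 //; first by lia.
    by rewrite e3.
  + by move=> s' [[q1 q2 q3] e1 e2]; split=> //; split=> //=; rewrite /upd /= q1; lia.
- by move=> s' [[k1 k2] e1 e2]; split=> //; rewrite k1; lia.
- by lia.
Qed.

Definition main (t : term) : cmd :=
  Seq (Seq setup (compile [::] 2 t)) (If (TPos 2) (Stop true) (Stop false)).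

Definition cap := 9 * N.+1 ^ 2.

Lemma main_stop t : wf false t ->
  exists2 n, n <= (2 * N + 1 + (1 + (N.+1 * (N.+1 * 22 + 7) + 4)).+1).+1 + cost cap t + 3 &
  exists k s, iter n (kstep w) ([:: main t], Store (fun=> 0) (fun=> false)) =
    (Stop (0 < eval cap N.+1 w [::] (fun=> 0) t) :: k, s).
Proof.
move=> ht.
have : run w (Seq setup (compile [::] 2 t)) (Store (fun=> 0) (fun=> false))
    (fun s' => hd s' 2 = eval cap N.+1 w [::] (fun=> 0) t)
    ((2 * N + 1 + (1 + (N.+1 * (N.+1 * 22 + 7) + 4)).+1).+1 + cost cap t).+1.
  apply: run_seq run_setup _ => s1 [h1 h2 h3].
  have hM : N.+1 <= cap by rewrite /cap; nia.
  apply: run_weaken (compile_ok w hM (d := 2) (rho := [::]) (b := false) (S := [::]) ht _ _) _ _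
    => //; first by split.
  by move=> s' [].
move=> [s' [m [h1 h2 h3]]]; exists (1 + (m + 1)); first by lia.
exists [::], s'; rewrite iterD iterD /= h2 /= h3.
by case: (0 < _).
Qed.
End Setup.

(** Three polynomials are composed: the cost is polynomial in the cap, the cap is quadratic in the
    input length, and the simulation squares the number of steps up to constants. *)
Lemma term_machine t : wf false t ->
  exists (Mc : TM) (c k : nat), forall u : seq isym, exists2 n, n <= c * (size u).+1 ^ k &
    halt Mc (tm_state (tm_run Mc n u)) =
    Some (0 < eval (9 * (size u).+1 ^ 2) (size u).+1
                   (fun i => nth ord0 (map sym_code u) i) [::] (fun=> 0) t).
Proof.
move=> ht; pose R := \max_(r <- regs (main t)) r.
have hR : all (leq^~ R) (regs (main t)).
  by apply/allP => r hr; rewrite /R (big_rem r) //= leq_maxl.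
pose T N := (2 * N + 1 + (1 + (N.+1 * (N.+1 * 22 + 7) + 4)).+1).+1 + cost (9 * N.+1 ^ 2) t + 3.
have K := poly_bounded_const; have D := poly_bounded_add; have X := poly_bounded_mul.
have Z := poly_bounded_id.
have S f : poly_bounded f -> poly_bounded (fun x => (f x).+1).
  by move=> hf; have := D _ _ (K 1) hf.
have hT : poly_bounded T.
  rewrite /T; apply: (D _ _ _ (K 3)); apply: (D).
    by repeat (apply: (K) || apply: (Z) || apply: (S) || apply: (D) || apply: (X)).
  apply: (poly_bounded_comp (poly_bounded_cost t) (g := fun N => 9 * N.+1 ^ 2)).
  apply: (X _ _ (K 9)); by exists 1, 2 => x; rewrite mul1n leq_exp2r.
have [c [k hck]] : poly_bounded (fun N => (T N * (2 * T N + 6)).+1).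
  by apply: (S); apply: (X) => //; apply: (D _ _ _ (K 6)); exact: (X _ _ (K 2) hT).
exists (machine (main t) R), c, k => u.
have [n hn [k' [s hs]]] := main_stop u ht.
have [m hm h] := machine_run hR hs.
exists m => //; apply: leq_trans hm _; apply: leq_trans (hck _).
by rewrite ltnS; apply: leq_mul => //; rewrite leq_add2r leq_mul2l.
Qed.

(** * The decision procedure as a capped primitive recursive term *)

Record ctx := Ctx { cB : nat; cM : nat; cw : nat -> 'I_5; cS : seq nat }.
Definition setS (x : ctx) (S : seq nat) := Ctx (cB x) (cM x) (cw x) S.
Definition ev (x : ctx) e t := eval (cB x) (cM x) (cw x) (cS x) e t.
(** A cap of at least 9 leaves the truth value 1 and the constants up to 9 untouched by
    saturation. *)
Definition valid (x : ctx) (e : nat -> nat) :=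
  [/\ 8 < cB x, cM x <= cB x & forall i, e i <= cB x].

(* [f] is computed by a term; binders of [f] read the new variables as [e 0], [e 1]. *)
Definition def (b : bool) (f : ctx -> (nat -> nat) -> nat) :=
  exists2 t, wf b t & forall x e, valid x e -> ev x e t = f x e.
Definition defb (b : bool) (p : ctx -> (nat -> nat) -> bool) :=
  def b (fun x e => p x e : nat).

Definition sc (x : ctx) n := minn (cB x) n.+1.
Definition addc (x : ctx) m n := minn (cB x) (m + n).
Definition mulc (x : ctx) m n := minn (cB x) (m * n).
Definition exb (n : nat) (P : nat -> bool) := has P (iota 0 n).

Lemma exbP n (P : nat -> bool) : reflect (exists2 i, i < n & P i) (exb n P).
Proof.
apply: (iffP hasP) => [[i hi h]|[i hi h]]; exists i => //.
  by rewrite mem_iota in hi; lia.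
by rewrite mem_iota; lia.
Qed.

Lemma exbS n (P : nat -> bool) : exb n.+1 P = exb n P || P n.
Proof. by rewrite /exb -[n.+1]addn1 iotaD has_cat /= orbF. Qed.

Lemma valid_scons x e v : valid x e -> v <= cB x -> valid x (scons v e).
Proof. by move=> [h1 h2 h3] hv; split=> //; apply: scons_le. Qed.

Lemma valid_tail x e : valid x e -> valid x (fun i => e i.+1).
Proof. by move=> [h1 h2 h3]; split. Qed.

Lemma ev_le x e t : valid x e -> ev x e t <= cB x.
Proof. by move=> [h1 h2 h3]; apply: eval_le. Qed.

(** * Closure properties of the functions computed by terms *)

Section Closure.
Variable b : bool.
Implicit Types (f g : ctx -> (nat -> nat) -> nat) (p q : ctx -> (nat -> nat) -> bool).

Lemma def_ext f g : def b f -> (forall x e, valid x e -> f x e = g x e) -> def b g.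
Proof. by move=> [t ht h] hfg; exists t => // x e hx; rewrite h // hfg. Qed.

Lemma defb_ext p q : defb b p -> (forall x e, valid x e -> p x e = q x e) -> defb b q.
Proof. by move=> hp hpq; apply: def_ext hp _ => x e hx; rewrite hpq. Qed.

Lemma def_var i : def b (fun x e => e i).
Proof. by exists (Var i). Qed.

Lemma def_cst : def b (fun x e => cM x).
Proof. by exists Cst. Qed.

Lemma def_const n : n <= 9 -> def b (fun x e => n).
Proof.
move=> hn; exists (iter n Succ Zero); first by elim: n {hn}.
move=> x e [h _ _]; elim: n hn => //= n IH hn.
by rewrite /ev /= in IH *; rewrite IH; lia.
Qed.

Lemma def_sc f : def b f -> def b (fun x e => sc x (f x e)).
Proof.
by move=> [t ht h]; exists (Succ t) => // x e hx; rewrite -h.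
Qed.

Lemma def_let a f : def b a -> def b f -> def b (fun x e => f x (scons (a x e) e)).
Proof.
move=> [t ht h] [t' ht' h']; exists (Let t t'); rewrite /= ?ht // => x e hx.
by rewrite -h // -h' //; apply: valid_scons => //; apply: ev_le.
Qed.

Lemma def_lift f : def b f -> def b (fun x e => f x (fun i => e i.+1)).
Proof.
move=> [t ht h]; exists (Lift t) => // x e hx.
by rewrite -h //; apply: valid_tail.
Qed.

(** The argument is bound by [Let], so [F] has to be treated for a variable only. *)
Lemma def_app1 (F : ctx -> nat -> nat) a :
  def b (fun x e => F x (e 0)) -> def b a -> def b (fun x e => F x (a x e)).
Proof. by move=> hF ha; apply: (def_let ha hF). Qed.

Lemma def_app2 (F : ctx -> nat -> nat -> nat) a1 a2 :
  def b (fun x e => F x (e 0) (e 1)) -> def b a1 -> def b a2 ->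
  def b (fun x e => F x (a1 x e) (a2 x e)).
Proof. by move=> hF h1 h2; apply: (def_let h2 (def_let (def_lift h1) hF)). Qed.

Lemma def_app4 (F : ctx -> nat -> nat -> nat -> nat -> nat) a1 a2 a3 a4 :
  def b (fun x e => F x (e 0) (e 1) (e 2) (e 3)) ->
  def b a1 -> def b a2 -> def b a3 -> def b a4 ->
  def b (fun x e => F x (a1 x e) (a2 x e) (a3 x e) (a4 x e)).
Proof.
move=> hF h1 h2 h3 h4.
apply: (def_let h4 (def_let (def_lift h3) (def_let (def_lift (def_lift h2))
  (def_let (def_lift (def_lift (def_lift h1))) hF)))).
Qed.

Lemma def_app5 (F : ctx -> nat -> nat -> nat -> nat -> nat -> nat) a1 a2 a3 a4 a5 :
  def b (fun x e => F x (e 0) (e 1) (e 2) (e 3) (e 4)) ->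
  def b a1 -> def b a2 -> def b a3 -> def b a4 -> def b a5 ->
  def b (fun x e => F x (a1 x e) (a2 x e) (a3 x e) (a4 x e) (a5 x e)).
Proof.
move=> hF h1 h2 h3 h4 h5.
apply: (def_let h5 (def_let (def_lift h4) (def_let (def_lift (def_lift h3))
  (def_let (def_lift (def_lift (def_lift h2)))
  (def_let (def_lift (def_lift (def_lift (def_lift h1)))) hF))))).
Qed.

Lemma def_if p f g : defb b p -> def b f -> def b g ->
  def b (fun x e => if p x e then f x e else g x e).
Proof.
move=> [t ht h] [t1 ht1 h1] [t2 ht2 h2]; exists (IfLt Zero t t1 t2).
  by rewrite /= ht ht1 ht2.
move=> x e hx; have := h x e hx; have := h1 x e hx; have := h2 x e hx.
by rewrite /ev /= => -> -> ->; case: (p x e).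
Qed.

Lemma def_lt f g : def b f -> def b g -> defb b (fun x e => f x e < g x e).
Proof.
move=> [t ht h] [t1 ht1 h1]; exists (IfLt t t1 (Succ Zero) Zero).
  by rewrite /= ht ht1.
move=> x e hx; have := h x e hx; have := h1 x e hx; case: hx => hB _ _.
by rewrite /ev /= => -> ->; case: ifP => // _; lia.
Qed.

Lemma defb_true : defb b (fun x e => true).
Proof. exact (@def_const 1 isT). Qed.

Lemma defb_false : defb b (fun x e => false).
Proof. exact (@def_const 0 isT). Qed.

Lemma defb_not p : defb b p -> defb b (fun x e => ~~ p x e).
Proof.
move=> h; apply: def_ext (def_if h defb_false defb_true) _ => x e _.
by case: (p x e).
Qed.

Lemma defb_and p q : defb b p -> defb b q -> defb b (fun x e => p x e && q x e).
Proof.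
move=> h1 h2; apply: def_ext (def_if h1 h2 defb_false) _ => x e _.
by case: (p x e).
Qed.

Lemma defb_or p q : defb b p -> defb b q -> defb b (fun x e => p x e || q x e).
Proof.
move=> h1 h2; apply: def_ext (def_if h1 defb_true h2) _ => x e _.
by case: (p x e).
Qed.

Lemma def_le f g : def b f -> def b g -> defb b (fun x e => f x e <= g x e).
Proof.
move=> h1 h2; apply: defb_ext (defb_not (def_lt h2 h1)) _ => x e _.
by rewrite -leqNgt.
Qed.

Lemma def_eq f g : def b f -> def b g -> defb b (fun x e => f x e == g x e).
Proof.
move=> h1 h2; apply: defb_ext (defb_and (def_le h1 h2) (def_le h2 h1)) _ => x e _.
by rewrite -eqn_leq.
Qed.

(** The successor here is not capped. As g is at most the cap, f+1 = g means that f < g while the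
    capped successor of f is not below g. *)
Lemma def_eqS f g : def b f -> def b g -> defb b (fun x e => (f x e).+1 == g x e).
Proof.
move=> h1 h2.
apply: defb_ext (defb_and (def_lt h1 h2) (defb_not (def_lt (def_sc h1) h2))) _ => x e hx.
case: h2 => t _ /(_ x e hx) <-; have := ev_le t hx; rewrite /sc.
by case: eqP; lia.
Qed.

Lemma def_sym c f : def b f -> defb b (fun x e => cw x (f x e) == c).
Proof.
move=> [t ht h]; exists (IfSym c t (Succ Zero) Zero); first by rewrite /= ht.
move=> x e hx; have := h x e hx; case: hx => hB _ _.
by rewrite /ev /= => ->; case: eqP => //; lia.
Qed.

Lemma def_iteri (s : ctx -> nat -> nat -> (nat -> nat) -> nat) a z :
  def b a -> def b z ->
  def b (fun x e => s x (e 1) (e 0) (fun i => e i.+2)) ->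
  def b (fun x e => iteri (a x e) (fun c acc => s x c acc e) (z x e)).
Proof.
move=> [t1 w1 h1] [t2 w2 h2] [t3 w3 h3]; exists (Rec t1 t2 t3).
  by rewrite /= w1 w2 w3.
move=> x e hx; have l1 := ev_le t1 hx; have := l1; rewrite -h1 // -h2 //.
rewrite /ev /= -/(ev x e t1) -/(ev x e t2).
elim: (ev x e t1) => //= n IH hn.
rewrite IH; last by lia.
have hle : iteri n (fun c acc => s x c acc e) (ev x e t2) <= cB x.
  rewrite -IH; last by lia.
  elim: n {IH} hn => [|n IHn] hn /=; first exact: ev_le.
  by apply: (@ev_le x); do 2?apply: valid_scons => //; rewrite ?IHn; lia.
by rewrite -[LHS]/(ev x _ t3) h3 //; do 2?apply: valid_scons => //; lia.
Qed.

(** An iteration that ignores its accumulator returns its last counter. *)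
Lemma def_pred f : def b f -> def b (fun x e => (f x e).-1).
Proof.
move=> h; have := @def_iteri (fun x c acc e => c) f (fun x e => 0) h (def_const (leq0n _)) (def_var 1).
by move/def_ext; apply=> x e _; case: (f x e).
Qed.

Lemma def_sub f g : def b f -> def b g -> def b (fun x e => f x e - g x e).
Proof.
move=> hf hg.
have := @def_iteri (fun x c acc e => acc.-1) g f hg hf (def_pred (def_var 0)).
move/def_ext; apply=> x e _; elim: (g x e) => [|n IH] /=; first by rewrite subn0.
by rewrite IH; lia.
Qed.

Lemma def_addc f g : def b f -> def b g -> def b (fun x e => addc x (f x e) (g x e)).
Proof.
move=> hf hg.
have := @def_iteri (fun x c acc e => sc x acc) g f hg hf (def_sc (def_var 0)).
move/def_ext; apply=> x e hx; case: hf => t _ /(_ x e hx) <-.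
have := ev_le t hx; rewrite /addc /sc.
by elim: (g x e) => [|n IH] /= hB; rewrite ?IH; lia.
Qed.

Lemma def_mulc f g : def b f -> def b g -> def b (fun x e => mulc x (f x e) (g x e)).
Proof.
move=> hf hg.
have := @def_iteri (fun x c acc e => addc x acc (f x e)) g (fun x e => 0) hg
  (def_const (leq0n _)) (def_addc (def_var 0) (def_lift (def_lift hf))).
move/def_ext; apply=> x e hx; rewrite /addc /mulc.
by elim: (g x e) => [|n IH] /=; rewrite ?IH; lia.
Qed.

Lemma defb_ex (P : ctx -> nat -> (nat -> nat) -> bool) n :
  def b n -> defb b (fun x e => P x (e 0) (fun i => e i.+1)) ->
  defb b (fun x e => exb (n x e) (fun c => P x c e)).
Proof.
move=> hn hP.
have h : def b (fun x e => if P x (e 1) (fun i => e i.+2) then 1 else e 0).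
  by apply: def_if (def_const _) (def_var 0) => //; apply: (def_lift hP).
have := @def_iteri (fun x c acc e => if P x c e then 1 else acc) n (fun x e => 0) hn
  (def_const (leq0n _)) h.
move/def_ext; apply=> x e _; elim: (n x e) => //= m IH.
by rewrite exbS IH; case: (P x m e); case: exb.
Qed.
End Closure.

Definition marks (x : ctx) (p : ctx -> nat -> bool) : seq nat :=
  iter (cB x) (fun S0 => foldl (fun S1 c => if p (setS x S1) c then c :: S1 else S1)
                               S0 (iota 0 (cB x))) [::].

Lemma def_bit f : def true f -> defb true (fun x e => f x e \in cS x).
Proof.
move=> [t ht h]; exists (IfBit t (Succ Zero) Zero); first by rewrite /= ht.
move=> x e hx; have := h x e hx; case: hx => hB _ _.
by rewrite /ev /= => ->; case: (_ \in _) => //; lia.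
Qed.

Lemma eq_foldl_in (T : eqType) (A : Type) (f g : A -> T -> A) (s : seq T) z :
  (forall a y, y \in s -> f a y = g a y) -> foldl f z s = foldl g z s.
Proof.
elim: s z => //= y s IH z h; rewrite h ?mem_head //; apply: IH => a y' hy'.
by apply: h; rewrite inE hy' orbT.
Qed.

Lemma def_fix (p : ctx -> nat -> (nat -> nat) -> bool) f :
  defb true (fun x e => p x (e 0) (fun i => e i.+1)) -> def true f ->
  def false (fun x e => f (setS x (marks x (fun x' c => p x' c e))) e).
Proof.
move=> [t ht h] [t' ht' h']; exists (Fix t t'); first by rewrite /= ht ht'.
move=> x e hx; rewrite -h' // /ev /=.
set T := iter _ _ _; rewrite (_ : T = marks x (fun x' c => p x' c e)) //.
rewrite /T /marks; apply: eq_iter => S0; apply: eq_foldl_in => S1 c.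
rewrite mem_iota => /= hc; have hx' : valid (setS x S1) (scons c e).
  by apply: (@valid_scons (setS x S1)) => //=; lia.
have := h _ _ hx'; rewrite /ev /= => ->.
by case: (p _ _ _).
Qed.

(* The input is a list of comma-terminated fields, binary with least significant bit first:
   field 0 is the index of the origin, fields [2q+1] and [2q+2] are the coordinates of the
   [q]-th position.  Coordinates are shifted by [cM x] to become natural numbers. *)
Definition cntc x n :=
  iteri n (fun c acc => if cw x c == sym_code IComma then sc x acc else acc) 0.
Definition isbit x c := (cw x c == sym_code I0) || (cw x c == sym_code I1).
(** The weight of a digit at input position [n] of field [f]: it doubles with every earlier bit of
    that field. *)
Definition pw x f n :=
  iteri n (fun c acc => if (cntc x c == f) && isbit x c then addc x acc acc else acc) 1.
Definition fval x f :=
  iteri (cM x) (fun c acc => if (cntc x c == f) && (cw x c == sym_code I1)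
                             then addc x acc (pw x f c) else acc) 0.
Definition neg x f := exb (cM x) (fun c => (cntc x c == f) && (cw x c == sym_code IMinus)).
Definition crd x f := if neg x f then cM x - fval x f else addc x (cM x) (fval x f).
Definition px x q := crd x (sc x (addc x q q)).
Definition py x q := crd x (sc x (sc x (addc x q q))).
(** With n positions the input has 2n+1 commas, and q < n is equivalent to 2q+2 <= 2n+1. *)
Definition npos x q := sc x (sc x (addc x q q)) <= cntc x (cM x).
Definition gdim x := sc x (addc x (cM x) (cM x)).
Definition idx x a b := addc x a (mulc x (gdim x) b).
Definition nearb a b a' b' :=
  ((a == a') && [|| b == b', b.+1 == b' | b'.+1 == b])
  || ((b == b') && ((a.+1 == a') || (a'.+1 == a))).
Definition blocked x u v a b :=
  exb (cM x) (fun q => [&& npos x q, u <= q, q <= v & nearb (px x q) (py x q) a b]).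
Definition freeb x k u v a b :=
  ((a == px x k) && (b == py x k)) || ~~ blocked x u v a b.
(** The coordinates of cell number [c] are found by search, which avoids division. *)
Definition stepb x c k u v :=
  exb (gdim x) (fun a => exb (gdim x) (fun b =>
    [&& c == idx x a b, freeb x k u v a b &
     ((a == px x k) && (b == py x k)) ||
     exb (gdim x) (fun a' => exb (gdim x) (fun b' =>
       nearb a b a' b' && (idx x a' b' \in cS x)))])).
(* Connectedness of cell [(a, b)] to position [k] outside of the neighbourhood of positions [u] to
   [v]. *)
Definition reach x k u v a b := idx x a b \in marks x (fun x' c => stepb x' c k u v).
(* Unbounded regions are those that contain this corner of the grid. *)
Definition corner x := addc x (cM x) (cM x).
Definition fin x i j :=
  ((i == 0) || ~~ reach x i.-1 i (sc x j) (corner x) (corner x)) &&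
  (~~ npos x (sc x j) || ~~ reach x (sc x j) i.-1 j (corner x) (corner x)).
Definition interf x i j :=
  exb (gdim x) (fun a => exb (gdim x) (fun b => exb (gdim x) (fun a' => exb (gdim x) (fun b' =>
    [&& nearb a b a' b', reach x i.-1 i (sc x j) a b & reach x (sc x j) i.-1 j a' b'])))).
Definition orig x := fval x 0.
Definition bad x i j :=
  [&& 0 < i, i <= orig x, orig x <= j, i < j, npos x (sc x j),
      fin x i.-1 j || fin x i (sc x j) & interf x i j].
(** A single position always satisfies the condition. Otherwise NI fails at i = j, and the next two
    tests keep that pair out of I and J; by monotonicity of finiteness it is then not in K
    either. *)
Definition algo x :=
  ~~ npos x 1 ||
  [&& (orig x == 0) || ~~ fin x (orig x).-1 (orig x),
      ~~ npos x (sc x (orig x)) || ~~ fin x (orig x) (sc x (orig x)) &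
      ~~ exb (cM x) (fun i => exb (cM x) (fun j => bad x i j))].

(** * The decision procedure is computed by a term *)

Section AlgoDef.
Variable b : bool.

Lemma def_cntc f : def b f -> def b (fun x e => cntc x (f x e)).
Proof.
apply: def_app1 => {f}; apply: def_iteri; [exact: def_var|exact: def_const|].
by apply: def_if; [apply: def_sym; apply: def_var|apply: def_sc; apply: def_var|apply: def_var].
Qed.

Lemma defb_isbit f : def b f -> defb b (fun x e => isbit x (f x e)).
Proof. by move=> hf; apply: defb_or; apply: def_sym. Qed.

Lemma def_pw f n : def b f -> def b n -> def b (fun x e => pw x (f x e) (n x e)).
Proof.
apply: def_app2 => {f n}; apply: def_iteri; [exact: def_var|exact: def_const|].
apply: def_if; [|by apply: def_addc; apply: def_var|exact: def_var].
apply: defb_and; first by apply: def_eq; [apply: def_cntc|]; apply: def_var.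
by apply: defb_isbit; apply: def_var.
Qed.

Lemma def_val f : def b f -> def b (fun x e => fval x (f x e)).
Proof.
apply: def_app1 => {f}; apply: def_iteri; [exact: def_cst|exact: def_const|].
apply: def_if; [|apply: def_addc; [|apply: def_pw]; exact: def_var|exact: def_var].
apply: defb_and; first by apply: def_eq; [apply: def_cntc|]; apply: def_var.
by apply: def_sym; apply: def_var.
Qed.

Lemma defb_neg f : def b f -> defb b (fun x e => neg x (f x e)).
Proof.
apply: (@def_app1 b (fun x v => neg x v : nat)) => {f}.
apply: defb_ex; first exact: def_cst.
apply: defb_and; first by apply: def_eq; [apply: def_cntc|]; apply: def_var.
by apply: def_sym; apply: def_var.
Qed.

Lemma def_crd f : def b f -> def b (fun x e => crd x (f x e)).
Proof.
move=> hf; apply: def_if; first exact: defb_neg.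
  by apply: def_sub; [apply: def_cst|apply: def_val].
by apply: def_addc; [apply: def_cst|apply: def_val].
Qed.

Lemma def_px f : def b f -> def b (fun x e => px x (f x e)).
Proof. by move=> hf; apply: def_crd; apply: def_sc; apply: def_addc. Qed.

Lemma def_py f : def b f -> def b (fun x e => py x (f x e)).
Proof. by move=> hf; apply: def_crd; do 2?apply: def_sc; apply: def_addc. Qed.

Lemma defb_npos f : def b f -> defb b (fun x e => npos x (f x e)).
Proof.
move=> hf; apply: def_le; first by do 2?apply: def_sc; apply: def_addc.
by apply: def_cntc; apply: def_cst.
Qed.

Lemma def_dim : def b (fun x e => gdim x).
Proof. by apply: def_sc; apply: def_addc; apply: def_cst. Qed.

Lemma def_idx f g : def b f -> def b g -> def b (fun x e => idx x (f x e) (g x e)).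
Proof. by move=> hf hg; apply: def_addc => //; apply: def_mulc => //; apply: def_dim. Qed.

Lemma defb_nearb f1 f2 f3 f4 : def b f1 -> def b f2 -> def b f3 -> def b f4 ->
  defb b (fun x e => nearb (f1 x e) (f2 x e) (f3 x e) (f4 x e)).
Proof.
move=> h1 h2 h3 h4; apply: defb_or; apply: defb_and; try exact: def_eq.
  by apply: defb_or; [apply: def_eq|apply: defb_or; apply: def_eqS].
by apply: defb_or; apply: def_eqS.
Qed.

Lemma defb_blocked f1 f2 f3 f4 : def b f1 -> def b f2 -> def b f3 -> def b f4 ->
  defb b (fun x e => blocked x (f1 x e) (f2 x e) (f3 x e) (f4 x e)).
Proof.
apply: (@def_app4 b (fun x u v a c => blocked x u v a c : nat)) => {f1 f2 f3 f4}.
apply: defb_ex; first exact: def_cst.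
apply: defb_and; first by apply: defb_npos; apply: def_var.
apply: defb_and; first by apply: def_le; apply: def_var.
apply: defb_and; first by apply: def_le; apply: def_var.
by apply: defb_nearb; [apply: def_px|apply: def_py| |]; apply: def_var.
Qed.

Lemma defb_free f1 f2 f3 f4 f5 : def b f1 -> def b f2 -> def b f3 -> def b f4 -> def b f5 ->
  defb b (fun x e => freeb x (f1 x e) (f2 x e) (f3 x e) (f4 x e) (f5 x e)).
Proof.
move=> h1 h2 h3 h4 h5; apply: defb_or; last by apply: defb_not; apply: defb_blocked.
by apply: defb_and; apply: def_eq => //; [apply: def_px|apply: def_py].
Qed.
End AlgoDef.

Lemma defb_stepb : defb true (fun x e => stepb x (e 0) (e 1) (e 2) (e 3)).
Proof.
have V i : def true (fun x e => e i) by apply: def_var.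
apply: defb_ex; first exact: def_dim.
apply: (@defb_ex true (fun x bb e => _)); first exact: def_dim.
apply: defb_and; first by apply: def_eq; [|apply: def_idx].
apply: defb_and; first exact: defb_free.
apply: defb_or.
  by apply: defb_and; apply: def_eq => //; [apply: def_px|apply: def_py].
apply: (@defb_ex true (fun x bb e => _)); first exact: def_dim.
apply: (@defb_ex true (fun x bb e => _)); first exact: def_dim.
apply: defb_and; first exact: defb_nearb.
by apply: def_bit; apply: def_idx.
Qed.

Lemma defb_reach f1 f2 f3 f4 f5 :
  def false f1 -> def false f2 -> def false f3 -> def false f4 -> def false f5 ->
  defb false (fun x e => reach x (f1 x e) (f2 x e) (f3 x e) (f4 x e) (f5 x e)).
Proof.
apply: (@def_app5 false (fun x k u v a c => reach x k u v a c : nat)) => {f1 f2 f3 f4 f5}.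
apply: (@def_fix (fun x c e => stepb x c (e 0) (e 1) (e 2))
   (fun x e => (idx x (e 3) (e 4) \in cS x) : nat)); first exact: defb_stepb.
by apply: def_bit; apply: def_idx; apply: def_var.
Qed.

Lemma def_corner : def false (fun x e => corner x).
Proof. by apply: def_addc; apply: def_cst. Qed.

Lemma defb_fin f g : def false f -> def false g ->
  defb false (fun x e => fin x (f x e) (g x e)).
Proof.
move=> hf hg; have hc := def_corner; have hs := def_sc hg; have hp := def_pred hf.
apply: defb_and; apply: defb_or.
- by apply: def_eq => //; apply: def_const.
- by apply: defb_not; apply: defb_reach.
- by apply: defb_not; apply: defb_npos.
- by apply: defb_not; apply: defb_reach.
Qed.

Lemma defb_interf f g : def false f -> def false g ->
  defb false (fun x e => interf x (f x e) (g x e)).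
Proof.
apply: (@def_app2 false (fun x i j => interf x i j : nat)) => {f g}.
have V i : def false (fun x e => e i) by apply: def_var.
do 4!(apply: (@defb_ex false (fun x bb e => _)); first exact: def_dim).
apply: defb_and; first exact: defb_nearb.
by apply: defb_and; apply: defb_reach => //; try exact: def_pred; exact: def_sc.
Qed.

Lemma def_orig : def false (fun x e => orig x).
Proof. by apply: def_val; apply: def_const. Qed.

Lemma defb_algo : defb false (fun x e => algo x).
Proof.
have ho := def_orig; have V i : def false (fun x e => e i) by apply: def_var.
have hp := def_pred ho; have hs := def_sc ho.
apply: defb_or; first by apply: defb_not; apply: defb_npos; apply: def_const.
apply: defb_and.
  apply: defb_or; first by apply: def_eq => //; apply: def_const.
  by apply: defb_not; apply: defb_fin.
apply: defb_and.
  apply: defb_or; first by apply: defb_not; apply: defb_npos.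
  by apply: defb_not; apply: defb_fin.
apply: defb_not.
do 2!(apply: (@defb_ex false (fun x bb e => _)); first exact: def_cst).
have hsc := def_sc (V 0); have hpr := def_pred (V 1).
apply: defb_and; first by apply: def_lt => //; apply: def_const.
do 2!(apply: defb_and; first exact: def_le).
apply: defb_and; first exact: def_lt.
apply: defb_and; first exact: defb_npos.
apply: defb_and; last exact: defb_interf.
by apply: defb_or; apply: defb_fin.
Qed.

Definition input_ctx (u : seq isym) : ctx :=
  Ctx (9 * (size u).+1 ^ 2) (size u).+1 (fun i => nth ord0 (map sym_code u) i) [::].

Lemma algo_machine :
  exists (Mc : TM) (c k : nat), forall u : seq isym, exists2 n, n <= c * (size u).+1 ^ k &
    halt Mc (tm_state (tm_run Mc n u)) = Some (algo (input_ctx u)).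
Proof.
have [t ht h] := defb_algo; have [Mc [c [k hM]]] := term_machine ht.
exists Mc, c, k => u; have [n hn hr] := hM u; exists n => //; rewrite hr.
have hv : valid (input_ctx u) (fun=> 0) by split=> //=; nia.
by have := h _ _ hv; rewrite /ev /= => ->; rewrite lt0b.
Qed.

(** * Induced paths and reachability *)

Lemma adjE (p q : pos) : adj p q = (`|p.1 - q.1| + `|p.2 - q.2| == 1)%N.
Proof.
case: p q => [a b] [c d]; rewrite /adj /eps !inE !xpair_eqE /=; lia.
Qed.

Definition near (p q : pos) : bool := (p == q) || adj p q.

Lemma nearE (p q : pos) : near p q = (`|p.1 - q.1| + `|p.2 - q.2| <= 1)%N.
Proof. by rewrite /near adjE; case: p q => [a b] [c d]; rewrite xpair_eqE /=; lia. Qed.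

Lemma adj_sym p q : adj p q = adj q p.
Proof. by rewrite !adjE; lia. Qed.

Lemma near_sym p q : near p q = near q p.
Proof. by rewrite !nearE; lia. Qed.

Lemma near_refl p : near p p.
Proof. by rewrite /near eqxx. Qed.

Lemma adjxx p : adj p p = false.
Proof. by rewrite adjE; lia. Qed.

Lemma adj_near p q : adj p q -> near p q.
Proof. by rewrite /near => ->; rewrite orbT. Qed.

(** Induced paths. Using [near] instead of [adj] for the later cells includes distinctness. *)
Fixpoint snake (s : seq pos) : bool :=
  if s is a :: s' then
    snake s' && (if s' is b :: s'' then adj a b && all (fun c => ~~ near a c) s'' else true)
  else true.

Lemma snake_cons2 a b s :
  snake [:: a, b & s] = [&& snake (b :: s), adj a b & all (fun c => ~~ near a c) s].
Proof. by []. Qed.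

Definition apart (s t : seq pos) := all (fun x => all (fun y => ~~ near x y) t) s.

Lemma apartP s t : reflect (forall x y, x \in s -> y \in t -> ~~ near x y) (apart s t).
Proof.
apply: (iffP allP) => [h x y hx hy|h x hx]; first by have /allP := h x hx; apply.
by apply/allP => y hy; apply: h.
Qed.

(** The cutting and gluing rule: both halves keep [a], and all that remains to be checked across the
    cut is [apart s t]. *)
Lemma snake_mid s a t :
  snake (s ++ a :: t) = [&& snake (rcons s a), snake (a :: t) & apart s t].
Proof.
elim: s => [|c [|c' s] IH]; first by rewrite cat0s /= andbT.
  rewrite cat1s snake_cons2 /apart [rcons _ _]/= snake_cons2 /= !andbT.
  by case: (adj c a); rewrite /= ?andbF.
rewrite !rcons_cons !cat_cons !snake_cons2 -!cat_cons -!rcons_cons IH all_cat all_rcons.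
have -> : apart [:: c, c' & s] t = all (fun y => ~~ near c y) t && apart (c' :: s) t by [].
have -> : all (fun y => ~~ near c y) (a :: t) = ~~ near c a && all (fun y => ~~ near c y) t by [].
by case: (snake (rcons _ _)); case: (snake (_ :: t)); case: (apart _ t); case: (adj c c');
  case: (all _ s); case: (all _ t); case: (near c a).
Qed.

(** Lets right extensions be handled as left extensions of the reversed path. *)
Lemma snake_rev s : snake (rev s) = snake s.
Proof.
elim: s => [|a [|b s] IH] //.
rewrite snake_cons2 -IH !rev_cons -!cats1 -catA cat1s snake_mid cats1.
rewrite [snake [:: b; a]]/= andbT adj_sym; congr [&& _, _ & _].
apply/apartP/allP => [h x hx|h x y].
  by rewrite near_sym; apply: h; rewrite ?mem_rev ?mem_head.
by rewrite mem_rev inE near_sym => hx /eqP->; apply: h.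
Qed.

Lemma snake_uniq s : snake s -> uniq s.
Proof.
elim: s => [|a [|b s] IH] //; rewrite snake_cons2 => /and3P[/IH h1 h2 /allP h3].
rewrite cons_uniq h1 andbT inE negb_or; apply/andP; split.
  by apply/eqP => e; rewrite e adjxx in h2.
by apply/negP => /h3; rewrite near_refl.
Qed.

Lemma snake_catl s t : snake (s ++ t) -> snake s.
Proof.
case: t => [|a t]; first by rewrite cats0.
rewrite snake_mid => /and3P[h _ _]; move: h; rewrite -snake_rev rev_rcons /=.
by case/andP; rewrite snake_rev.
Qed.

Lemma snake_catr s t : snake (s ++ t) -> snake t.
Proof. by rewrite -snake_rev rev_cat => /snake_catl; rewrite snake_rev. Qed.

Lemma snakeP (s : seq pos) :
  snake s <-> [/\ forall l, (l.+1 < size s)%N -> adj (nth (0,0) s l) (nth (0,0) s l.+1),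
    uniq s &
    forall l m, (l < size s)%N -> (m < size s)%N -> (l + 2 <= m)%N ->
      ~~ adj (nth (0,0) s l) (nth (0,0) s m)]%R.
Proof.
split=> [h|].
  split=> [l hl||l m hl hm hlm]; last 1 first.
  - have hl1 : (l.+1 < size s)%N by apply: leq_ltn_trans hm; lia.
    have e : s = take l.+1 s ++ nth (0,0)%R s l.+1 :: drop l.+2 s.
      by rewrite -drop_nth ?cat_take_drop.
    move: h; rewrite {1}e snake_mid => /and3P[_ _ /apartP h].
    apply/negP => /adj_near; apply/negP; apply: h.
      by rewrite -(nth_take (n0 := l.+1)) // mem_nth // size_take hl1.
    have -> : nth (0,0)%R s m = nth (0,0)%R (drop l.+2 s) (m - l.+2).
      by rewrite nth_drop subnKC //; lia.
    by rewrite mem_nth // size_drop ltn_sub2r //; apply: leq_ltn_trans hm; lia.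
  - move: h; rewrite -{1}(cat_take_drop l s) (drop_nth (0,0)%R (ltnW hl)).
    by rewrite (drop_nth (0,0)%R hl) => /snake_catr; rewrite snake_cons2 => /and3P[].
  - exact: snake_uniq.
elim: s => [|a [|b s] IH] // [h1 h2 h3]; rewrite snake_cons2; apply/and3P; split.
- apply: IH; split.
  + by move=> l hl; apply: (h1 l.+1).
  + by case/andP: h2.
  + by move=> l m hl hm hlm; apply: (h3 l.+1 m.+1).
- exact: (h1 0).
- apply/allP => c hc; rewrite /near negb_or; apply/andP; split.
    by apply/eqP => e; move: h2; rewrite /= !inE e hc orbT.
  rewrite -(nth_index (0,0)%R hc); apply: (h3 0 (index c s).+2) => //=.
  by rewrite !ltnS index_mem.
Qed.

Lemma is_configE ps o :
  is_config ps o <-> [/\ (o < size ps)%N, nth (0,0)%R ps o = (0,0)%R & snake ps].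
Proof.
split=> [[h1 h2 h3 h4 h5]|[h1 h2 /snakeP[h3 h4 h5]]]; last by split.
by split=> //; apply/snakeP; split.
Qed.

(** Steps may be stationary, since clamping to a box can identify adjacent cells. The start is
    exempt from [P], because p_(i-1) touches the segment that a left extension must avoid. *)
Inductive conn (P : pred pos) (a : pos) : pos -> Prop :=
  | conn_refl : conn P a a
  | conn_step c c' : conn P a c -> near c' c -> P c' -> conn P a c'.

Lemma conn_sub (P Q : pred pos) a c :
  (forall x, P x -> Q x) -> conn P a c -> conn Q a c.
Proof.
move=> h; elim=> [|x y _ IH hn hp]; first exact: conn_refl.
by apply: conn_step IH hn _; apply: h.
Qed.

(** Leading cells are dropped as long as [c] is near a later one; then [c] either is the first cell
    left or touches only that one and can be put in front. *)
Lemma snake_shortcut c s e : snake (rcons s e) -> has (near c) (rcons s e) ->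
  exists2 s', snake (rcons s' e) & head e s' = c /\ {subset s' <= c :: s}.
Proof.
elim: s => [|b s IH] hs hc.
  move: hc; rewrite /= orbF /near => /orP[/eqP->|hce]; first by exists [::].
  by exists [:: c]; [rewrite /= hce|split].
have [h|h] := boolP (has (near c) (rcons s e)).
  have [s' h1 [h2 h3]] := IH (snake_catr (s := [:: b]) hs) h.
  by exists s' => //; split=> // x /h3; rewrite !inE => /orP[->|->]; rewrite ?orbT.
move: hc; rewrite rcons_cons /= (negbTE h) orbF /near => /orP[/eqP->|hcb].
  by exists (b :: s) => //; split=> // x; rewrite !inE => ->; rewrite orbT.
exists [:: c, b & s]; last by split.
by rewrite !rcons_cons snake_cons2 -rcons_cons hs hcb /= all_predC.
Qed.

(* A walk is made induced by cutting it short whenever it comes near itself. *)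
Lemma conn_snake (P : pred pos) a c : conn P a c ->
  exists2 s, snake (rcons s a) & head a s = c /\ all P s.
Proof.
elim=> [|x y _ [s hs [hx hP]] hn hy]; first by exists [::].
have hh : has (near y) (rcons s a).
  by case: s hx {hs hP} => [|b s] /= ->; rewrite hn.
have [s' h1 [h2 h3]] := snake_shortcut hs hh.
exists s' => //; split=> //; apply/allP => z /h3; rewrite inE => /orP[/eqP->//|].
by have /allP := hP; apply.
Qed.

Lemma snake_conn (P : pred pos) a s : snake (rcons s a) -> all P s ->
  forall c, c \in rcons s a -> conn P a c.
Proof.
elim: s => [|b s IH] hs hP c; first by rewrite inE => /eqP->; apply: conn_refl.
move: hP hs => /andP[hb hP]; rewrite rcons_cons => hs.
have IH' := IH (snake_catr (s := [:: b]) hs) hP.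
rewrite inE => /orP[/eqP->|]; last exact: IH'.
case E : (rcons s a) hs IH' => [|d t]; first by case: (s) E.
rewrite snake_cons2 => /and3P[_ hbd _] IH'.
by apply: conn_step (IH' d (mem_head _ _)) (adj_near hbd) hb.
Qed.

Definition clear (T : seq pos) (c : pos) := ~~ has (near c) T.

Lemma snake_extend (a : pos) T y : snake (a :: T) ->
  snake (y ++ a :: T) = snake (rcons y a) && all (clear T) y.
Proof.
move=> h; rewrite snake_mid h /=; congr (_ && _).
by apply: eq_all => x; rewrite /clear -all_predC.
Qed.

Lemma conn_extension a T c : snake (a :: T) -> conn (clear T) a c ->
  exists2 y, snake (y ++ a :: T) & head a y = c.
Proof.
by move=> h /conn_snake[y h1 [h2 h3]]; exists y; rewrite // snake_extend // h1.
Qed.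

Lemma extension_conn a T y c : snake (y ++ a :: T) -> c \in rcons y a -> conn (clear T) a c.
Proof.
move=> h; move: (h); rewrite snake_extend ?(snake_catr h) // => /andP[h1 h2].
exact: snake_conn.
Qed.

(** * Walks inside and outside a box *)

Section Box.
Variable M : nat.
Local Open Scope ring_scope.
Definition inbox (c : pos) := (`|c.1| <= M)%N && (`|c.2| <= M)%N.
Definition inside (c : pos) := (`|c.1| < M)%N && (`|c.2| < M)%N.
Definition clamp1 (z : int) : int := if z < - M%:Z then - M%:Z else if M%:Z < z then M%:Z else z.
Definition clamp (c : pos) : pos := (clamp1 c.1, clamp1 c.2).

Variable P : pred pos.
Hypothesis P_out : forall c, ~~ inside c -> P c.

Lemma near_clamp c c' : near c c' -> near (clamp c) (clamp c').
Proof.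
rewrite !nearE /clamp /clamp1 /=; case: c c' => [x y] [x' y'] /=.
by do ?[case: ifP => ?]; lia.
Qed.

Lemma clamp_inbox c : inbox (clamp c).
Proof. by rewrite /inbox /clamp /clamp1 /=; do ?[case: ifP => ?]; lia. Qed.

Lemma clamp_id c : inbox c -> clamp c = c.
Proof.
by case: c => x y; rewrite /inbox /clamp /clamp1 /= => h; congr (_, _); do ?[case: ifP => ?]; lia.
Qed.

Lemma clamp_P c : P c -> P (clamp c).
Proof.
move=> h; have [hc|hc] := boolP (inbox c); first by rewrite clamp_id.
apply: P_out; move: hc; case: c {h} => x y; rewrite /inside /inbox /clamp /clamp1 /=.
by do ?[case: ifP => ?]; lia.
Qed.

(* Clamping to the box retracts walks, since every cell outside the box is free. *)
Lemma conn_clamp a c : inbox a -> conn P a c ->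
  conn (fun x => inbox x && P x) a (clamp c).
Proof.
move=> ha h; rewrite -(clamp_id ha) => {ha}.
elim: h => [|x y _ IH hn hp]; first exact: conn_refl.
by apply: conn_step IH (near_clamp hn) _; rewrite clamp_inbox clamp_P.
Qed.

Lemma conn_box a c : inbox a -> inbox c -> conn P a c ->
  conn (fun x => inbox x && P x) a c.
Proof. by move=> ha hc /(conn_clamp ha); rewrite clamp_id. Qed.

Lemma conn_trans a b c : conn P a b -> conn P b c -> conn P a c.
Proof. by move=> hab; elim=> // x y _ IH; apply: conn_step. Qed.

Lemma line_conn_nat (f : nat -> pos) n :
  (forall i, P (f i)) -> (forall i, near (f i.+1) (f i)) -> conn P (f 0) (f n).
Proof.
by move=> h1 h2; elim: n => [|n IH]; [apply: conn_refl|apply: conn_step IH (h2 _) (h1 _)].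
Qed.

Lemma row_conn (x x' y : int) : (M <= `|y|)%N -> conn P (x, y) (x', y).
Proof.
move=> hy; pose sg : int := if x <= x' then 1 else - 1.
have := @line_conn_nat (fun i => (x + sg * i%:Z, y)) `|x' - x|%N.
rewrite /= mulr0 addr0.
have -> : x + sg * `|x' - x|%N%:Z = x' by rewrite /sg; case: ifP => h; lia.
apply=> i; first by apply: P_out; rewrite /inside /=; lia.
by rewrite nearE /= /sg; case: ifP => h; lia.
Qed.

Lemma col_conn (x y y' : int) : (M <= `|x|)%N -> conn P (x, y) (x, y').
Proof.
move=> hx; pose sg : int := if y <= y' then 1 else - 1.
have := @line_conn_nat (fun i => (x, y + sg * i%:Z)) `|y' - y|%N.
rewrite /= mulr0 addr0.
have -> : y + sg * `|y' - y|%N%:Z = y' by rewrite /sg; case: ifP => h; lia.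
apply=> i; first by apply: P_out; rewrite /inside /=; lia.
by rewrite nearE /= /sg; case: ifP => h; lia.
Qed.

(** Every outside cell is joined to the corner (M, M): a cell with large first coordinate runs along
    its column to height M and then along that row, and symmetrically for the second coordinate. *)
Lemma outside_conn c c' : ~~ inside c -> ~~ inside c' -> conn P c c'.
Proof.
have aux d : ~~ inside d -> conn P d (M%:Z, M%:Z) /\ conn P (M%:Z, M%:Z) d.
  case: d => x y; rewrite /inside /= negb_and -!leqNgt => /orP[hx|hy]; split.
  - by apply: conn_trans (col_conn y M hx) _; apply: row_conn; lia.
  - by apply: (@conn_trans _ (x, M%:Z)); [apply: row_conn; lia|apply: col_conn].
  - by apply: conn_trans (row_conn x M hy) _; apply: col_conn; lia.
  - by apply: (@conn_trans _ (M%:Z, y)); [apply: col_conn; lia|apply: row_conn].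
by move=> /aux[h _] /aux[_ h']; apply: conn_trans h h'.
Qed.
End Box.

(** * Reduction of the condition to reachability *)

Lemma adjP p c : reflect (exists2 e, e \in eps & c = padd p e) (adj p c).
Proof.
apply: (iffP idP) => [h|[e he ->]].
  exists (c.1 - p.1, c.2 - p.2)%R => //.
  by case: c {h} => x y; rewrite /padd /=; congr (_, _); lia.
rewrite /adj /padd /=; suff -> : (p.1 + e.1 - p.1, p.2 + e.2 - p.2)%R = e by [].
by case: e {he} => x y /=; congr (_, _); lia.
Qed.

Lemma bcP s t p : bc s p = bc t p <-> (forall c, adj p c -> (c \in s) = (c \in t)).
Proof.
split=> [/eq_in_map h c /adjP[e he ->]|h]; first exact: h.
by apply/eq_in_map => e he; apply: h; apply/adjP; exists e.
Qed.

Lemma snake_nbr s g1 g2 t c : snake (s ++ [:: g1, g2 & t]) -> adj g1 c ->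
  c \in s ++ [:: g1, g2 & t] -> c = g2 \/ exists s', s = rcons s' c.
Proof.
rewrite snake_mid => /and3P[h1 h2 h3] hc; rewrite mem_cat => /orP[].
  case/lastP: s h1 h3 => // s d h1 _; rewrite mem_rcons inE => /orP[/eqP<-|hcs].
    by right; exists s.
  move: h1; rewrite -!cats1 -catA cat1s snake_mid => /and3P[_ _ /apartP/(_ c g1 hcs)].
  by rewrite mem_head near_sym adj_near // => /(_ isT).
rewrite !inE => /or3P[/eqP e|/eqP->|hct]; [by rewrite e adjxx in hc|by left|].
by move: h2; rewrite snake_cons2 => /and3P[_ _ /allP/(_ c hct)]; rewrite adj_near.
Qed.

(** The cell [g1] has the same neighbours in both paths, and [g2] is one of them. The other one, if
    it exists, must therefore precede [g1] in the new path; if it does not exist, nothing can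
    precede [g1]. Without the second cell [g2] the two sides of [g1] could not be told apart. *)
Lemma left_extension A al x0 g1 g2 R R' :
  size al <= 1 -> (al = [::] -> A = [::]) ->
  snake (A ++ al ++ [:: g1, g2 & R]) -> snake (x0 ++ [:: g1, g2 & R']) ->
  (forall c, adj g1 c ->
     (c \in x0 ++ [:: g1, g2 & R']) = (c \in A ++ al ++ [:: g1, g2 & R])) ->
  exists2 y0, x0 = y0 ++ al & (al = [::] -> y0 = [::]).
Proof.
case: al => [|a [|//]] _ hA hs hx hn.
  rewrite (hA erefl) /= in hs hn; exists [::] => //.
  case/lastP: x0 hx hn => // x0 d hx hn; exfalso.
  have hd : adj g1 d.
    move: hx; rewrite -cats1 -catA cat1s => /snake_catr.
    by rewrite snake_cons2 adj_sym => /and3P[].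
  (* A cell [d] before [g1] would be a neighbour in the old path too, hence equal to [g2], and would
     occur twice. *)
  have : d \in [:: g1, g2 & R] by rewrite -hn // mem_cat mem_rcons mem_head.
  case/(snake_nbr (s := [::]) hs hd) => [e|[s' ]]; last by case: s'.
  have := snake_uniq hx; rewrite cat_uniq => /and3P[_ /hasPn/(_ d) h _].
  by move: h; rewrite e !inE eqxx orbT mem_rcons mem_head => /(_ isT).
have ha : adj g1 a.
  by move: hs => /snake_catr; rewrite cat1s snake_cons2 adj_sym => /and3P[].
have : a \in x0 ++ [:: g1, g2 & R'] by rewrite hn // !mem_cat mem_head orbT.
case/(snake_nbr hx ha) => [e|[s' ->]]; last by exists s'; rewrite // cats1.
have := snake_uniq (snake_catr hs); rewrite cat1s e.
by rewrite /= !inE eqxx orbT.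
Qed.

Lemma mem_core y0 al G bl y1 p c :
  snake (y0 ++ al ++ G ++ bl ++ y1) -> p \in G -> adj p c ->
  size al <= 1 -> size bl <= 1 -> (al = [::] -> y0 = [::]) -> (bl = [::] -> y1 = [::]) ->
  (c \in y0 ++ al ++ G ++ bl ++ y1) = (c \in al ++ G ++ bl).
Proof.
move=> h hp hc ha hb h0 h1; rewrite !mem_cat.
have /negbTE-> : c \notin y0.
  apply/negP => hcy; case: al ha h0 h => [|a [|//]] _ h0 h; first by rewrite h0 in hcy.
  move: h; rewrite cat1s snake_mid => /and3P[_ _ /apartP/(_ c p hcy)].
  by rewrite mem_cat hp near_sym adj_near // => /(_ isT).
have /negbTE-> : c \notin y1.
  apply/negP => hcy; case: bl hb h1 h => [|b [|//]] _ h1 h; first by rewrite h1 in hcy.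
  move: h; rewrite !catA -catA cat1s snake_mid => /and3P[_ _ /apartP/(_ p c)].
  by rewrite !mem_cat hp hcy orbT adj_near // => /(_ isT isT).
by rewrite orbF.
Qed.

(** * The shape of the extensions of a segment *)

Section Split.
Variables (ps : seq pos) (i j : nat).
(** The position before the segment as a list of length at most one, empty when i = 0, so that the
    end of the configuration needs no separate treatment; [bl] does the same on the right. *)
Definition al := drop i.-1 (take i ps).
Definition bl := take 1 (drop j.+1 ps).
Definition A0 := take i.-1 ps.
Definition Z0 := drop j.+2 ps.

Lemma seg_size : j < size ps -> i <= j -> size (seg ps i j) = (j - i).+1.
Proof. by move=> h1 h2; rewrite /seg size_take size_drop; case: ltnP; lia. Qed.

Lemma take_al : A0 ++ al = take i ps.
Proof. by rewrite -[RHS](cat_take_drop i.-1) take_takel ?leq_pred. Qed.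

Lemma take_bl : bl ++ Z0 = drop j.+1 ps.
Proof. by rewrite -[RHS](cat_take_drop 1) drop_drop add1n. Qed.

Lemma split_ps : i <= j -> ps = A0 ++ al ++ seg ps i j ++ bl ++ Z0.
Proof.
move=> h; rewrite catA take_al take_bl /seg -[LHS](cat_take_drop i); congr (_ ++ _).
by rewrite -[LHS](cat_take_drop (j - i).+1) drop_drop; congr (_ ++ drop _ _); lia.
Qed.

Lemma al_size : size al <= 1.
Proof. by rewrite /al size_drop size_take; case: ifP; lia. Qed.

Lemma bl_size : size bl <= 1.
Proof. by rewrite /bl size_take; case: ifP => //; lia. Qed.

Lemma al_nil : i <= size ps -> al = [::] -> A0 = [::].
Proof.
move=> h /(congr1 size); rewrite /al size_drop size_takel //= => e.
have e0 : i.-1 = 0 by lia.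
by rewrite /A0 e0 take0.
Qed.

Lemma bl_nil : bl = [::] -> Z0 = [::].
Proof.
move=> /(congr1 size); rewrite /bl size_take size_drop /= => e.
by apply: drop_oversize; move: e; case: ifP; lia.
Qed.

Lemma al_S : 0 < i -> i <= size ps -> al = [:: nth (0, 0)%R ps i.-1].
Proof.
move=> h1 h2; rewrite /al.
have -> : take i ps = rcons (take i.-1 ps) (nth (0,0)%R ps i.-1).
  by rewrite -take_nth ?prednK.
by rewrite -cats1 drop_size_cat // size_takel //; apply: leq_trans h2; lia.
Qed.

Lemma bl_S : j.+1 < size ps -> bl = [:: nth (0, 0)%R ps j.+1].
Proof. by move=> h; rewrite /bl (drop_nth (0,0)%R h) /= take0. Qed.

Lemma seg_left : i <= j -> j < size ps -> al ++ seg ps i j = seg ps i.-1 j.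
Proof.
move=> h hj; case: (posnP i) => [e|h0]; first by rewrite /al e take0.
rewrite al_S // ?cat1s; last by apply: leq_trans hj; lia.
have hi : i.-1 < size ps by apply: leq_ltn_trans hj; lia.
rewrite /seg (drop_nth (0,0)%R hi) prednK //.
by have -> : (j - i.-1).+1 = (j - i).+2 by lia.
Qed.

Lemma seg_right : i <= j -> seg ps i j ++ bl = seg ps i j.+1.
Proof.
move=> h; rewrite /seg /bl.
have -> : (j.+1 - i).+1 = (j - i).+1 + 1 by lia.
rewrite takeD drop_drop; congr (_ ++ take _ (drop _ _)); lia.
Qed.

Hypotheses (hij : i < j) (hj : j < size ps) (hs : snake ps).
Variable (o : nat).
Hypotheses (hio : i <= o) (hoj : o <= j) (ho : nth (0, 0)%R ps o = (0, 0)%R).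

Lemma nth_seg k : k <= j - i -> nth (0,0)%R (seg ps i j) k = nth (0,0)%R ps (i + k).
Proof. by move=> h; rewrite /seg nth_take ?ltnS // nth_drop. Qed.

Lemma W_char x0 x1 :
  W ps o i j (x0, x1) <-> exists y0 y1, [/\ x0 = y0 ++ al, x1 = bl ++ y1,
    al = [::] -> y0 = [::], bl = [::] -> y1 = [::] &
    snake (y0 ++ al ++ seg ps i j ++ bl ++ y1)].
Proof.
have hij' := ltnW hij; have hsz := seg_size hj hij'; have e := split_ps hij'.
have hip : i <= size ps by apply: leq_trans (ltnW hj).
have A1 := al_nil hip; have B1 := bl_nil; have sa := al_size; have sb := bl_size.
rewrite /W /=; split.
  move=> [/is_configE[h1 h2 h3] h4].
  have hG1 : exists g1 g2 R, seg ps i j = [:: g1, g2 & R] /\ g1 = nth (0,0)%R ps i.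
    have := nth_seg (leq0n _); rewrite addn0.
    case: (seg ps i j) hsz => [|g1 [|g2 R]] /= hh; try lia.
    by move=> <-; exists g1, g2, R.
  have hG2 : exists g1 g2 R, rev (seg ps i j) = [:: g1, g2 & R] /\ g1 = nth (0,0)%R ps j.
    have := nth_seg (leqnn _); rewrite subnKC // => e2.
    have := nth_rev (0,0)%R (_ : 0 < size (seg ps i j)); rewrite hsz /= subn1 /= e2.
    move/(_ isT); have : size (rev (seg ps i j)) = (j - i).+1 by rewrite size_rev.
    case: (rev (seg ps i j)) => [|g1 [|g2 R]] /= hh; try lia.
    by move=> <-; exists g1, g2, R.
  have [y0 ey0 hy0] : exists2 y0, x0 = y0 ++ al & (al = [::] -> y0 = [::]).
    have [g1 [g2 [R [eG eg]]]] := hG1; rewrite eG in h3 h4.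
    have e' := e; rewrite eG in e'.
    apply: (@left_extension A0 al x0 g1 g2 (R ++ bl ++ Z0) (R ++ x1)) => //.
      by rewrite -[[:: g1, g2 & _]]/([:: g1, g2 & R] ++ bl ++ Z0) -e'.
    have hb := h4 i; rewrite leqnn hij' -eg in hb; have /bcP h := hb isT; move=> c hc.
    by rewrite -[[:: g1, g2 & _]]/([:: g1, g2 & R] ++ x1) h // {1}e'.
  (* The right side is the left side of the reversed path. *)
  have [y1 ey1 hy1] : exists2 y1, rev x1 = y1 ++ rev bl & (rev bl = [::] -> y1 = [::]).
    have [g1 [g2 [R [eG eg]]]] := hG2.
    have e' : rev ps = rev Z0 ++ rev bl ++ rev (seg ps i j) ++ rev al ++ rev A0.
      by rewrite {1}e !rev_cat !catA.
    rewrite eG in e'.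
    have e3 : rev (x0 ++ seg ps i j ++ x1) = rev x1 ++ [:: g1, g2 & R ++ rev x0].
      by rewrite !rev_cat eG -catA.
    apply: (@left_extension (rev Z0) (rev bl) (rev x1) g1 g2 (R ++ rev al ++ rev A0) (R ++ rev x0)).
    - by rewrite size_rev.
    - by move/(congr1 rev); rewrite revK => /B1 ->.
    - by rewrite -[[:: g1, g2 & _]]/([:: g1, g2 & R] ++ rev al ++ rev A0) -e' snake_rev.
    - by rewrite -e3 snake_rev.
    - have hb := h4 j; rewrite leqnn hij' -eg in hb; have /bcP h := hb isT; move=> c hc.
      rewrite -e3 -[[:: g1, g2 & _]]/([:: g1, g2 & R] ++ rev al ++ rev A0) -e'.
      by rewrite !mem_rev h.
  have e1 : x1 = bl ++ rev y1 by rewrite -[x1]revK ey1 rev_cat revK.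
  exists y0, (rev y1); split=> //; first by move=> hb; rewrite hy1 // hb.
  by rewrite e1 ey0 -!catA in h3.
move=> [y0 [y1 [-> -> hy0 hy1 h]]]; rewrite -!catA; split.
  apply/is_configE; split=> //.
    by rewrite !size_cat hsz; lia.
  rewrite catA nth_cat ltnNge leq_addr /= addnC addnK nth_cat hsz ifT; last by lia.
  by rewrite nth_seg; [rewrite subnKC|lia].
move=> l hl; apply/bcP => c hc.
have hl' : nth (0,0)%R ps l \in seg ps i j.
  have -> : nth (0,0)%R ps l = nth (0,0)%R (seg ps i j) (l - i).
    by rewrite nth_seg; [rewrite subnKC //|]; lia.
  by rewrite mem_nth // hsz; lia.
have hps := hs; rewrite e in hps.
by rewrite (mem_core h hl' hc) // [in RHS]e (mem_core hps hl' hc).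
Qed.
End Split.

(** * Criteria for finite and infinite sets of extensions *)

Lemma unbounded_infinite (P : seq pos * seq pos -> Prop) (f : seq pos * seq pos -> nat) :
  (forall k, exists2 x, P x & k < f x) -> ~ finite_set P.
Proof.
move=> h [s hs]; have [x hx] := h (\max_(y <- s) f y).
by rewrite ltnNge leq_bigmax_seq // hs.
Qed.

Fixpoint lists (T : eqType) (bx : seq T) (n : nat) : seq (seq T) :=
  if n is m.+1 then [::] :: [seq x :: l | x <- bx, l <- lists bx m] else [:: [::]].

Lemma mem_lists (T : eqType) (bx : seq T) n l :
  size l <= n -> {subset l <= bx} -> l \in lists bx n.
Proof.
elim: n l => [|n IH] [|x l] //= hs hb; rewrite inE; apply/orP; right.
apply/allpairsP; exists (x, l); split=> //=; first by apply: hb; rewrite mem_head.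
by apply: IH => // y hy; apply: hb; rewrite inE hy orbT.
Qed.

(** Sequences without repetition in a finite box are no longer than the box. *)
Lemma bounded_finite (bx : seq pos) (P : seq pos * seq pos -> Prop) :
  (forall x, P x -> [/\ uniq x.1, uniq x.2, {subset x.1 <= bx} & {subset x.2 <= bx}]) ->
  finite_set P.
Proof.
move=> h; exists [seq (x, y) | x <- lists bx (size bx), y <- lists bx (size bx)].
move=> [x y] /h[/= u1 u2 s1 s2]; apply/allpairsP; exists (x, y).
by split=> //=; apply: mem_lists => //; apply: uniq_leq_size.
Qed.

Definition coord_range (M : nat) : seq int := [seq (Posz k - Posz M)%R | k <- iota 0 (2 * M)].
Definition box (M : nat) : seq pos := [seq (x, y) | x <- coord_range M, y <- coord_range M].

Lemma mem_box M c : inside M c -> c \in box M.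
Proof.
have aux (z : int) : (`|z| < M)%N -> z \in coord_range M.
  move=> h; apply/mapP; exists (absz (z + Posz M)%R); last by lia.
  by rewrite mem_iota; lia.
by case: c => x y /andP[/= /aux hx /aux hy]; apply/allpairsP; exists (x, y).
Qed.

Lemma subset_take_drop (T : eqType) (s : seq T) k m : {subset take k (drop m s) <= s}.
Proof. by move=> x /mem_take /mem_drop. Qed.

(** * Noninterference and finiteness in terms of the two regions *)

Section Characterisation.
Variables (ps : seq pos) (o M : nat).
Hypotheses (hos : o < size ps) (ho : nth (0, 0)%R ps o = (0, 0)%R) (hs : snake ps).
Hypothesis (hM : forall p, p \in ps -> inside M.-1 p).

Notation "'p_ i" := (nth (0, 0)%R ps i) (at level 8, i at level 2, format "''p_' i").
Definition far : pos := (Posz M, Posz M)%R.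
(* Cells that a left (right) extension of [p_i ... p_j] can reach. *)
Definition Lc (i j : nat) := conn (clear (seg ps i j.+1)) 'p_(i.-1).
Definition Rc (i j : nat) := conn (clear (seg ps i.-1 j)) 'p_(j.+1).

(** The positions lie in a box smaller by one layer, so cells outside the large box are not even
    adjacent to them. *)
Lemma clear_outside u v c : ~~ inside M c -> clear (seg ps u v) c.
Proof.
move=> hc; apply/hasPn => x /subset_take_drop/hM; rewrite nearE.
by move: hc; rewrite /inside; lia.
Qed.

Lemma far_outside : ~~ inside M far.
Proof. by rewrite /inside /far /=; lia. Qed.

Section Fixed.
Variables (i j : nat).
Hypotheses (hij : i < j) (hj : j < size ps) (hio : i <= o) (hoj : o <= j).

Let hij' := ltnW hij.
Let hip : i <= size ps := leq_trans hij' (ltnW hj).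
Let Wc x0 x1 := W_char hij hj hs hio hoj ho x0 x1.
Let e := split_ps ps hij'.
Let hps : snake (A0 ps i ++ al ps i ++ seg ps i j ++ bl ps j ++ Z0 ps j).
Proof. by rewrite -e. Qed.

Let snake_core : snake (al ps i ++ seg ps i j ++ bl ps j).
Proof. by move: hps; rewrite !catA => /snake_catl; rewrite -!catA => /snake_catr. Qed.

Lemma W_left x0 x1 : 0 < i -> W ps o i j (x0, x1) ->
  exists2 y0, x0 = rcons y0 'p_(i.-1) & snake (y0 ++ 'p_(i.-1) :: seg ps i j.+1).
Proof.
move=> hi /Wc[y0 [y1 [-> _ _ _]]]; rewrite (al_S hi hip) => h; exists y0; rewrite ?cats1 //.
rewrite -seg_right //; apply: (@snake_catl _ y1).
by move: h; rewrite cat1s -!catA /= -!catA.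
Qed.

Lemma W_right x0 x1 : j.+1 < size ps -> W ps o i j (x0, x1) ->
  exists2 y1, x1 = 'p_(j.+1) :: y1 & snake (seg ps i.-1 j ++ 'p_(j.+1) :: y1).
Proof.
move=> hj1 /Wc[y0 [y1 [_ -> _ _]]]; rewrite (bl_S hj1) => h; exists y1 => //.
by rewrite -seg_left //; move: h => /snake_catr; rewrite catA.
Qed.

Lemma W_left_conn x0 x1 : 0 < i -> W ps o i j (x0, x1) -> forall c, c \in x0 -> Lc i j c.
Proof. by move=> hi /(W_left hi)[y0 -> h] c; apply: extension_conn h. Qed.

Lemma W_right_conn x0 x1 : j.+1 < size ps -> W ps o i j (x0, x1) ->
  forall c, c \in x1 -> Rc i j c.
Proof.
move=> hj1 /(W_right hj1)[y1 -> h] c hc.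
have h' : snake (rev y1 ++ 'p_(j.+1) :: rev (seg ps i.-1 j)).
  by rewrite -cat_rcons -rev_cons -rev_cat snake_rev.
have hc2 : c \in rcons (rev y1) 'p_(j.+1) by rewrite -rev_cons mem_rev.
have := extension_conn h' hc2.
by apply: conn_sub => x; rewrite /clear has_rev.
Qed.

(** With the right component reduced to [bl], an induced path to [c] only has to avoid p_i ...
    p_(j+1), which is what [Lc] asks for. *)
Lemma conn_W_left c : 0 < i -> Lc i j c ->
  exists2 x0, W ps o i j (x0, bl ps j) & head (0,0)%R x0 = c /\ c \in x0.
Proof.
move=> hi hc.
have hsn : snake ('p_(i.-1) :: seg ps i j.+1).
  by move: snake_core; rewrite al_S // seg_right.
have [y hy eh] := conn_extension hsn hc; exists (rcons y 'p_(i.-1)).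
  apply/Wc; exists y, [::]; rewrite al_S // cats1 cats0; split=> //.
  by rewrite seg_right.
rewrite -eh; case: y {hy eh} => [|y0 y] /=; first by rewrite mem_head.
by rewrite mem_head.
Qed.

Lemma conn_W_right c : j.+1 < size ps -> Rc i j c ->
  exists2 x1, W ps o i j (al ps i, x1) & last (0,0)%R x1 = c /\ c \in x1.
Proof.
move=> hj1 hc.
have hsn : snake ('p_(j.+1) :: rev (seg ps i.-1 j)).
  by rewrite -rev_rcons snake_rev -cats1 -(bl_S hj1) -seg_left // -catA.
have hc' : conn (clear (rev (seg ps i.-1 j))) 'p_(j.+1) c.
  by apply: conn_sub hc => x; rewrite /clear has_rev.
have [y hy eh] := conn_extension hsn hc'; exists ('p_(j.+1) :: rev y).
  apply/Wc; exists [::], (rev y); rewrite (bl_S hj1); split=> //.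
  rewrite cat0s catA seg_left // -snake_rev rev_cat rev_cons revK.
  by rewrite cat_rcons.
rewrite -eh; case: y {hy eh} => [|y0 y] /=; first by rewrite mem_head.
by rewrite rev_cons last_rcons inE mem_rcons mem_head orbT.
Qed.

(** Each side is already compatible with the segment and with the first cell of the other side, so
    contact between the two sides is the only obstruction left. *)
Lemma W_combine x0 x1 x0' x1' : 0 < i -> j.+1 < size ps ->
  W ps o i j (x0, x1') -> W ps o i j (x0', x1) ->
  (forall c c', c \in x0 -> c' \in x1 -> ~~ near c c') -> W ps o i j (x0, x1).
Proof.
move=> hi hj1 /(W_left hi)[y0 -> h0] /(W_right hj1)[y1 -> h1] hc.
apply/Wc; exists y0, y1; rewrite (al_S hi hip) (bl_S hj1) cats1; split=> //.
move: h0 h1; rewrite -seg_right // -seg_left // (al_S hi hip) (bl_S hj1) -!catA !cat1s.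
rewrite !snake_mid => /and3P[-> _ /apartP h2] -> /=.
apply/apartP => x y hx; rewrite mem_cat => /orP[hy|hy].
  by apply: h2; rewrite // mem_cat hy.
by apply: hc => //; rewrite mem_rcons inE hx orbT.
Qed.

Lemma W_apart x0 x1 c c' : 0 < i -> j.+1 < size ps -> W ps o i j (x0, x1) ->
  c \in x0 -> c' \in x1 -> ~~ near c c'.
Proof.
move=> hi hj1 /Wc[y0 [y1 [-> -> _ _]]]; rewrite catA.
have := seg_size hj hij'; case: (seg ps i j) => [//|g G] _.
by rewrite cat_cons snake_mid => /and3P[_ _ /apartP h] h1 h2; apply: h; rewrite // mem_cat h2 orbT.
Qed.

(** Cells of the two regions lie on a left and on a right extension; NI combines these into one
    induced path, which keeps the cells apart. Conversely, all extensions run inside the regions. *)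
Lemma NI_char : 0 < i -> j.+1 < size ps ->
  NI ps o i j <-> (forall c c', Lc i j c -> Rc i j c' -> ~~ near c c').
Proof.
move=> hi hj1; split=> [h c c' /(conn_W_left hi)[x0 h0 [_ hc]] /(conn_W_right hj1)[x1 h1 [_ hc']]|].
  by apply: W_apart (h x0 x1 _ _) hc hc' => //; eexists; eassumption.
move=> h x0 x1 [x1' h0] [x0' h1]; apply: (W_combine hi hj1 h0 h1) => c c' hc hc'.
by apply: h; [apply: (W_left_conn hi h0)|apply: (W_right_conn hj1 h1)].
Qed.

(** The left component can only be empty, so there is nothing to combine. *)
Lemma NI_left_end : i = 0 -> NI ps o i j.
Proof.
move=> hi x0 x1 [x1' /Wc[y0 [y1 [-> _ h1 _ _]]]] [x0' h]; move: (h).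
move/Wc => [y0' [y1' [e1 _ h1' _ _]]].
have a0 : al ps i = [::] by rewrite /al hi take0.
by rewrite h1 // a0; move: h; rewrite e1 h1' // a0.
Qed.

Lemma NI_right_end : size ps <= j.+1 -> NI ps o i j.
Proof.
move=> hj1 x0 x1 [x1' h] [x0' /Wc[y0' [y1' [_ -> _ h2 _]]]]; move: (h).
move/Wc => [y0 [y1 [_ e1 _ h1 _]]].
have b0 : bl ps j = [::] by rewrite /bl drop_oversize.
by rewrite h2 // b0; move: h; rewrite e1 h1 // b0.
Qed.

Lemma M_gt0 : 0 < M.
Proof. by have := hM (mem_nth (0,0)%R hos); rewrite /inside; lia. Qed.

Lemma outside_far_conn u v a c c' : ~~ inside M c -> ~~ inside M c' ->
  conn (clear (seg ps u v)) a c -> conn (clear (seg ps u v)) a c'.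
Proof.
move=> hc hc' h; apply: conn_trans h _; apply: (outside_conn _ hc hc').
exact: clear_outside.
Qed.

(** The outside of the box is connected, so a region that leaves the box contains [far] and cells at
    any distance, and each of them ends an extension. Otherwise both components are repetition-free
    sequences in the box. *)
Lemma fin_char : finite_set (W ps o i j) <->
  (i = 0 \/ ~ Lc i j far) /\ (size ps <= j.+1 \/ ~ Rc i j far).
Proof.
pose c k : pos := (Posz M + Posz k, Posz M)%R.
have hc k : ~~ inside M (c k) by rewrite /inside /c /=; lia.
split=> [hf|[hL hR]].
  split.
    have [->|hi] := posnP i; [by left|right=> hl]; move: hf.
    apply: (@unbounded_infinite _ (fun x => `|(head (0,0)%R x.1).1|)%N) => k.
    have /(conn_W_left hi)[x0 h0 [eh _]] : Lc i j (c k).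
      exact: outside_far_conn far_outside (hc k) hl.
    by exists (x0, bl ps j) => //=; rewrite eh /c /=; have := M_gt0; lia.
  have [|hj1] := leqP (size ps) j.+1; [by left|right=> hr]; move: hf.
  apply: (@unbounded_infinite _ (fun x => `|(last (0,0)%R x.2).1|)%N) => k.
  have /(conn_W_right hj1)[x1 h1 [eh _]] : Rc i j (c k).
    exact: outside_far_conn far_outside (hc k) hr.
  by exists (al ps i, x1) => //=; rewrite eh /c /=; have := M_gt0; lia.
apply: (@bounded_finite (box M)) => -[x0 x1] h.
have u : uniq (x0 ++ seg ps i j ++ x1).
  by case: h => /is_configE[_ _ /snake_uniq].
have /= in01 : x0 = [::] \/ forall x, x \in x0 -> inside M x.
  have [e0|hi] := posnP i.
    left; move/Wc: h => [y0 [y1 [-> _ h1 _ _]]].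
    by have a0 : al ps i = [::]; [rewrite /al e0 take0|rewrite h1 // a0].
  right=> x hx; apply/negPn/negP => hx'.
  case: hL => [e0|]; first by rewrite e0 in hi.
  by apply; apply: outside_far_conn hx' far_outside _; apply: W_left_conn h x hx.
have in11 : x1 = [::] \/ forall x, x \in x1 -> inside M x.
  have [hj1|hj1] := leqP (size ps) j.+1.
    left; move/Wc: h => [y0 [y1 [_ -> _ h1 _]]].
    by have b0 : bl ps j = [::]; [rewrite /bl drop_oversize|rewrite h1 // b0].
  right=> x hx; apply/negPn/negP => hx'.
  case: hR => [e0|]; first by rewrite leqNgt hj1 in e0.
  by apply; apply: outside_far_conn hx' far_outside _; apply: W_right_conn h x hx.
move: u; rewrite !cat_uniq => /and3P[u0 _ /and3P[_ _ u1]]; split=> //=.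
  by case: in01 => [->|hin] x // /hin/mem_box.
by case: in11 => [->|hin] x // /hin/mem_box.
Qed.
End Fixed.
End Characterisation.

(** * Reduction of the condition to pairs i < j *)

Section CNI.
Variables (ps : seq pos) (o : nat).
Hypotheses (hos : o < size ps) (ho : nth (0, 0)%R ps o = (0, 0)%R) (hs : snake ps).

Notation "'p_ i" := (nth (0, 0)%R ps i) (at level 8, i at level 2, format "''p_' i").
Notation F i j := (finite_set (W ps o i j)).

Lemma finite_sub (P Q : seq pos * seq pos -> Prop) f g :
  (forall x, P x -> Q (f x)) -> (forall x, g (f x) = x) -> finite_set Q -> finite_set P.
Proof.
move=> hf hg [s hQ]; exists [seq g x | x <- s] => x hx.
by apply/mapP; exists (f x); rewrite ?hg //; apply/hQ/hf.
Qed.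

(** Moving p_(i-1) from the segment into the left component embeds W(i-1,j) into W(i,j). *)
Lemma F_left i j : 0 < i -> i <= o -> o <= j -> j < size ps -> F i j -> F i.-1 j.
Proof.
move=> hi hio hoj hj.
apply: (@finite_sub _ _ (fun x => (rcons x.1 'p_(i.-1), x.2))
   (fun x => (take (size x.1).-1 x.1, x.2))) => [[y0 y1] [/= h1 h2]|[y0 y1] /=].
  have hsg : seg ps i.-1 j = 'p_(i.-1) :: seg ps i j.
    by rewrite -seg_left ?al_S //; lia.
  rewrite hsg in h1 h2; split=> /=; rewrite cat_rcons; last first.
    by move=> l hl; apply: h2; lia.
  by rewrite size_rcons; move: h1; congr is_config; lia.
by rewrite size_rcons -cats1 take_size_cat.
Qed.

Lemma F_right i j : i <= o -> o <= j -> j.+1 < size ps -> F i j -> F i j.+1.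
Proof.
move=> hio hoj hj.
apply: (@finite_sub _ _ (fun x => (x.1, 'p_(j.+1) :: x.2))
   (fun x => (x.1, behead x.2))) => [[y0 y1] [/= h1 h2]|[y0 y1] //].
have hsg : seg ps i j.+1 = seg ps i j ++ [:: 'p_(j.+1)].
  by rewrite -seg_right ?bl_S //; lia.
rewrite hsg -catA in h1 h2; split=> //= l hl; apply: h2; lia.
Qed.

Lemma seg_self : seg ps o o = [:: 'p_o].
Proof. by rewrite /seg subnn (drop_nth (0,0)%R hos) /= take0. Qed.

Lemma W_self x0 x1 : is_config (x0 ++ 'p_o :: x1) (size x0) ->
  (x0 ++ 'p_o :: x1 =i ps) -> W ps o o o (x0, x1).
Proof.
move=> h1 h2; rewrite /W /= seg_self subnn addn0; split=> // l hl.
by apply/bcP => c _; apply: h2.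
Qed.

(* With [i = j] the two neighbours of the origin may be swapped, so that the reversed
   configuration is also an extension and interferes with the original one. *)
Lemma NI_self : 1 < size ps -> ~ NI ps o o o.
Proof.
move=> hn hNI; pose x0 := take o ps; pose x1 := drop o.+1 ps.
have e : ps = x0 ++ 'p_o :: x1 by rewrite -drop_nth // cat_take_drop.
have s0 : size x0 = o by rewrite size_takel // ltnW.
have h1 : W ps o o o (x0, x1).
  by apply: W_self; rewrite -e // s0; apply/is_configE.
have e' : rev ps = rev x1 ++ 'p_o :: rev x0.
  by rewrite {1}e rev_cat rev_cons cat_rcons.
have h2 : W ps o o o (rev x1, rev x0).
  apply: W_self; rewrite -e'; last exact: mem_rev.
  apply/is_configE; split; last by rewrite snake_rev.
    by rewrite !size_rev /x1 size_drop ltn_subrL /= (leq_ltn_trans (leq0n o)).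
  by rewrite e' nth_cat ltnn subnn.
have U1 : U ps o o o x0 by exists x1.
have U2 : U ps o o o (rev x1) by exists (rev x0).
have V1 : V ps o o o x1 by exists x0.
have V2 : V ps o o o (rev x0) by exists (rev x1).
(* Mixing the configuration with its reversal puts the same cells on both sides of the origin, which
   distinctness forbids. *)
have no s : W ps o o o (s, rev s) -> s = [::].
  case=> /= /is_configE[_ _ /snake_uniq]; rewrite cat_uniq seg_self => /and3P[_ /hasPn h _] _.
  case: s h => // a s /(_ a); rewrite /= inE mem_rev mem_head orbT => /(_ isT).
  by [].
have z0 := no _ (hNI _ _ U1 V2).
have := no (rev x1); rewrite revK => /(_ (hNI _ _ U2 V1)) z1.
by move: hn; rewrite e z0 -[x1]revK z1.
Qed.

Lemma CNI_char : 1 < size ps ->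
  (forall i j, i <= o -> o <= j -> i < j -> j < size ps -> F i j \/ ~ F i j) ->
  CNI ps o <->
  [/\ 0 < o -> ~ F o.-1 o, o.+1 < size ps -> ~ F o o.+1 &
    forall i j, 0 < i -> i <= o -> o <= j -> i < j -> j.+1 < size ps ->
      F i.-1 j \/ F i j.+1 -> NI ps o i j].
Proof.
move=> hn dec; split.
  move=> h; have vo : valid_ij ps o o o by [].
  have nF : ~ F o o by move=> hF; apply: (NI_self hn); apply: h => //; right; right.
  split.
  - by move=> ho0 hF; apply: (NI_self hn); apply: h => //; left.
  - by move=> ho0 hF; apply: (NI_self hn); apply: h => //; right; left.
  - move=> i j hi hio hoj hij hj hF; apply: h; first by split; [|split=> //; lia].
    have [hK|hK] := dec i j hio hoj hij (ltnW hj); first by right; right.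
    by case: hF => hF; [left|right; left].
move=> [h1 h2 h3] i j [hio [hoj hj]] hIJK.
have [hij|hij] := ltnP i j; last first.
  have ei : i = o by lia.
  have ej : j = o by lia.
  subst i j; exfalso.
  case: hIJK => [[ho0 [_ /(h1 ho0)]]|[[ho0 [_ /(h2 ho0)]]|]] //.
  (* There are at least two positions, so the origin has a neighbour; finiteness at (o,o) would pass
     to the pair enlarged by it. *)
  have [e|ho0] := posnP o; last by move/(F_left ho0 (leqnn _) (leqnn _) hj)/h1; apply.
  have hn1 : o.+1 < size ps by rewrite e.
  by move/(F_right (leqnn _) (leqnn _) hn1)/h2; apply.
have [e|hi] := posnP i; first by apply: NI_left_end.
have [hj1|hj1] := leqP (size ps) j.+1; first by apply: NI_right_end.
apply: h3 => //; case: hIJK => [[_ [_ hF]]|[[_ [_ hF]]|hF]]; [by left|by right|left].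
exact: F_left.
Qed.

(** The [bc] of the lone origin is zero, so neither side can contain a cell. *)
Lemma CNI_single : size ps <= 1 -> CNI ps o.
Proof.
move=> hn i j [hio [hoj hj]] _.
have oo : o = 0 by lia.
have ei : i = o by lia.
have ej : j = o by lia.
have ep : ps = [:: 'p_o].
  by case: (ps) hn hos => [|a [|//]] //=; rewrite oo.
have nil x0 x1 : W ps o o o (x0, x1) -> x0 = [::] /\ x1 = [::].
  case=> /=; rewrite seg_self => /is_configE[_ _ h] hb.
  have hb0 := hb o; rewrite leqnn in hb0; have /bcP hb' := hb0 isT.
  have aux c : adj 'p_o c -> c \in x0 ++ [:: 'p_o] ++ x1 -> False.
    by move=> hc; rewrite (hb' c hc) ep inE => /eqP e; rewrite -e adjxx in hc.
  split.
    case/lastP: x0 h aux {hb hb0 hb'} => // s d h aux; case: (aux d); last by rewrite mem_cat mem_rcons mem_head.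
    by move: h; rewrite -cats1 -catA => /snake_catr; rewrite cat1s snake_cons2 adj_sym => /and3P[].
  case: x1 h aux {hb hb0 hb'} => // d s h aux; case: (aux d); last by rewrite !mem_cat mem_head !orbT.
  by move: h => /snake_catr; rewrite cat1s snake_cons2 => /and3P[].
subst i j => x0 x1 [x1' hu] [x0' hv].
have [e0 _] := nil _ _ hu; have [e0' _] := nil _ _ hv.
by rewrite e0 -e0'.
Qed.
End CNI.

(** * Decoding the input *)

Arguments sym_code : simpl never.

Lemma isym_comparable : comparable isym.
Proof. by move=> x y; rewrite /decidable; decide equality. Qed.

HB.instance Definition _ := hasDecEq.Build isym (compareP isym_comparable).

Lemma isym_eqE (a b : isym) : (a == b) =
  match a, b with I0, I0 | I1, I1 | IMinus, IMinus | IComma, IComma => true | _, _ => false end.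
Proof. by apply/eqP/idP; case: a; case: b. Qed.

Definition bit_sym (a : isym) : bool := (a == I0) || (a == I1).

(** Symbols other than bits are skipped without changing the weight, so a leading minus sign leaves
    the absolute value. *)
Fixpoint vall (l : seq isym) : nat :=
  if l is a :: l' then (a == I1) + (if bit_sym a then 2 else 1) * vall l' else 0.

Lemma vall_rcons l a : vall (rcons l a) = vall l + (a == I1) * 2 ^ count bit_sym l.
Proof.
elim: l => [|b l IH] /=; first by rewrite muln0 expn0 muln1 addn0.
rewrite IH; case: (bit_sym b) => /=; rewrite ?expnD; lia.
Qed.

Lemma binf_vall fuel n : n <= fuel -> vall (binf fuel n) = n.
Proof.
elim: fuel n => [|fuel IH] [|n] //= hn.
have hd : uphalf n <= fuel by rewrite uphalf_half; lia.
have e := odd_double_half n.+1; rewrite -[RHS]e /= IH //.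
by case: (odd n) => /=; rewrite /bit_sym !isym_eqE /=; lia.
Qed.

Lemma bin_vall n : vall (bin n) = n.
Proof. exact: binf_vall. Qed.

Lemma binf_bits fuel n : all bit_sym (binf fuel n).
Proof.
elim: fuel n => [|fuel IH] [|n] //=; rewrite IH andbT.
by case: (odd n); rewrite /bit_sym !isym_eqE.
Qed.

Definition fields (ps : seq pos) (o : nat) : seq (seq isym) :=
  bin o :: flatten [seq [:: enc_int p.1; enc_int p.2] | p <- ps].

Definition join (F : seq (seq isym)) : seq isym := flatten [seq rcons f IComma | f <- F].

Lemma join_cat F G : join (F ++ G) = join F ++ join G.
Proof. by rewrite /join map_cat flatten_cat. Qed.

Lemma enc_config_fields ps o : enc_config ps o = join (fields ps o).
Proof.
rewrite /enc_config /join /fields /= cat_rcons; congr (_ ++ _ :: _).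
elim: ps => [|p ps IH] //=; rewrite IH -!catA !cat_rcons /=.
by rewrite -catA.
Qed.

Lemma size_fields ps o : size (fields ps o) = (2 * size ps).+1.
Proof. by rewrite /fields /=; elim: ps => [|p ps IH] //=; lia. Qed.

Lemma nth_fields ps o q : q < size ps ->
  nth [::] (fields ps o) (q + q).+1 = enc_int (nth (0,0)%R ps q).1 /\
  nth [::] (fields ps o) (q + q).+2 = enc_int (nth (0,0)%R ps q).2.
Proof.
rewrite /fields /=; elim: ps q => [|p ps IH] [|q] //= hq.
by rewrite addnS /=; apply: IH.
Qed.

Lemma enc_int_free z : IComma \notin enc_int z.
Proof.
have h n : IComma \notin bin n.
  by apply/negP => hh; have /allP/(_ _ hh) := binf_bits n n; rewrite /bit_sym !isym_eqE.
case: z => n; first exact: h.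
by rewrite -[enc_int _]/(IMinus :: bin n.+1) inE negb_or isym_eqE h.
Qed.

Lemma fields_free ps o f : f \in fields ps o -> IComma \notin f.
Proof.
rewrite inE => /orP[/eqP->|]; first exact: (enc_int_free (Posz o)).
elim: ps => [|p ps IH] //=; rewrite !inE => /or3P[/eqP->|/eqP->|//]; exact: enc_int_free.
Qed.

Lemma count_join (F : seq (seq isym)) : (forall f, f \in F -> IComma \notin f) ->
  count_mem IComma (join F) = size F.
Proof.
elim: F => [|f F IH] //= h; rewrite /join /= count_cat -/(join F) IH; last first.
  by move=> g hg; apply: h; rewrite inE hg orbT.
rewrite -cats1 count_cat /= eqxx.
by have /count_memPn-> := h f (mem_head _ _).
Qed.

Lemma join_last F : join F = [::] \/ exists l, join F = rcons l IComma.
Proof.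
case/lastP: F => [|F f]; [by left|right].
by rewrite -cats1 join_cat /join /= cats0 -rcons_cat; exists (flatten [seq rcons f IComma | f <- F] ++ f).
Qed.

(** A loop over the whole input acts only inside the field it reads. *)
Lemma iteri_window (g : nat -> nat -> nat) z N st len : st + len <= N ->
  (forall c acc, c < N -> (c < st) || (st + len <= c) -> g c acc = acc) ->
  iteri N g z = iteri len (fun i => g (st + i)) z.
Proof.
move=> hN hg; rewrite -(subnK hN) addnC.
have step m : st + len + m <= N -> iteri (st + len + m) g z = iteri (st + len) g z.
  elim: m => [|m IH] hm; first by rewrite addn0.
  rewrite addnS /= hg; [by apply: IH; lia|lia|lia].
rewrite step; last by rewrite subnKC.
have {}step m : m <= st -> iteri m g z = z.
  by elim: m => [|m IH] hm //=; rewrite hg; [apply: IH; lia|lia|lia].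
elim: len {hN hg} => [|len IH] /=; first by rewrite addn0 step.
by rewrite addnS /= IH.
Qed.

Section Decode.
Variables (u : seq isym) (F : seq (seq isym)) (x : ctx) (M : nat).
Hypotheses (hu : u = join F) (hF : forall f, f \in F -> IComma \notin f).
Hypotheses (hsu : M = (size u).+1) (hM : cM x = M) (hMB : M <= cB x)
  (hw : cw x = fun i => nth ord0 (map sym_code u) i).

Lemma sym_code_inj : injective sym_code.
Proof. by move=> a b /(congr1 val); case: a; case: b; rewrite /= !inordK. Qed.

Lemma cw_eq c a : (cw x c == sym_code a) = (c < size u) && (nth IComma u c == a).
Proof.
rewrite hw; case: ltnP => h /=.
  by rewrite (nth_map IComma) // (inj_eq sym_code_inj).
by rewrite nth_default ?size_map // eq_sym (negbTE (sym_code_neq0 a)).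
Qed.

Lemma cntc_count c : c <= M -> cntc x c = count_mem IComma (take c u).
Proof.
move=> hc; elim: c hc => [|c IH] hc; first by rewrite take0.
rewrite /cntc /= -/(cntc x c) IH ?cw_eq; last exact: ltnW.
have hle : count_mem IComma (take c u) <= c.
  by apply: leq_trans (count_size _ _) _; rewrite size_take; case: ifP => // ?; lia.
case: (ltnP c (size u)) => h /=; last by rewrite (take_oversize h) (take_oversize (leqW h)).
rewrite (take_nth IComma) // -cats1 count_cat /= addn0 /sc.
case: eqP => _; last by rewrite addn0.
by rewrite addn1; apply/minn_idPr; apply: leq_trans hMB; apply: leq_trans hc.
Qed.

Section Field.
Variables (k st : nat) (f : seq isym).
Hypotheses (hk : k < size F) (hf : f = nth [::] F k) (hst : st = size (join (take k F))).

Lemma field_split : u = join (take k F) ++ f ++ IComma :: join (drop k.+1 F).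
Proof.
rewrite {1}hu -[in LHS](cat_take_drop k F) join_cat (drop_nth [::] hk) -hf.
by rewrite /join /= cat_rcons.
Qed.

Lemma field_size : st + size f < size u.
Proof. by rewrite field_split hst !size_cat ltn_add2l /= addnS ltnS leq_addr. Qed.

Lemma count_at i : i <= size f -> count_mem IComma (take (st + i) u) = k.
Proof.
move=> hi; rewrite field_split hst takeD take_size_cat // drop_size_cat // count_cat.
rewrite takel_cat // count_join; last by move=> g /mem_take; apply: hF.
rewrite (size_takel (ltnW hk)).
have : count_mem IComma f = 0.
  by apply/count_memPn; apply: hF; rewrite hf mem_nth.
rewrite -{1}(cat_take_drop i f) count_cat => /eqP; rewrite addn_eq0 => /andP[/eqP-> _].
exact: addn0.
Qed.

(** The second bound is not strict: the comma that ends field [k] also has [k] commas before it. *)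
Lemma count_window c : c < size u -> (count_mem IComma (take c u) == k) ->
  st <= c /\ c <= st + size f.
Proof.
move=> hc e; split.
  rewrite leqNgt; apply/negP => hlt; move: e.
  case: (join_last (take k F)) => [e0|[l el]]; first by rewrite hst e0 in hlt.
  have : count_mem IComma (join (take k F)) = k.
    by rewrite count_join ?(size_takel (ltnW hk)) // => g /mem_take; apply: hF.
  move: hlt; rewrite hst field_split el size_rcons ltnS => hlt.
  rewrite takel_cat ?size_rcons; last by lia.
  rewrite -cats1 count_cat /= takel_cat // => <-.
  have := count_cat (pred1 IComma) (take c l) (drop c l); rewrite cat_take_drop => ->.
  by rewrite (eqxx IComma) -addnA -[X in X == _]addn0 eqn_add2l /= addn0 addn1.
rewrite leqNgt; apply/negP => hlt.
have : take (st + size f).+1 u = rcons (take (st + size f) u) IComma.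
  rewrite (take_nth IComma field_size); congr rcons.
  rewrite field_split hst nth_cat ltnNge leq_addr /= addKn nth_cat ltnn subnn //.
move/(congr1 (count_mem IComma)); rewrite -cats1 count_cat count_at //= (eqxx IComma) addn1 => e2.
have : count_mem IComma (take (st + size f).+1 u) <= count_mem IComma (take c u).
  by rewrite -(subnKC hlt) takeD count_cat leq_addr.
by rewrite (eqP e) e2 ltnn.
Qed.

Lemma nth_field i : i < size f -> nth IComma u (st + i) = nth IComma f i.
Proof.
by move=> hi; rewrite field_split hst nth_cat ltnNge leq_addr /= addKn nth_cat hi.
Qed.

Lemma in_window c a : c < M -> a != IComma -> (cntc x c == k) && (cw x c == sym_code a) ->
  st <= c < st + size f.
Proof.
move=> hc ha /andP[]; rewrite (cntc_count (ltnW hc)) cw_eq => h /andP[hcu hn].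
have [-> h2] := count_window hcu h; rewrite /= ltn_neqAle h2 andbT.
apply/eqP => e; move: hn; rewrite e field_split hst nth_cat ltnNge leq_addr /= addKn.
by rewrite nth_cat ltnn subnn /= eq_sym (negbTE ha).
Qed.

Lemma window_eq i a : i < size f ->
  (cntc x (st + i) == k) && (cw x (st + i) == sym_code a) = (nth IComma f i == a).
Proof.
move=> hi; have h : st + i < size u by apply: leq_ltn_trans field_size; rewrite leq_add2l ltnW.
have h' : st + i <= M by rewrite hsu ltnW // ltnS ltnW.
by rewrite (cntc_count h') (count_at (ltnW hi)) eqxx /= cw_eq nth_field // h.
Qed.

(** Truncating after each addition gives the same as truncating once at the end, so saturation does
    not distort the recursion. *)
Lemma pw_field i : i <= size f -> pw x k (st + i) = minn (cB x) (2 ^ count bit_sym (take i f)).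
Proof.
move=> hi; have h := field_size.
have hlt : st + i <= M.
  by rewrite hsu; apply: leqW; apply: leq_trans (ltnW h); rewrite leq_add2l.
rewrite /pw (@iteri_window _ _ _ st i) //; last first.
  move=> c acc hc hlt'; case: ifP => // /andP[h1 h2].
  have hcM : c < M by apply: leq_trans hlt.
  have : st <= c < st + size f.
    case/orP: h2 => h2.
      by apply: (@in_window c I0 hcM); rewrite ?isym_eqE ?h1.
    by apply: (@in_window c I1 hcM); rewrite ?isym_eqE ?h1.
  by lia.
elim: i hi hlt => [|i IH] hi hlt /=; first by rewrite take0 expn0; apply/esym/minn_idPr; lia.
have hi' : i < size f by lia.
have := window_eq I0 hi'; have := window_eq I1 hi'; rewrite /isbit andb_orr => -> ->.
rewrite IH; [|lia|lia].
rewrite (take_nth IComma hi') -cats1 count_cat /= addn0 /bit_sym.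
by case: (_ || _); rewrite /addc ?addn0 // addn1 expnS; lia.
Qed.

Lemma fval_field : fval x k = minn (cB x) (vall f).
Proof.
have h := field_size; rewrite /fval (@iteri_window _ _ _ st (size f)) ?hM; last first.
- move=> c acc hc hlt'; case: ifP => // h1.
  have := @in_window c I1 hc _ h1; rewrite isym_eqE => /(_ isT); lia.
- by rewrite hsu; lia.
suff aux i : i <= size f -> iteri i (fun i0 acc => if (cntc x (st + i0) == k) && (cw x (st + i0) == sym_code I1)
   then addc x acc (pw x k (st + i0)) else acc) 0 = minn (cB x) (vall (take i f)).
  by rewrite aux // take_size.
elim: i => [|i IH] hi /=; first by rewrite take0 /= minn0.
rewrite IH ?window_eq //; last by lia.
rewrite (take_nth IComma hi) vall_rcons.
case: eqP => _; last by rewrite mul0n addn0.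
by rewrite /addc pw_field ?mul1n; lia.
Qed.

Lemma neg_field : neg x k = (IMinus \in f).
Proof.
have h := field_size; apply/exbP/idP => [[c hc h1]|hin].
  rewrite hM in hc; have := @in_window c IMinus hc _ h1; rewrite isym_eqE => /(_ isT) hw1.
  have hi : c - st < size f by lia.
  have e : c = st + (c - st) by lia.
  by rewrite e window_eq // in h1; rewrite -(eqP h1) mem_nth.
have hi : index IMinus f < size f by rewrite index_mem.
exists (st + index IMinus f); first by rewrite hM hsu; lia.
by rewrite window_eq // nth_index.
Qed.
End Field.

Lemma fval_fieldE k : k < size F -> fval x k = minn (cB x) (vall (nth [::] F k)).
Proof. by move=> hk; apply: fval_field. Qed.

Lemma neg_fieldE k : k < size F -> neg x k = (IMinus \in nth [::] F k).
Proof. by move=> hk; apply: neg_field. Qed.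
End Decode.

(** * Size of the coordinates and correctness of their decoding *)

Lemma snake_dist s l m : snake s -> l <= m -> m < size s ->
  (`|((nth (0, 0)%R s m).1 - (nth (0, 0)%R s l).1)%R| <= m - l) /\
  (`|((nth (0, 0)%R s m).2 - (nth (0, 0)%R s l).2)%R| <= m - l).
Proof.
move=> /snakeP[h _ _]; elim: m => [|m IH] hlm hm.
  have -> : l = 0 by lia.
  by lia.
have [->|ne] := eqVneq l m.+1; first by lia.
have hlm' : l <= m by lia.
have [h1 h2] := IH hlm' (ltnW hm).
move: h1 h2 (h m hm); rewrite adjE.
by move: (nth _ s m.+1) (nth _ s m) (nth _ s l) => [a b] [c d] [a' b'] /=; lia.
Qed.

(** A coordinate changes by at most one per step and vanishes at the origin, so its value, not only
    its binary length, is linear in the input. *)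
Lemma snake_inside s o p : snake s -> o < size s -> nth (0, 0)%R s o = (0, 0)%R ->
  p \in s -> inside (size s) p.
Proof.
move=> hs ho h0 /(nthP (0,0)%R)[l hl <-]; rewrite /inside.
have [hlo|hlo] := leqP l o.
  have hd := snake_dist hs hlo ho; move: hd ho hl; rewrite h0.
  by move: (nth _ s l) (size s) => [a b] n /=; lia.
have hd := snake_dist hs (ltnW hlo) hl; move: hd ho hl; rewrite h0.
by move: (nth _ s l) (size s) => [a b] n /=; lia.
Qed.

Lemma enc_int_val z :
  vall (enc_int z) = `|z|%N /\ (IMinus \in enc_int z) = (z < 0)%R.
Proof.
have h n : IMinus \notin bin n.
  by apply/negP => hh; have /allP/(_ _ hh) := binf_bits n n; rewrite /bit_sym !isym_eqE.
case: z => n; first by rewrite bin_vall (negbTE (h n)).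
rewrite -[enc_int _]/(IMinus :: bin n.+1) mem_head; split=> //.
rewrite -[vall _]/((IMinus == I1) + (if bit_sym IMinus then 2 else 1) * vall (bin n.+1)).
by rewrite bin_vall /bit_sym !isym_eqE /=; lia.
Qed.

Section Coordinates.
Variables (ps : seq pos) (o : nat) (x : ctx) (M : nat).
Hypotheses (hos : o < size ps) (ho : nth (0, 0)%R ps o = (0, 0)%R) (hs : snake ps).
Let u := enc_config ps o.
Hypotheses (hsu : M = (size u).+1) (hB : cB x = 9 * M ^ 2) (hM : cM x = M)
  (hw : cw x = fun i => nth ord0 (map sym_code u) i).

Let hu : u = join (fields ps o) := enc_config_fields ps o.
Let hF := @fields_free ps o.

Lemma M_le_cap : 0 < M /\ 5 * M <= cB x.
Proof.
have hM0 : 0 < M by rewrite hsu.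
have : M <= M ^ 2 by rewrite -mulnn leq_pmulr.
by rewrite hB; split=> //; lia.
Qed.

Let hMB : M <= cB x.
Proof. by have := M_le_cap; lia. Qed.

Lemma count_u : count_mem IComma u = (2 * size ps).+1.
Proof. by rewrite hu count_join ?size_fields. Qed.

(** Each position contributes two commas to the input and the index of the origin one more. *)
Lemma M_ge_size : 2 * size ps + 2 <= M.
Proof. by have := count_size (pred1 IComma) u; rewrite count_u hsu addn2 ltnS. Qed.

Lemma npos_ok q : q <= M -> npos x q = (q < size ps).
Proof.
move=> hq; rewrite /npos hM (cntc_count hsu hM hMB hw (leqnn M)) take_oversize ?hsu //.
by rewrite count_u /sc /addc; have := M_le_cap; lia.
Qed.

Lemma orig_ok : orig x = o.
Proof.
rewrite /orig (fval_fieldE hu hF hsu hM hMB hw) ?size_fields //.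
by rewrite [nth _ _ _]/= bin_vall; have := M_le_cap; have := M_ge_size; lia.
Qed.

Lemma crd_ok k z : k < size (fields ps o) -> nth [::] (fields ps o) k = enc_int z ->
  `|z| < M -> Posz (crd x k) = (Posz M + z)%R.
Proof.
move=> hk hz hzM; have := M_le_cap.
rewrite /crd (fval_fieldE hu hF hsu hM hMB hw) // (neg_fieldE hu hF hsu hM hMB hw) //.
have [e1 e2] := enc_int_val z; rewrite hz e1 e2 hM /addc.
by case: ltP; lia.
Qed.

Lemma p_inside p : p \in ps -> inside M.-1 p.
Proof.
move/(snake_inside hs hos ho); rewrite /inside => /andP[h1 h2].
by have := M_ge_size; lia.
Qed.

Lemma pxy_ok q : q < size ps ->
  Posz (px x q) = (Posz M + (nth (0, 0)%R ps q).1)%R /\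
  Posz (py x q) = (Posz M + (nth (0, 0)%R ps q).2)%R.
Proof.
move=> hq; have [e1 e2] := nth_fields o hq.
have := p_inside (mem_nth (0,0)%R hq); rewrite /inside => /andP[h1 h2].
have hc := M_le_cap; have hn := M_ge_size.
have s1 : addc x q q = q + q by rewrite /addc; lia.
have s2 : sc x (q + q) = (q + q).+1 by rewrite /sc; lia.
have s3 : sc x (q + q).+1 = (q + q).+2 by rewrite /sc; lia.
have hk : (q + q).+2 < size (fields ps o) by rewrite size_fields ltnS; lia.
rewrite /px /py s1 s2 s3; split; apply: crd_ok => //.
- exact: ltnW hk.
- exact: leq_trans h1 (leq_pred _).
- exact: leq_trans h2 (leq_pred _).
Qed.
End Coordinates.

(** * Correctness of the decision procedure *)

Section Marks.
Variables (x : ctx) (p : ctx -> nat -> bool).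

Definition round (S0 : seq nat) : seq nat :=
  foldl (fun S1 c => if p (setS x S1) c then c :: S1 else S1) S0 (iota 0 (cB x)).

Lemma marksE : marks x p = iter (cB x) round [::].
Proof. by []. Qed.

Lemma marks_ind (Q : nat -> Prop) :
  (forall S c, (forall y, y \in S -> Q y) -> p (setS x S) c -> Q c) ->
  forall c, c \in marks x p -> Q c.
Proof.
move=> hQ; rewrite marksE; elim: (cB x) => //= n; set S0 := iter n _ _.
rewrite /round; elim: (iota 0 _) S0 => //= d l IH S0 hS0; apply: IH.
case: ifP => // hp y; rewrite inE => /orP[/eqP->|]; last exact: hS0.
exact: hQ hp.
Qed.

Lemma round_sub S0 : {subset S0 <= round S0}.
Proof.
move=> y; rewrite /round; elim: (iota 0 _) S0 => //= d l IH S0 hy; apply: IH.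
by case: ifP => // _; rewrite inE hy orbT.
Qed.

(** Marks accumulate during a round, so the set seen when [c] is tested is only known to contain
    [S0]. *)
Lemma round_add S0 c : c < cB x ->
  (forall S1, {subset S0 <= S1} -> p (setS x S1) c) -> c \in round S0.
Proof.
move=> hc hp; have : c \in iota 0 (cB x) by rewrite mem_iota.
have keep l S1 y : y \in S1 ->
    y \in foldl (fun S1 c => if p (setS x S1) c then c :: S1 else S1) S1 l.
  elim: l S1 => //= d l IH S1 hy; apply: IH.
  by case: ifP => // _; rewrite inE hy orbT.
have aux l S1 : {subset S0 <= S1} -> c \in l ->
    c \in foldl (fun S1 c => if p (setS x S1) c then c :: S1 else S1) S1 l.
  elim: l S1 => //= d l IH S1 hS; rewrite inE => /orP[/eqP e|hl].
    by apply: keep; rewrite -e hp // mem_head.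
  by apply: IH => // y /hS hy; case: ifP => // _; rewrite inE hy orbT.
exact: aux.
Qed.

Lemma iter_round_le m n : m <= n -> {subset iter m round [::] <= iter n round [::]}.
Proof.
move=> /subnK<-; elim: (n - m) => //= k IH y hy; idtac.
by apply/round_sub/IH.
Qed.
End Marks.

(** * Cells of the grid and their numbers *)

Section Cells.
Variable M : nat.
Notation D := (2 * M).+1.

Definition cellp (a b : nat) : pos := (Posz a - Posz M, Posz b - Posz M)%R.
Definition xof (c : pos) : nat := absz (c.1 + Posz M)%R.
Definition yof (c : pos) : nat := absz (c.2 + Posz M)%R.

Lemma nearb_ok a b a' b' : nearb a b a' b' = near (cellp a b) (cellp a' b').
Proof. by rewrite nearE /nearb /cellp /=; lia. Qed.

Lemma cellpK c : inbox M c -> [/\ xof c < D, yof c < D & cellp (xof c) (yof c) = c].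
Proof.
case: c => c d /andP[/= h1 h2]; rewrite /xof /yof /cellp /=.
by split; [lia|lia|congr (_, _); lia].
Qed.

Lemma xof_cellp a b : xof (cellp a b) = a /\ yof (cellp a b) = b.
Proof. by rewrite /xof /yof /cellp /=; lia. Qed.

Lemma inbox_cellp a b : a < D -> b < D -> inbox M (cellp a b).
Proof. by rewrite /inbox /cellp /=; lia. Qed.
End Cells.

Section Grid.
Variables (ps : seq pos) (o : nat) (x : ctx) (M : nat).
Hypotheses (hos : o < size ps) (ho : nth (0, 0)%R ps o = (0, 0)%R) (hs : snake ps).
Hypotheses (hsu : M = (size (enc_config ps o)).+1) (hB : cB x = 9 * M ^ 2) (hM : cM x = M)
  (hw : cw x = fun i => nth ord0 (map sym_code (enc_config ps o)) i).

Notation D := (2 * M).+1.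
Notation "'p_ i" := (nth (0, 0)%R ps i) (at level 8, i at level 2, format "''p_' i").

Lemma dim_ok : gdim x = D.
Proof. by have [h1 h2] := M_le_cap hos hs hsu hB hM; rewrite /gdim /sc /addc hM; lia. Qed.

Lemma idx_ok a b : a < D -> b < D -> idx x a b = a + D * b /\ idx x a b < cB x.
Proof.
move=> ha hb; have [h1 _] := M_le_cap hos hs hsu hB hM.
have hD : a + D * b < D * D.
  by apply: (@leq_trans (D * b.+1)); rewrite ?leq_mul2l ?hb ?orbT // mulnS ltn_add2r.
(* The origin of the factor 9 in the cap: D is at most 3M, so cell numbers never saturate. *)
have hDB : D * D <= cB x.
  have : D * D <= (3 * M) * (3 * M) by apply: leq_mul; lia.
  by rewrite hB -mulnn; lia.
by rewrite /idx /addc /mulc dim_ok; lia.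
Qed.


Lemma cellp_ok k a b : k < size ps -> (a == px x k) && (b == py x k) = (cellp M a b == 'p_k).
Proof.
move=> hk; have [] := pxy_ok hos ho hs hsu hB hM hw hk.
case: ('p_k) => c d /= h1 h2; rewrite /cellp xpair_eqE /=.
have -> : (Posz a - Posz M == c)%R = (a == px x k) by apply/eqP/eqP; lia.
by have -> : (Posz b - Posz M == d)%R = (b == py x k) by apply/eqP/eqP; lia.
Qed.

Lemma mem_seg u v c : u <= v ->
  reflect (exists2 q, q < size ps & [/\ u <= q, q <= v & c = 'p_q]) (c \in seg ps u v).
Proof.
move=> huv; apply: (iffP (nthP (0,0)%R)) => [[q hq <-]|[q hq [h1 h2 ->]]].
  move: hq; rewrite /seg size_take_min size_drop leq_min => /andP[hq1 hq2].
  rewrite /seg nth_take // nth_drop; exists (u + q); first by rewrite -ltn_subRL.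
  by split=> //; lia.
exists (q - u).
  by rewrite /seg size_take_min size_drop leq_min ltnS leq_sub2r //= ltn_sub2r // (leq_ltn_trans h1).
by rewrite /seg nth_take ?nth_drop ?subnKC // ltnS leq_sub2r.
Qed.

Lemma blocked_ok u v a b : u <= v ->
  blocked x u v a b = ~~ clear (seg ps u v) (cellp M a b).
Proof.
move=> huv; rewrite /clear negbK; have [hn _] := M_le_cap hos hs hsu hB hM.
have hMn := M_ge_size hsu.
have near_p q : q < size ps -> nearb (px x q) (py x q) a b = near (cellp M a b) 'p_q.
  move=> hq; have := cellp_ok (px x q) (py x q) hq; rewrite !eqxx => /esym/eqP <-.
  by rewrite (nearb_ok M) near_sym.
apply/exbP/hasP => [[q hq /and4P[h1 h2 h3 h4]]|[c /(mem_seg _ huv)[q hq [h1 h2 ->]] hc]].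
  rewrite (npos_ok hos hs hsu hB hM hw) in h1; last by rewrite -hM ltnW.
  exists 'p_q; last by rewrite -near_p.
  by apply/mem_seg => //; exists q.
have hqM : q < M by lia.
exists q; first by rewrite hM.
by rewrite (npos_ok hos hs hsu hB hM hw) ?hq ?h1 ?h2 ?near_p //; apply: ltnW.
Qed.

Section Reach.
Variables (k u v : nat).
Hypotheses (huv : u <= v) (hk : k < size ps).

Lemma stepb_ok S c :
  reflect (exists a b, [/\ a < D, b < D, c = idx x a b &
    cellp M a b = 'p_k \/ clear (seg ps u v) (cellp M a b) /\
    exists a' b', [/\ a' < D, b' < D, near (cellp M a b) (cellp M a' b') & idx x a' b' \in S]])
  (stepb (setS x S) c k u v).
Proof.
apply: (iffP (exbP _ _)); rewrite -[gdim (setS x S)]/(gdim x) dim_ok.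
  case=> a ha /exbP[b] => hb /and3P[/eqP h1 h2 h3].
  exists a, b; split=> //.
  move: h2 h3; rewrite /freeb -[px _ k]/(px x k) -[py _ k]/(py x k) cellp_ok //.
  rewrite -[blocked (setS x S) _ _ _ _]/(blocked x u v a b) blocked_ok // negbK.
  case: eqP => [e|_] /=; [by left|move=> h2 /exbP[a']].
  move=> ha' /exbP[b'] => hb' /andP[h3 h4].
  by right; split=> //; exists a', b'; rewrite -(nearb_ok M).
case=> a [b [ha hb hc h]]; exists a => //; apply/exbP.
exists b => //.
rewrite /freeb -[px _ k]/(px x k) -[py _ k]/(py x k) cellp_ok //.
rewrite -[blocked (setS x S) _ _ _ _]/(blocked x u v a b) blocked_ok // negbK.
rewrite -[idx (setS x S) a b]/(idx x a b) hc eqxx /=.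
case: h => [->|[-> [a' [b' [h1 h2 h3 h4]]]]]; first by rewrite eqxx.
rewrite orbT /=; apply/orP; right; apply/exbP.
exists a' => //.
apply/exbP; exists b' => //.
by rewrite (nearb_ok M) h3.
Qed.

Definition idxp (c : pos) : nat := idx x (xof M c) (yof M c).




Lemma idx_inj a b a' b' : a < D -> b < D -> a' < D -> b' < D ->
  idx x a b = idx x a' b' -> a = a' /\ b = b'.
Proof.
move=> ha hb ha' hb'; have [-> _] := idx_ok ha hb; have [-> _] := idx_ok ha' hb' => e.
have eb : b = b'.
  have := congr1 (divn^~ D) e; rewrite /= ![_ + D * _]addnC ![D * _]mulnC !divnMDl //.
  by rewrite !divn_small // !addn0.
by move: e; rewrite eb => /addIn.
Qed.

Lemma p_inbox : inbox M 'p_k.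
Proof.
have /andP[h1 h2] := p_inside hos ho hs hsu hB hM (mem_nth (0,0)%R hk).
by apply/andP; split; apply: leq_trans (leq_pred M); apply: ltnW.
Qed.

Lemma reach_sound c : c \in marks x (fun x' c => stepb x' c k u v) ->
  exists a b, [/\ a < D, b < D, c = idx x a b & conn (clear (seg ps u v)) 'p_k (cellp M a b)].
Proof.
move: c; apply: marks_ind => S c hS /stepb_ok[a [b [ha hb hc h]]]; exists a, b; split=> //.
case: h => [->|[h1 [a' [b' [ha' hb' hn /hS[a2 [b2 [ha2 hb2 e hconn]]]]]]]]; first exact: conn_refl.
have [e1 e2] := idx_inj ha' hb' ha2 hb2 e.
by apply: conn_step hconn _ h1; rewrite -e1 -e2.
Qed.

(** The walk is first made induced. Its cells then have distinct numbers below the cap, so its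
    length does not exceed the number of rounds, and each round marks at least one further cell
    along it. *)
Lemma reach_complete c : inbox M c ->
  conn (fun y => inbox M y && clear (seg ps u v) y) 'p_k c ->
  idxp c \in marks x (fun x' c => stepb x' c k u v).
Proof.
move=> hc /conn_snake[s hsn [<- hP]].
have hin : all (inbox M) (rcons s 'p_k).
  by rewrite all_rcons p_inbox; apply: sub_all hP => y /andP[].
have hsz : (size s).+1 <= cB x.
  have hu : uniq [seq idxp y | y <- rcons s 'p_k].
    rewrite map_inj_in_uniq ?snake_uniq // => y z /(allP hin) hy /(allP hin) hz.
    have [h1 h2 <-] := cellpK hy; have [h3 h4 <-] := cellpK hz.
    by rewrite /idxp !(proj1 (xof_cellp _ _ _)) !(proj2 (xof_cellp _ _ _)) => /idx_inj[] // -> ->.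
  have := @uniq_leq_size _ _ (iota 0 (cB x)) hu.
  rewrite size_map size_rcons size_iota; apply=> _ /mapP[y /(allP hin)/cellpK[h1 h2 _] ->].
  by rewrite mem_iota /=; have [_] := idx_ok h1 h2.
rewrite marksE; apply: (iter_round_le hsz) => {hsz}.
have idxp_lt y : inbox M y -> idxp y < cB x.
  by move=> /cellpK[h1 h2 _]; have [_] := idx_ok h1 h2.
elim: s hsn hP hin => [|y s IH] hsn hP hin.
  apply: round_add => [|S1 _]; first by apply/idxp_lt/p_inbox.
  have [h1 h2 h3] := cellpK p_inbox.
  by apply/stepb_ok; exists (xof M 'p_k), (yof M 'p_k); split=> //; left.
move: hP hin; rewrite rcons_cons /= => /andP[/andP[hy1 hy2] hP] /andP[_ hin].
have {}IH := IH (snake_catr (s := [:: y]) hsn) hP hin.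
apply: round_add => [|S1 hS1]; first exact: idxp_lt.
have [h1 h2 h3] := cellpK hy1; apply/stepb_ok; exists (xof M y), (yof M y); split=> //.
right; rewrite h3; split=> //.
have hh : inbox M (head 'p_k s) /\ near y (head 'p_k s).
  move: hsn; rewrite rcons_cons; case: (s) hin => [|z s'] /= /andP[hz _]; rewrite ?andbT.
    by move=> /adj_near.
  by move=> /and3P[_ /adj_near].
have [h4 h5] := hh; have [g1 g2 g3] := cellpK h4.
by exists (xof M (head 'p_k s)), (yof M (head 'p_k s)); split=> //; [rewrite g3|apply: hS1].
Qed.

Lemma reach_ok a b : a < D -> b < D ->
  reflect (conn (clear (seg ps u v)) 'p_k (cellp M a b)) (reach x k u v a b).
Proof.
move=> ha hb; apply: (iffP idP) => [/reach_sound[a' [b' [ha' hb' e h]]]|h].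
  by have [-> ->] := idx_inj ha hb ha' hb' e.
have hbox := inbox_cellp ha hb.
have : conn (fun y => inbox M y && clear (seg ps u v) y) 'p_k (cellp M a b).
  (* The walk may leave the grid; it is pulled back into the box, outside of which every cell is
     clear. *)
  apply: conn_box p_inbox hbox h => c hc; apply/hasPn => y hy.
  have := mem_seg y huv; rewrite hy => /elimT/(_ isT)[q hq [_ _ ey]].
  have := p_inside hos ho hs hsu hB hM (mem_nth (0,0)%R hq); rewrite -ey nearE.
  by move: hc; rewrite /inside; lia.
move/(reach_complete hbox); rewrite /idxp.
by have [-> ->] := xof_cellp M a b.
Qed.
End Reach.
End Grid.

(** * From the reachability tests to the condition *)

Section Correctness.
Variables (ps : seq pos) (o : nat).
Hypotheses (hos : o < size ps) (ho : nth (0, 0)%R ps o = (0, 0)%R) (hs : snake ps).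
Let x := input_ctx (enc_config ps o).
Let M := (size (enc_config ps o)).+1.
Let hsu : M = (size (enc_config ps o)).+1 := erefl.
Let hB : cB x = 9 * M ^ 2 := erefl.
Let hM : cM x = M := erefl.
Let hw : cw x = (fun i => nth ord0 (map sym_code (enc_config ps o)) i) := erefl.
Let capM := M_le_cap hos hs hsu hB hM.
Let sizeM := M_ge_size hsu.
Let hin := p_inside hos ho hs hsu hB hM.
Let reachP := reach_ok hos ho hs hsu hB hM hw.
Notation "'p_ i" := (nth (0, 0)%R ps i) (at level 8, i at level 2, format "''p_' i").

Lemma size_lt_M j : j < size ps -> j < M.
Proof. by move=> hj; apply: leq_trans hj _; have := sizeM; lia. Qed.

Lemma sc_ok j : j < M -> sc x j = j.+1.
Proof. by move=> hj; rewrite /sc; have := capM; lia. Qed.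

Lemma nposS j : j < M -> npos x j.+1 = (j.+1 < size ps).
Proof. by move=> hj; apply: (npos_ok hos hs hsu hB hM hw). Qed.

Lemma corner_ok : corner x = 2 * M.
Proof. by rewrite /corner /addc hM; have := capM; lia. Qed.

Lemma cellp_corner : cellp M (2 * M) (2 * M) = far M.
Proof. by rewrite /cellp /far; congr (_, _); lia. Qed.

Section Pair.
Variables (i j : nat).
Hypotheses (hio : i <= o) (hoj : o <= j) (hj : j < size ps).
Let hjM := size_lt_M hj.

Lemma reachLP a b : a < (2 * M).+1 -> b < (2 * M).+1 ->
  reflect (Lc ps i j (cellp M a b)) (reach x i.-1 i (sc x j) a b).
Proof.
move=> ha hb; rewrite sc_ok //; apply: reachP => //; first by lia.
by apply: leq_ltn_trans hj; lia.
Qed.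

Lemma reachRP a b : j.+1 < size ps -> a < (2 * M).+1 -> b < (2 * M).+1 ->
  reflect (Rc ps i j (cellp M a b)) (reach x (sc x j) i.-1 j a b).
Proof. by move=> hj1 ha hb; rewrite sc_ok //; apply: reachP => //; lia. Qed.

Lemma fin_ok : i < j -> reflect (finite_set (W ps o i j)) (fin x i j).
Proof.
move=> hij; apply: (equivP _ (iff_sym (fin_char hos ho hs hin hij hj hio hoj))).
rewrite /fin corner_ok sc_ok // nposS // -leqNgt -cellp_corner.
have cM : 2 * M < (2 * M).+1 by [].
have rL := reachLP cM cM; rewrite sc_ok // in rL.
apply: (iffP andP) => [[h1 h2]|[h1 h2]]; split.
- by case/orP: h1 => [/eqP->|/rL]; [left|right].
- case/orP: h2 => h2; [by left|].
  have [hj1|hj1] := leqP (size ps) j.+1; first by left.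
  by right=> h; move: h2; have := reachRP hj1 cM cM; rewrite sc_ok // => /introT/(_ h) ->.
- by case: h1 => [->//|/rL ->]; rewrite orbT.
- case: h2 => [->//|h2]; have [//|hj1] := leqP (size ps) j.+1.
  by apply/negP => h; apply: h2; have := reachRP hj1 cM cM; rewrite sc_ok // => /elimT; apply.
Qed.

Lemma interf_ok : 0 < i -> i < j -> j.+1 < size ps -> reflect (NI ps o i j) (~~ interf x i j).
Proof.
move=> hi hij hj1; apply: (equivP _ (iff_sym (NI_char ho hs hij hj hio hoj hi hj1))).
have hdim := dim_ok hos hs hsu hB hM.
apply: (iffP negP) => [h c c' hL hR|h]; last first.
  case/exbP=> a; rewrite hdim => ha /exbP[b hb /exbP[a' ha' /exbP[b' hb' /and3P[]]]].
  rewrite (nearb_ok M) => hn /(reachLP ha hb) hL /(reachRP hj1 ha' hb') hR.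
  by have := h _ _ hL hR; rewrite hn.
apply/negP => hn; apply: h.
have out u v d : ~~ inside M d -> clear (seg ps u v) d by apply: (clear_outside hos hs hin).
have pin q : q < size ps -> inbox M 'p_q by move=> hq; apply: (p_inbox hos ho hs hsu hB hM hq).
(* The interfering cells may lie outside the grid. Clamping keeps them in their regions and near
   each other. *)
have hL' : Lc ps i j (clamp M c).
  apply: conn_sub (conn_clamp (out _ _) (pin _ _) hL) => [d /andP[]//|].
  by apply: leq_ltn_trans hj; lia.
have hR' : Rc ps i j (clamp M c').
  by apply: conn_sub (conn_clamp (out _ _) (pin _ hj1) hR) => d /andP[].
have [a1 a2 a3] := cellpK (clamp_inbox M c).
have [b1 b2 b3] := cellpK (clamp_inbox M c').
apply/exbP; exists (xof M (clamp M c)); rewrite hdim //.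
apply/exbP; exists (yof M (clamp M c)) => //.
apply/exbP; exists (xof M (clamp M c')) => //.
apply/exbP; exists (yof M (clamp M c')) => //.
rewrite (nearb_ok M) a3 b3 near_clamp //=; apply/andP; split.
  by apply/reachLP => //; rewrite a3.
by apply/reachRP => //; rewrite b3.
Qed.
End Pair.

Lemma algo_ok : reflect (CNI ps o) (algo x).
Proof.
have horig := orig_ok hos hs hsu hB hM hw.
have hM1 : 1 <= M by [].
rewrite /algo (npos_ok hos hs hsu hB hM hw hM1) -leqNgt horig.
have [hn|hn] := leqP (size ps) 1; first by apply: ReflectT; apply: CNI_single.
(* The test decides finiteness, which replaces a classical case distinction. *)
have dec i j : i <= o -> o <= j -> i < j -> j < size ps ->
    finite_set (W ps o i j) \/ ~ finite_set (W ps o i j).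
  by move=> h1 h2 h3 h4; case: (fin_ok h1 h2 h4 h3); [left|right].
apply: (equivP _ (iff_sym (CNI_char hos ho hs hn dec))).
have oM := size_lt_M hos.
rewrite /= sc_ok // nposS // -leqNgt.
apply: (iffP and3P) => [[h1 h2 h3]|[h1 h2 h3]]; split.
- move=> ho0; have hlt : o.-1 < o by lia.
  by case/orP: h1 => [/eqP e|/(fin_ok (leq_pred o) (leqnn o) hos hlt)//]; rewrite e in ho0.
- move=> ho1; case/orP: h2 => [|/(fin_ok (leqnn o) (leqnSn o) ho1 (ltnSn o))//].
  by rewrite leqNgt ho1.
- move=> i j hi hio hoj hij hj hF; have hj' := ltnW hj; have hjM := size_lt_M hj'.
  apply/(interf_ok hio hoj hj' hi hij hj); apply/negP => hI; case/negP: h3.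
  have iM : i < M by have := sizeM; lia.
  have jM : j < M by have := sizeM; lia.
  apply/exbP; exists i; rewrite ?hM //; apply/exbP; exists j; rewrite ?hM //.
  rewrite /bad horig hi hio hoj hij sc_ok // nposS // hj hI andbT /=.
  case: hF => hF; apply/orP; [left|right]; apply/fin_ok => //; try lia.
- have [//|ho0] := posnP o; have hlt : o.-1 < o by lia.
  by apply/orP; right; apply/negP => /(fin_ok (leq_pred o) (leqnn o) hos hlt)/(h1 ho0).
- have [//|ho1] := leqP (size ps) o.+1.
  by apply/negP => /(fin_ok (leqnn o) (leqnSn o) ho1 (ltnSn o))/(h2 ho1).
- apply/negP => /exbP[i hi /exbP[j hj /and5P[h4 h5 h6 h7 /and3P[h8 h9 h10]]]].
  rewrite horig in h5 h6.
  have hjn : j.+1 < size ps by rewrite -nposS // -(sc_ok hj).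
  have hj' := ltnW hjn.
  have hF : finite_set (W ps o i.-1 j) \/ finite_set (W ps o i j.+1).
    rewrite sc_ok // in h9; case/orP: h9 => h9; [left|right].
      by apply/fin_ok: h9 => //; lia.
    by apply/fin_ok: h9 => //; lia.
  have /(interf_ok h5 h6 hj' h4 h7 hjn) := h3 i j h4 h5 h6 h7 hjn hF.
  by rewrite h10.
Qed.
End Correctness.

Theorem theorem14 :
  exists (M : TM) (c k : nat),
    forall (ps : seq pos) (o : nat), is_config ps o ->
      exists t : nat,
        (t <= c * (size (enc_config ps o)).+1 ^ k)%N /\
        exists b : bool,
          halt M (tm_state (tm_run M t (enc_config ps o))) = Some b /\
          (b = true <-> CNI ps o).
Proof.
have [M [c [k h]]] := algo_machine; exists M, c, k => ps o /is_configE[hos ho hs].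
have [t ht hr] := h (enc_config ps o); exists t; split=> //.
by exists (algo (input_ctx (enc_config ps o))); split=> //; split=> [/algo_ok|/algo_ok]; apply.
Qed.
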